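(* On $\mathcal{SF}(\mathbb{C})$, the Hilbert space adjoints of the backward shift operators $R_\infty$ and $L_\infty$ satisfy $$R_{\infty}^{*}=I_\infty\qquad\text{and}\qquad L_{\infty}^{*}=J_\infty.$$
   Context: $\mathcal{F}(\mathbb{C})$ is the classical Fock space of entire functions $h$ with $\|h\|^2_{\mathcal F(\mathbb C)}=\frac1\pi\int_{\mathbb C}|h(z)|^2e^{-|z|^2}dA(z)<\infty$. The polyanalytic Fock space of infinite order $\mathcal{SF}(\mathbb{C})$ is the set of functions $f(z)=\sum_{n=0}^{\infty}\overline{z}^nf_n(z)$ with $f_n\in\mathcal{F}(\mathbb{C})$ for all $n\ge0$ and $\|f\|^2_{\mathcal{SF}(\mathbb{C})}=\sum_{n=0}^{\infty}n!\,\|f_n\|^2_{\mathcal{F}(\mathbb{C})}<\infty$, with scalar product $\langle f,g\rangle_{\mathcal{SF}(\mathbb{C})}=\sum_{k}k!\,\langle f_k,g_k\rangle_{\mathcal{F}(\mathbb{C})}$. Its elements can also be written $g(z)=\sum_{m=0}^\infty z^mg_m(\overline z)$ with $g_m$ power series in $\overline z$. For $f=\sum_n\overline z^nf_n(z)$ and $g=\sum_mz^mg_m(\overline z)$: $$R_\infty(f)=\frac1z\Big(f-\sum_{n=0}^\infty\overline z^nf_n(0)\Big),\qquad L_\infty(g)=\frac1{\overline z}\Big(g-\sum_{m=0}^\infty z^mg_m(0)\Big),$$ $$I_\infty(f)=\sum_{n=0}^\infty\overline z^nI(f_n)(z),\qquad J_\infty(g)=\sum_{m=0}^\infty z^mJ(g_m)(\overline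 z),$$ where $I$ is integration from $0$ in the variable $z$ and $J$ is integration from $0$ in the variable $\overline z$; thus $I_\infty(\overline z^nz^m)=\frac{\overline z^nz^{m+1}}{m+1}$ and $J_\infty(\overline z^nz^m)=\frac{\overline z^{n+1}z^m}{n+1}$. *)

(* Defs.v *)
From mathcomp Require Import all_boot all_order all_algebra.
From mathcomp Require Import complex.
From mathcomp Require Import all_classical all_reals all_analysis.

Set Implicit Arguments.
Unset Strict Implicit.
Unset Printing Implicit Defensive.

Import Order.TTheory GRing.Theory Num.Theory.
Import numFieldNormedType.Exports.

Local Open Scope classical_set_scope.
Local Open Scope ring_scope.

(* R[i] packed as a numClosedFieldType: in this form the topology and the
   normed structure of an arbitrary numFieldType apply to it. In particular
   [derivable h z 1] over [CC R] is complex differentiability. *)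
Definition CC (R : realType) : numClosedFieldType := R[i].

Section Fock.
Variable R : realType.
Local Notation C := (CC R).
Implicit Types (h k : C -> C) (z w : C).

Definition toC (x y : R) : C := Complex x y.
Definition reC z : R := complex.Re z.
Definition imC z : R := complex.Im z.
Definition absC z : R := ComplexField.Normc.normc z.

Definition entire h := forall z, derivable h z 1.

(* area measure dA = dx dy *)
Local Notation area := ((@lebesgue_measure R) \x (@lebesgue_measure R))%E.

Definition gauss_weight (p : R * R) : R := expR (- (p.1 ^+ 2 + p.2 ^+ 2)).

Definition fock_norm2 h : \bar R :=
  ((pi^-1)%:E *
   \int[area]_p (absC (h (toC p.1 p.2)) ^+ 2 * gauss_weight p)%:E)%E.

Definition fock : set (C -> C) :=
  [set h | entire h /\ (fock_norm2 h < +oo)%E].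

Definition fock_ip h k : C :=
  let u (p : R * R) := h (toC p.1 p.2) * (k (toC p.1 p.2))^* in
  toC (pi^-1 * \int[area]_p (reC (u p) * gauss_weight p))
      (pi^-1 * \int[area]_p (imC (u p) * gauss_weight p)).

Definition csum (u : nat -> C) : C := limn (series u).

(* [u] is the sequence of components of [f], i.e. f(z) = sum_n conj(z)^n u_n(z)
   with u_n in the Fock space and finite SF norm; it is determined by [f]. *)
Definition sf_decomp (f : C -> C) (u : nat -> C -> C) :=
  [/\ forall n, fock (u n),
      (\sum_(0 <= n <oo) ((n`!)%:R%:E * fock_norm2 (u n)) < +oo)%E &
      forall z, series (fun n => z^* ^+ n * u n z) @ \oo --> f z].

Definition SF : set (C -> C) := [set f | exists u, sf_decomp f u].

Definition sf_coef (f : C -> C) : nat -> C -> C :=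
  xget (fun _ _ => 0) [set u | sf_decomp f u].

Definition sf_norm2 (f : C -> C) : \bar R :=
  (\sum_(0 <= n <oo) ((n`!)%:R%:E * fock_norm2 (sf_coef f n)))%E.

Definition sf_norm (f : C -> C) : R := Num.sqrt (fine (sf_norm2 f)).

Definition sf_ip (f g : C -> C) : C :=
  csum (fun n => (n`!)%:R * fock_ip (sf_coef f n) (sf_coef g n)).

(* g(z) = sum_m z^m v_m(conj z), where the v_m are everywhere convergent power
   series v_m(w) = sum_n b_mn w^n and the double power series
   sum_mn b_mn z^m conj(z)^n converges absolutely on C. For g in SF this
   is the regrouping by powers of z of the double series underlying the
   decomposition [sf_decomp]; absolute convergence makes [v] unique. *)
Definition sfbar_decomp (g : C -> C) (v : nat -> C -> C) :=
  exists b : nat -> nat -> C,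
  [/\ forall r : R, 0 <= r ->
        (\sum_(0 <= m <oo) \sum_(0 <= n <oo)
           (absC (b m n) * r ^+ (m + n))%:E < +oo)%E,
      forall m w, series (fun n => b m n * w ^+ n) @ \oo --> v m w &
      forall z, series (fun m => z ^+ m * v m z^*) @ \oo --> g z].

Definition sfbar_coef (g : C -> C) : nat -> C -> C :=
  xget (fun _ _ => 0) [set v | sfbar_decomp g v].

(* quotients by z and conj(z) are extended to the origin by continuity *)
Definition extend0 (q : C -> C) z : C :=
  if z == 0 then lim (q w @[w --> 0^']) else q z.

Definition Rinf (f : C -> C) : C -> C :=
  extend0 (fun z => z^-1 * (f z - csum (fun n => z^* ^+ n * sf_coef f n 0))).

Definition Linf (g : C -> C) : C -> C :=
  extend0 (fun z =>
    (z^*)^-1 * (g z - csum (fun m => z ^+ m * sfbar_coef g m 0))).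

(* integral of h from 0 to z, along the segment t |-> t z *)
Definition prim h z : C :=
  z * toC (\int[lebesgue_measure]_(t in `[0, 1]) reC (h (toC t 0 * z)))
          (\int[lebesgue_measure]_(t in `[0, 1]) imC (h (toC t 0 * z))).

Definition Iinf (f : C -> C) : C -> C :=
  fun z => csum (fun n => z^* ^+ n * prim (sf_coef f n) z).

Definition Jinf (g : C -> C) : C -> C :=
  fun z => csum (fun m => z ^+ m * prim (sfbar_coef g m) z^*).

Definition sf_bounded_operator (T : (C -> C) -> (C -> C)) :=
  [/\ forall f, SF f -> SF (T f),
      forall (a : C) f g, SF f -> SF g ->
        T (fun z => a * f z + g z) = (fun z => a * T f z + T g z) &
      exists M : R, forall f, SF f -> sf_norm (T f) <= M * sf_norm f].

(* T^* = S on the Hilbert space SF: for each g in SF, [S g] is the one and only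
   vector h of SF such that <T f, g> = <f, h> for all f in SF. *)
Definition sf_adjoint (T S : (C -> C) -> (C -> C)) :=
  sf_bounded_operator T /\
  forall g, SF g ->
    SF (S g) /\
    forall h, SF h ->
      (forall f, SF f -> sf_ip (T f) g = sf_ip f h) <-> h = S g.

End Fock.

(* Main.v *)
Require Import Defs.
From HB Require Import structures.
From mathcomp Require Import all_boot all_order all_algebra.
From mathcomp Require Import complex.
From mathcomp Require Import all_classical all_reals all_analysis.
From mathcomp Require Import cyclic separable cyclotomic.
From mathcomp Require Import measurable_realfun.
From mathcomp Require Import ring lra zify.

(* An element of SF is a double series f(z) = sum_nm a_nm conj(z)^n z^m. The
   monomials z^m are orthogonal in the Fock space, of squared norm m!, so that
   ||f||^2 = sum_nm n! m! |a_nm|^2, <f, g> = sum_nm n! m! a_nm conj(b_nm), and f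
   determines the matrix a. On matrices, R_oo is the shift a_n(m+1) and I_oo is the
   weighted shift sending b_nm to position (n, m+1) with the factor 1/(m+1); they are
   adjoint because (m+1)!/(m+1) = m!. Transposing the matrix, i.e. composing f with
   the conjugation, is an isometry that exchanges R_oo with L_oo and I_oo with J_oo.

   The Fock norm of sum_k c_k z^k is computed without polar coordinates: averaging
   over the rotations by roots of unity kills the cross terms (the area measure is
   rotation invariant, a rotation being a product of shears), and the moments
   int |z|^(2k) e^(-|z|^2) dA = pi k! come from the Gaussian integrals
   int e^(-(1-t)|z|^2) dA = pi/(1-t). *)

Set Implicit Arguments.
Unset Strict Implicit.
Unset Printing Implicit Defensive.
Import Order.TTheory GRing.Theory Num.Theory.
Import numFieldNormedType.Exports.
Local Open Scope classical_set_scope.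
Local Open Scope ring_scope.

(** * Complex numbers and series *)

(** Passing to matrices is not formal, because the components [u n] are only assumed complex
    differentiable at every point. Their power series come from Goursat's theorem, which asks for no
    continuity of the derivative; applied to functions of exp(s + i t) on rectangles, it makes
    integrals over circles centred at 0 independent of the radius, and Cauchy's formula follows.

    The coefficients [sf_coef] and [sfbar_coef] are chosen by [xget], so uniqueness of the matrix is
    a genuine step: the part of lowest total degree is isolated by the behaviour at 0, and dividing
    it by a power of z leaves a polynomial in conj z / z.

    For the norm formula no dominating function is exhibited; each of the two inequalities between
    integrals is an instance of Fatou's lemma. Double series are summed over squares, a form that
    transposition preserves. The factors 2 in the integral estimates come from bounding real and
    imaginary parts separately. *)

Section ComplexModulus.
Variable R : realType.
Local Notation C := (CC R).
Implicit Types (z w : C) (r : R).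

Lemma CC_eqP z w : reC z = reC w -> imC z = imC w -> z = w.
Proof. by case: z => a b; case: w => c d /= -> ->. Qed.

Lemma reCD z w : reC (z + w) = reC z + reC w. Proof. by case: z; case: w. Qed.
Lemma imCD z w : imC (z + w) = imC z + imC w. Proof. by case: z; case: w. Qed.
Lemma reCN z : reC (- z) = - reC z. Proof. by case: z. Qed.
Lemma imCN z : imC (- z) = - imC z. Proof. by case: z. Qed.
Lemma reCB z w : reC (z - w) = reC z - reC w. Proof. by rewrite reCD reCN. Qed.
Lemma imCB z w : imC (z - w) = imC z - imC w. Proof. by rewrite imCD imCN. Qed.
Lemma reCM z w : reC (z * w) = reC z * reC w - imC z * imC w.
Proof. by case: z; case: w. Qed.
Lemma imCM z w : imC (z * w) = reC z * imC w + imC z * reC w.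
Proof. by case: z => a b; case: w => c d. Qed.
Lemma conjCE z : z^* = toC (reC z) (- imC z).
Proof.
case: z => a b; rewrite /toC /reC /imC /=.
have -> : (Complex a b : C) = Complex a 0 + 'i * Complex b 0.
  rewrite -complexiE; apply: CC_eqP; rewrite ?(reCD, imCD, reCM, imCM) /=; ring.
rewrite rmorphD rmorphM /= conjCi !conj_Creal ?complex_real ?eqxx//.
by rewrite -complexiE; apply: CC_eqP;
  rewrite ?(reCD, imCD, reCM, imCM, reCN, imCN) /=; ring.
Qed.
Lemma reC_conj z : reC z^* = reC z. Proof. by rewrite conjCE. Qed.
Lemma imC_conj z : imC z^* = - imC z. Proof. by rewrite conjCE. Qed.

Lemma toCE r : toC r 0 = real_complex R r. Proof. by []. Qed.

Lemma normCE z : `|z| = toC (absC z) 0.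
Proof. by case: z => a b; rewrite normc_def. Qed.

Lemma absC_sqr z : absC z ^+ 2 = reC z ^+ 2 + imC z ^+ 2.
Proof. by case: z => a b; rewrite /absC /= sqr_sqrtr// addr_ge0// sqr_ge0. Qed.

Lemma absC_ge0 z : 0 <= absC z. Proof. by case: z => a b; exact: sqrtr_ge0. Qed.

Lemma absCM z w : absC (z * w) = absC z * absC w.
Proof. exact: ComplexField.Normc.normcM. Qed.
Lemma absC0 : absC 0 = 0 :> R. Proof. exact: ComplexField.Normc.normc0. Qed.
Lemma absC1 : absC 1 = 1 :> R. Proof. exact: ComplexField.Normc.normc1. Qed.
Lemma absCV z : absC z^-1 = (absC z)^-1.
Proof. exact: ComplexField.Normc.normcV. Qed.
Lemma absCX z n : absC (z ^+ n) = absC z ^+ n.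
Proof. by elim: n => [|n IH]; rewrite ?expr0 ?absC1// !exprS absCM IH. Qed.
Lemma absC_eq0 z : (absC z == 0) = (z == 0).
Proof.
by apply/eqP/eqP => [|->]; [exact: ComplexField.Normc.eq0_normc|exact: absC0].
Qed.
Lemma absC_gt0 z : (0 < absC z) = (z != 0).
Proof. by rewrite lt0r absC_eq0 absC_ge0 andbT. Qed.
Lemma absCN z : absC (- z) = absC z.
Proof. by case: z => a b; rewrite /absC /= !sqrrN. Qed.
Lemma absC_dist z w : absC (z - w) = absC (w - z).
Proof. by rewrite -absCN opprB. Qed.
Lemma ler_absCD z w : absC (z + w) <= absC z + absC w.
Proof. exact: le_normcD. Qed.
Lemma ler_absCB z w : absC (z - w) <= absC z + absC w.
Proof. by rewrite -(absCN w) ler_absCD. Qed.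
Lemma ler_absC_sub z w : absC z - absC w <= absC (z - w).
Proof. by rewrite lerBlDr (le_trans _ (ler_absCD _ _))// subrK. Qed.
Lemma ler_absC_dist z w v : absC (z - w) <= absC (z - v) + absC (v - w).
Proof. by rewrite (le_trans _ (ler_absCD _ _))// addrA subrK. Qed.
Lemma absC_conj z : absC z^* = absC z.
Proof. by rewrite conjCE; case: z => a b; rewrite /absC /= sqrrN. Qed.
Lemma absC_toC r : absC (toC r 0) = `|r|.
Proof. by rewrite /absC /= expr0n /= addr0 sqrtr_sqr. Qed.
Lemma natCE n : (n%:R : C) = toC n%:R 0.
Proof. by rewrite toCE rmorph_nat. Qed.
Lemma absC_nat n : absC (n%:R : C) = n%:R.
Proof. by rewrite natCE absC_toC normr_nat. Qed.

Lemma ler_reC z : `|reC z| <= absC z.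
Proof.
rewrite -(ler_pXn2r (ltn0Sn 1)) ?nnegrE ?absC_ge0// absC_sqr real_normK ?num_real//.
by rewrite lerDl sqr_ge0.
Qed.
Lemma ler_imC z : `|imC z| <= absC z.
Proof.
rewrite -(ler_pXn2r (ltn0Sn 1)) ?nnegrE ?absC_ge0// absC_sqr real_normK ?num_real//.
by rewrite lerDr sqr_ge0.
Qed.
Lemma toC_reim z : toC (reC z) (imC z) = z. Proof. by case: z. Qed.
Lemma absC_le_reim z : absC z <= `|reC z| + `|imC z|.
Proof.
rewrite -(ler_pXn2r (ltn0Sn 1)) ?nnegrE ?absC_ge0 ?addr_ge0// absC_sqr.
rewrite sqrrD !real_normK ?num_real// lerD2r lerDl mulrn_wge0//.
Qed.
Lemma absC_sum (I : Type) (s : seq I) (P : pred I) (F : I -> C) :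
  absC (\sum_(i <- s | P i) F i) <= \sum_(i <- s | P i) absC (F i).
Proof.
elim/big_ind2 : _ => [|x u y v hx hy|//]; first by rewrite absC0.
by rewrite (le_trans (ler_absCD _ _))// lerD.
Qed.
Lemma reC_sum (I : Type) (s : seq I) (P : pred I) (F : I -> C) :
  reC (\sum_(i <- s | P i) F i) = \sum_(i <- s | P i) reC (F i).
Proof. by elim/big_rec2 : _ => [//|i y x _ <-]; rewrite reCD. Qed.
Lemma imC_sum (I : Type) (s : seq I) (P : pred I) (F : I -> C) :
  imC (\sum_(i <- s | P i) F i) = \sum_(i <- s | P i) imC (F i).
Proof. by elim/big_rec2 : _ => [//|i y x _ <-]; rewrite imCD. Qed.

Lemma mulC_conj z : z * z^* = toC (absC z ^+ 2) 0.
Proof.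
by rewrite conjCE; apply: CC_eqP; rewrite ?(reCM, imCM) /= ?absC_sqr; ring.
Qed.

End ComplexModulus.

(** * Convergence in the complex plane through real moduli *)

Section ComplexTopology.
Variable R : realType.
Local Notation C := (CC R).
Implicit Types (z w : C) (r : R).

Lemma normC_lt z w r : (`|z - w| < toC r 0) = (absC (z - w) < r).
Proof. by rewrite normCE ltcR. Qed.

Lemma gt0_toC (e : C) : 0 < e -> e = toC (reC e) 0 /\ 0 < reC e.
Proof. by case: e => a b; rewrite ltcE /= => /andP[/eqP -> ->]. Qed.

(** A positive element of [C] is a positive real, so the complex tolerance of the normed structure
    can be traded for a real one. *)
Lemma cvgCP {T} {F : set_system T} {FF : Filter F} (f : T -> C) (l : C) :
  f @ F --> l <-> forall e, 0 < e -> \forall x \near F, absC (l - f x) < e.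
Proof.
split=> [/cvgrPdist_lt h e e0|h].
  have := h (toC e 0); rewrite ltcR => /(_ e0).
  by apply: filterS => x; rewrite normC_lt.
apply/cvgrPdist_lt => e /gt0_toC[-> /h].
by apply: filterS => x; rewrite normC_lt.
Qed.

Lemma cvgC_dominated (u : nat -> C) (v : nat -> R) (l : C) :
  (forall n, absC (l - u n) <= v n) -> v @ \oo --> 0 -> u @ \oo --> l.
Proof.
move=> uv /cvgrPdist_lt v0; apply/cvgCP => e /v0.
apply: filterS => n; rewrite sub0r normrN; apply: le_lt_trans.
exact: le_trans (uv n) (ler_norm _).
Qed.

Lemma cvgC_reim (u : nat -> C) (l : C) :
  @reC R \o u @ \oo --> reC l -> @imC R \o u @ \oo --> imC l -> u @ \oo --> l.
Proof.
move=> hr hi; apply: (@cvgC_dominated _ (fun n => `|reC l - reC (u n)| +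
  `|imC l - imC (u n)|)).
  by move=> n; rewrite -reCB -imCB absC_le_reim.
rewrite -[X in _ --> X]addr0; apply: cvgD.
  rewrite -[X in _ --> X](@normr0 _ R) -(subrr (reC l)).
  by apply: cvg_norm; apply: cvgB => //; exact: cvg_cst.
rewrite -[X in _ --> X](@normr0 _ R) -(subrr (imC l)).
by apply: cvg_norm; apply: cvgB => //; exact: cvg_cst.
Qed.

Lemma cvg_reC {T} {F : set_system T} {FF : Filter F} (f : T -> C) (l : C) :
  f @ F --> l -> @reC R \o f @ F --> reC l.
Proof.
move=> /cvgCP h; apply/cvgrPdist_lt => e /h; apply: filterS => x /=.
by rewrite -reCB; apply: le_lt_trans; exact: ler_reC.
Qed.
Lemma cvg_imC {T} {F : set_system T} {FF : Filter F} (f : T -> C) (l : C) :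
  f @ F --> l -> @imC R \o f @ F --> imC l.
Proof.
move=> /cvgCP h; apply/cvgrPdist_lt => e /h; apply: filterS => x /=.
by rewrite -imCB; apply: le_lt_trans; exact: ler_imC.
Qed.
Lemma cvg_absC {T} {F : set_system T} {FF : Filter F} (f : T -> C) (l : C) :
  f @ F --> l -> @absC R \o f @ F --> absC l.
Proof.
move=> /cvgCP h; apply/cvgrPdist_lt => e /h; apply: filterS => x /=.
apply: le_lt_trans; rewrite ler_norml ler_absC_sub andbT lerNl opprB.
by rewrite absC_dist ler_absC_sub.
Qed.

Lemma cvgC_unique (u : nat -> C) (l l' : C) :
  u @ \oo --> l -> u @ \oo --> l' -> l = l'.
Proof. by move=> h h'; apply: (cvg_unique _ h h'). Qed.

Lemma limC_eq (u : nat -> C) (l : C) : u @ \oo --> l -> limn u = l.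
Proof. by move=> h; apply/cvg_lim. Qed.

Lemma csum_eq (u : nat -> C) (l : C) : series u @ \oo --> l -> csum u = l.
Proof. exact: limC_eq. Qed.

Lemma ler_lim_cst (u : nat -> R) (l B : R) :
  u @ \oo --> l -> (forall n, u n <= B) -> l <= B.
Proof.
move=> h hB; rewrite -(cvg_lim _ h)//; apply: limr_le.
  by apply/cvg_ex; exists l.
by apply: nearW.
Qed.

Lemma ler_absC_lim (u : nat -> C) (l : C) B :
  u @ \oo --> l -> (forall n, absC (u n) <= B) -> absC l <= B.
Proof. by move=> /cvg_absC h hB; apply: ler_lim_cst h _. Qed.

End ComplexTopology.

Lemma cvg_sum_nat (K : numFieldType) (V : normedModType K) (f : nat -> nat -> V)
    (a : nat -> V) N : (forall n, f n @ \oo --> a n) ->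
  (fun M => \sum_(0 <= n < N) f n M) @ \oo --> \sum_(0 <= n < N) a n.
Proof.
move=> fa; elim: N => [|N IH].
  by rewrite big_geq//; under eq_fun do rewrite big_geq//; exact: cvg_cst.
by rewrite big_nat_recr//=; under eq_fun do rewrite big_nat_recr//=; exact: cvgD.
Qed.

(** * Absolutely convergent simple and double series *)

Section AbsoluteConvergence.
Variable R : realType.
Local Notation C := (CC R).

Lemma nneg_series_cvg (u : nat -> R) (B : R) : (forall k, 0 <= u k) ->
  (forall N, \sum_(0 <= k < N) u k <= B) ->
  exists T : R, [/\ series u @ \oo --> T, T <= B &
                    forall N, \sum_(0 <= k < N) u k <= T].
Proof.
move=> u0 uB.
have nd : nondecreasing_seq (series u).
  move=> m n mn; rewrite /series /= -subr_ge0 -/(series u n) -/(series u m).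
  by rewrite sub_series_geq// sumr_ge0.
have cu : cvgn (series u).
  by apply: nondecreasing_is_cvgn => //; exists B => _ [n _ <-]; exact: uB.
have /cvg_ex[T hT] := cu.
exists T; split => //; first exact: ler_lim_cst hT uB.
by move=> N; rewrite -(cvg_lim _ hT)//; apply: nondecreasing_cvgn_le.
Qed.

Lemma absC_series_cvg (u : nat -> C) (B : R) :
  (forall N, \sum_(0 <= k < N) absC (u k) <= B) ->
  exists l : C, series u @ \oo --> l.
Proof.
move=> uB.
have cv (p : C -> R) : (forall x, `|p x| <= absC x) -> cvgn (series (p \o u)).
  move=> hp; apply: normed_cvg.
  have [|N|T [hT _ _]] := @nneg_series_cvg (fun k => `|p (u k)|) B.
  - by [].
  - by rewrite (le_trans _ (uB N))//; apply: ler_sum => i _; exact: hp.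
  - by apply/cvg_ex; exists T.
have /cvg_ex[a ha] := cv (@reC R) (@ler_reC R).
have /cvg_ex[b hb] := cv (@imC R) (@ler_imC R).
exists (toC a b); apply: cvgC_reim.
  by rewrite (_ : _ \o _ = series (@reC R \o u))//; apply/funext => n /=; rewrite reC_sum.
by rewrite (_ : _ \o _ = series (@imC R \o u))//; apply/funext => n /=; rewrite imC_sum.
Qed.

(** Since [B] bounds every absolute partial sum, a section beyond [N] has absolute sum at most [B]
    minus the part already summed; the limit keeps this. *)
Lemma absC_series_tail (u : nat -> C) (l : C) (B : R) :
  (forall N, \sum_(0 <= k < N) absC (u k) <= B) -> series u @ \oo --> l ->
  forall N, absC (l - \sum_(0 <= k < N) u k) <= B - \sum_(0 <= k < N) absC (u k).
Proof.
move=> uB ul N.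
have h : (fun M => series u (M + N)%N - \sum_(0 <= k < N) u k) @ \oo -->
         l - \sum_(0 <= k < N) u k.
  apply: cvgB; last exact: cvg_cst.
  by rewrite (@cvg_shiftn N _ (series u)).
apply: ler_absC_lim h _ => M.
rewrite /series /= (@big_cat_nat _ _ _ N 0 (M + N)) ?leq_addl//=.
rewrite addrAC subrr add0r (le_trans (absC_sum _ _ _))// lerBrDl.
by rewrite -(@big_cat_nat _ _ _ N)//=; exact: leq_addl.
Qed.

Lemma absC_series_le (u : nat -> C) (l : C) (B : R) :
  (forall N, \sum_(0 <= k < N) absC (u k) <= B) -> series u @ \oo --> l ->
  absC l <= B.
Proof.
by move=> uB /(absC_series_tail uB)/(_ 0%N); rewrite !big_geq// !subr0.
Qed.

Lemma rect_sum_le (u : nat -> nat -> R) (B : R) : (forall n m, 0 <= u n m) ->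
  (forall N, \sum_(0 <= n < N) \sum_(0 <= m < N) u n m <= B) ->
  forall N M, \sum_(0 <= n < N) \sum_(0 <= m < M) u n m <= B.
Proof.
move=> u0 uB N M; apply: le_trans (uB (N + M)%N).
rewrite [leRHS](@big_cat_nat _ _ _ N) ?leq_addr//= ler_wpDr//.
  by apply: sumr_ge0 => n _; exact: sumr_ge0.
apply: ler_sum => n _; rewrite [leRHS](@big_cat_nat _ _ _ M) ?leq_addl//= ler_wpDr//.
exact: sumr_ge0.
Qed.

Lemma row_sum_le (u : nat -> nat -> R) (B : R) : (forall n m, 0 <= u n m) ->
  (forall N, \sum_(0 <= n < N) \sum_(0 <= m < N) u n m <= B) ->
  forall n M, \sum_(0 <= m < M) u n m <= B.
Proof.
move=> u0 uB n M; apply: le_trans (rect_sum_le u0 uB n.+1 M).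
by rewrite big_nat_recr//= ler_wpDl//; apply: sumr_ge0 => i _; exact: sumr_ge0.
Qed.

Section DoubleSeries.
Variables (x : nat -> nat -> C) (S : R).
Hypothesis xS :
  forall N, \sum_(0 <= n < N) \sum_(0 <= m < N) absC (x n m) <= S.

Let x0 n m : 0 <= absC (x n m). Proof. exact: absC_ge0. Qed.

(** Sums over squares are symmetric in the two indices; that they share the limit of the iterated
    sum is what later permits exchanging rows and columns. *)
Lemma double_series_cvg : exists (y : nat -> C) (l : C),
  [/\ forall n, series (x n) @ \oo --> y n, series y @ \oo --> l &
      (fun N => \sum_(0 <= n < N) \sum_(0 <= m < N) x n m) @ \oo --> l].
Proof.
have row n : exists l : C, series (x n) @ \oo --> l.
  by apply: (@absC_series_cvg _ S) => N; exact: (row_sum_le x0 xS).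
have [y hy] := choice row.
have sub N (a : nat) : (fun M => \sum_(0 <= n < N) series (x n) (M + a)%N) @ \oo -->
    \sum_(0 <= n < N) y n.
  apply: (@cvg_sum_nat _ C (fun n M => series (x n) (M + a)%N)) => n.
  by rewrite (@cvg_shiftn a _ (series (x n))).
have yS N : \sum_(0 <= n < N) absC (y n) <= S.
  have h : (fun M => \sum_(0 <= n < N) absC (series (x n) M)) @ \oo -->
      \sum_(0 <= n < N) absC (y n).
    apply: (@cvg_sum_nat _ R (fun n M => absC (series (x n) M))) => n.
    exact: (cvg_absC (hy n)).
  apply: ler_lim_cst h _ => M; apply: le_trans (rect_sum_le x0 xS N M).
  by apply: ler_sum => n _; exact: absC_sum.
have [l hl] := absC_series_cvg yS.
exists y, l; split => //.
pose s N := \sum_(0 <= n < N) \sum_(0 <= m < N) absC (x n m).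
have snd : nondecreasing_seq s.
  move=> N M NM; rewrite /s [leRHS](@big_cat_nat _ _ _ N)//= ler_wpDr//.
    by apply: sumr_ge0 => n _; apply: sumr_ge0 => m _; exact: absC_ge0.
  apply: ler_sum => n _; rewrite [leRHS](@big_cat_nat _ _ _ N)//= ler_wpDr//.
  by apply: sumr_ge0 => m _; exact: absC_ge0.
have cs : cvgn s.
  by apply: nondecreasing_is_cvgn => //; exists S => _ [n _ <-]; exact: xS.
have /cvg_ex[T hT] := cs.
have sT N : s N <= T by rewrite -(cvg_lim _ hT)//; apply: nondecreasing_cvgn_le.
(* Extending the first [N] rows to length [M + N] adds only entries of the square of side [M + N]
   lying outside the square of side [N], so the increments of [s] control the error. *)
have key N : absC (\sum_(0 <= n < N) y n - \sum_(0 <= n < N) \sum_(0 <= m < N) x n m) <= T - s N.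
  have h : (fun M => \sum_(0 <= n < N) series (x n) (M + N)%N -
      \sum_(0 <= n < N) \sum_(0 <= m < N) x n m) @ \oo -->
      \sum_(0 <= n < N) y n - \sum_(0 <= n < N) \sum_(0 <= m < N) x n m.
    by apply: cvgB; [exact: sub|exact: cvg_cst].
  apply: ler_absC_lim h _ => M; rewrite -sumrB.
  apply: le_trans (absC_sum _ _ _) _; rewrite lerBrDr; apply: le_trans (sT (M + N)%N).
  rewrite /s -big_split/= [leRHS](@big_cat_nat _ _ _ N) ?leq_addl//= ler_wpDr//.
    by apply: sumr_ge0 => n _; apply: sumr_ge0 => m _; exact: absC_ge0.
  apply: ler_sum => n _; rewrite [leRHS](@big_cat_nat _ _ _ N) ?leq_addl//=.
  rewrite addrC lerD2l /series /= (@big_cat_nat _ _ _ N 0 (M + N)) ?leq_addl//=.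
  by rewrite addrAC subrr add0r absC_sum.
have h0 : (fun N => \sum_(0 <= n < N) y n - (\sum_(0 <= n < N) y n -
   \sum_(0 <= n < N) \sum_(0 <= m < N) x n m)) @ \oo --> l - 0.
  apply: cvgB; first exact: hl.
  apply: (@cvgC_dominated _ _ (fun N => T - s N)).
    by move=> N; rewrite sub0r absCN.
  by rewrite -(subrr T); apply: cvgB => //; exact: cvg_cst.
rewrite subr0 in h0; apply: cvg_trans h0; apply: near_eq_cvg.
by apply: nearW => N; rewrite opprB addrC subrK.
Qed.

End DoubleSeries.

(** Small positive reals [t] suffice: once the coefficients below [d] vanish, dividing by [t ^+ d]
    leaves [c d] plus a tail of order [t]. *)
Lemma power_series_eq0 (c : nat -> C) (r S : R) : 0 < r ->
  (forall N, \sum_(0 <= k < N) absC (c k) * r ^+ k <= S) ->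
  (forall t : R, 0 < t < r -> series (fun k => c k * (toC t 0) ^+ k) @ \oo --> (0 : C)) ->
  forall k, c k = 0.
Proof.
move=> r0 cS c0 d; elim/ltn_ind : d => d IH.
have S0 : 0 <= S by have := cS 0%N; rewrite big_geq.
have key t : 0 < t < r -> absC (c d) <= t * (S / r ^+ d.+1).
  move=> /[dup] /andP[t0 tr] /c0 h.
  rewrite -(ler_pM2r (exprn_gt0 d t0)).
  have h' : (fun N => series (fun k => c k * toC t 0 ^+ k) (N + d.+1)%N -
      c d * toC t 0 ^+ d) @ \oo --> 0 - c d * toC t 0 ^+ d.
    apply: cvgB; last exact: cvg_cst.
    by rewrite (@cvg_shiftn d.+1 _ (series _)).
  rewrite sub0r in h'.
  have -> : absC (c d) * t ^+ d = absC (- (c d * toC t 0 ^+ d)).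
    by rewrite absCN absCM absCX absC_toC gtr0_norm.
  apply: ler_absC_lim h' _ => N.
  rewrite /series /= (@big_cat_nat _ _ _ d.+1) ?leq_addl//= big_nat_recr//= big1_seq; last first.
    by move=> i /= /[!mem_index_iota] /andP[_ id]; rewrite IH// mul0r.
  rewrite add0r addrAC subrr add0r (le_trans (absC_sum _ _ _))//.
  apply: (@le_trans _ _ (\sum_(d.+1 <= i < N + d.+1) (t / r) ^+ d.+1 * (absC (c i) * r ^+ i))).
    apply: ler_sum_nat => i /andP[di _]; rewrite absCM absCX absC_toC gtr0_norm//.
    rewrite mulrCA ler_wpM2l ?absC_ge0//.
    rewrite -[i in t ^+ i](subnKC di) -[i in r ^+ i](subnKC di) !exprD.
    rewrite mulrA expr_div_n divfK ?expf_neq0 ?gt_eqF//.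
    rewrite ler_wpM2l ?exprn_ge0 ?(ltW t0)//.
    by rewrite lerXn2r ?nnegrE ?(ltW t0) ?(ltW r0) ?(ltW tr).
  rewrite -mulr_sumr expr_div_n exprS.
  have -> : t * (S / r ^+ d.+1) * t ^+ d = t * t ^+ d / r ^+ d.+1 * S.
    by rewrite mulrA mulrAC -!mulrA; congr (_ * _); rewrite mulrCA; congr (_ * _); rewrite mulrC.
  rewrite ler_wpM2l//.
    by rewrite mulr_ge0 ?invr_ge0 ?exprn_ge0 ?(ltW r0)// mulr_ge0 ?exprn_ge0 ?(ltW t0).
  apply: le_trans (cS (N + d.+1)%N); rewrite [leRHS](@big_cat_nat _ _ _ d.+1) ?leq_addl//=.
  by rewrite ler_wpDl// sumr_ge0// => i _; rewrite mulr_ge0 ?absC_ge0 ?exprn_ge0 ?(ltW r0).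
apply/eqP; rewrite -absC_eq0 eq_le absC_ge0 andbT.
apply/ler_addgt0Pl => e e0; rewrite addr0.
pose K := S / r ^+ d.+1.
have K0 : 0 <= K by rewrite divr_ge0// exprn_ge0// ltW.
(* The first entry keeps [t] below [r], the second makes [t * K] at most [e]. *)
pose t := Num.min (r / 2) (e / (K + 1)).
have t0 : 0 < t by rewrite lt_min !divr_gt0// ltr_wpDl.
apply: (@le_trans _ _ (t * K)).
  by apply: key; rewrite t0 /= gt_min ltr_pdivrMr// ltr_pMr ?ltr1n.
apply: (@le_trans _ _ (e / (K + 1) * K)); first by rewrite ler_wpM2r// ge_min lexx orbT.
rewrite mulrAC ler_pdivrMr ?ltr_wpDl// mulrDr mulr1 lerDl ltW//.
Qed.

End AbsoluteConvergence.

(** * Goursat's theorem and power series expansions of entire functions *)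

Section ComplexIntegral.
Variable R : realType.
Local Notation C := (CC R).
Local Notation mu := (@lebesgue_measure R).

Definition cint (a b : R) (F : R -> C) : C :=
  toC (\int[mu]_(t in `[a, b]) reC (F t)) (\int[mu]_(t in `[a, b]) imC (F t)).

Definition cont_on (a b : R) (F : R -> C) :=
  forall t, a <= t <= b -> F x @[x --> t] --> F t.

Lemma continuous_itv_integrable (a b : R) (f : R -> R) :
  (forall t, a <= t <= b -> f x @[x --> t] --> f t) ->
  mu.-integrable `[a, b] (EFin \o f).
Proof.
move=> cf; apply: continuous_compact_integrable; first exact: segment_compact.
apply: continuous_in_subspaceT => t /set_mem /=; rewrite in_itv /=.
exact: cf.
Qed.

Lemma Rintegral_const_bound (a b c M : R) (f : R -> R) : a <= b ->
  (forall t, a <= t <= b -> f x @[x --> t] --> f t) ->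
  (forall t, a <= t <= b -> `|f t - c| <= M) ->
  `|\int[mu]_(t in `[a, b]) f t - c * (b - a)| <= M * (b - a).
Proof.
move=> ab /continuous_itv_integrable fi fM.
have cstE (r : R) : \int[mu]_(t in `[a, b]) (fun=> r) t = r * (b - a).
  rewrite /= Rintegral_cst//= lebesgue_measure_itv /= lte_fin.
  by move: ab; rewrite le_eqVlt => /orP[/eqP ->|->//]; rewrite ltxx subrr.
have ci (r : R) : mu.-integrable `[a, b] (EFin \o (fun=> r)).
  by apply: continuous_itv_integrable => t _; exact: cvg_cst.
rewrite ler_distl -mulrBl -mulrDl -!cstE; apply/andP; split.
  apply: le_Rintegral => //.
  by move=> x /=; rewrite in_itv /= => /fM; rewrite ler_distl => /andP[].
apply: le_Rintegral => //.
by move=> x /=; rewrite in_itv /= => /fM; rewrite ler_distl => /andP[].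
Qed.

Section Continuous.
Variables (a b : R).
Implicit Types F G : R -> C.

Lemma cont_on_re F : cont_on a b F ->
  forall t, a <= t <= b -> reC (F x) @[x --> t] --> reC (F t).
Proof. by move=> cF t /cF/cvg_reC. Qed.
Lemma cont_on_im F : cont_on a b F ->
  forall t, a <= t <= b -> imC (F x) @[x --> t] --> imC (F t).
Proof. by move=> cF t /cF/cvg_imC. Qed.

Lemma eq_cint F G : (forall t, a <= t <= b -> F t = G t) -> cint a b F = cint a b G.
Proof.
by move=> FG; congr toC; apply: eq_Rintegral => t /set_mem /=; rewrite in_itv => /FG ->.
Qed.

(** The factor 2 is the price of treating real and imaginary parts separately; the later estimates
    absorb it in their constants. *)
Lemma cint_const_bound (c : C) (M : R) F : a <= b -> cont_on a b F ->
  (forall t, a <= t <= b -> absC (F t - c) <= M) ->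
  absC (cint a b F - c * toC (b - a) 0) <= 2 * M * (b - a).
Proof.
move=> ab cF FM; apply: le_trans (absC_le_reim _) _.
rewrite reCB imCB reCM imCM /= !mulr0 subr0 add0r -mulrA mulr_natl mulr2n lerD//.
  apply: Rintegral_const_bound => //; first exact: cont_on_re.
  by move=> t /FM; apply: le_trans; rewrite -reCB ler_reC.
apply: Rintegral_const_bound => //; first exact: cont_on_im.
by move=> t /FM; apply: le_trans; rewrite -imCB ler_imC.
Qed.

Lemma cint_bound (M : R) F : a <= b -> cont_on a b F ->
  (forall t, a <= t <= b -> absC (F t) <= M) ->
  absC (cint a b F) <= 2 * M * (b - a).
Proof.
move=> ab cF FM; have := @cint_const_bound 0 M F ab cF.
by rewrite mul0r subr0; apply => t /FM; rewrite subr0.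
Qed.

Lemma cont_onD F G : cont_on a b F -> cont_on a b G -> cont_on a b (fun t => F t + G t).
Proof. by move=> cF cG t tab; apply: cvgD; [exact: cF|exact: cG]. Qed.
Lemma cont_onB F G : cont_on a b F -> cont_on a b G -> cont_on a b (fun t => F t - G t).
Proof. by move=> cF cG t tab; apply: cvgB; [exact: cF|exact: cG]. Qed.
Lemma cont_onM F G : cont_on a b F -> cont_on a b G -> cont_on a b (fun t => F t * G t).
Proof. by move=> cF cG t tab; apply: cvgM; [exact: cF|exact: cG]. Qed.
Lemma cont_on_cst (c : C) : cont_on a b (fun=> c).
Proof. by move=> t _; exact: cvg_cst. Qed.

Lemma cintB F G : cont_on a b F -> cont_on a b G ->
  cint a b (fun t => F t - G t) = cint a b F - cint a b G.
Proof.
move=> cF cG; rewrite /cint; apply: CC_eqP; rewrite ?(reCB, imCB) /=.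
  rewrite -RintegralB//; [|by apply: continuous_itv_integrable; exact: cont_on_re..].
  by apply: eq_Rintegral => t _; rewrite reCB.
rewrite -RintegralB//; [|by apply: continuous_itv_integrable; exact: cont_on_im..].
by apply: eq_Rintegral => t _; rewrite imCB.
Qed.

Lemma cintD F G : cont_on a b F -> cont_on a b G ->
  cint a b (fun t => F t + G t) = cint a b F + cint a b G.
Proof.
move=> cF cG; rewrite /cint; apply: CC_eqP; rewrite ?(reCD, imCD) /=.
  rewrite -RintegralD//; [|by apply: continuous_itv_integrable; exact: cont_on_re..].
  by apply: eq_Rintegral => t _; rewrite reCD.
rewrite -RintegralD//; [|by apply: continuous_itv_integrable; exact: cont_on_im..].
by apply: eq_Rintegral => t _; rewrite imCD.
Qed.

Lemma cintZ (c : C) F : cont_on a b F ->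
  cint a b (fun t => c * F t) = c * cint a b F.
Proof.
move=> cF.
have iR : mu.-integrable `[a, b] (EFin \o (fun t => reC (F t))).
  by apply: continuous_itv_integrable; exact: cont_on_re.
have iI : mu.-integrable `[a, b] (EFin \o (fun t => imC (F t))).
  by apply: continuous_itv_integrable; exact: cont_on_im.
have iZ (r : R) f : mu.-integrable `[a, b] (EFin \o f) ->
    mu.-integrable `[a, b] (EFin \o (fun t => r * f t)).
  move=> fi; rewrite (_ : _ \o _ = (fun t => r%:E * (EFin \o f) t)%E)//.
  exact: integrableZl.
rewrite /cint; apply: CC_eqP; rewrite ?(reCM, imCM) /=.
  rewrite -!RintegralZl// -RintegralB//; [|exact: iZ..].
  by apply: eq_Rintegral => t _; rewrite reCM.
rewrite -!RintegralZl// -RintegralD//; [|exact: iZ..].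
by apply: eq_Rintegral => t _; rewrite imCM.
Qed.

Lemma cint_chasles (m : R) F : a <= m -> m <= b -> cont_on a b F ->
  cint a b F = cint a m F + cint m b F.
Proof.
move=> am mb cF.
have real f : mu.-integrable `[a, b] (EFin \o f) ->
    \int[mu]_(t in `[a, b]) f t =
    \int[mu]_(t in `[a, m]) f t + \int[mu]_(t in `[m, b]) f t.
  move=> fi; apply/eqP; rewrite addrC -subr_eq.
  rewrite Rintegral_itvB ?bnd_simp//= Rintegral_itv_obnd_cbnd//.
  by apply: integrableS fi => //; apply: subset_itvr; rewrite bnd_simp.
rewrite /cint; apply: CC_eqP; rewrite ?(reCD, imCD) /=; apply: real.
  by apply: continuous_itv_integrable; exact: cont_on_re.
by apply: continuous_itv_integrable; exact: cont_on_im.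
Qed.

End Continuous.

End ComplexIntegral.

(** * Bisection of rectangles *)

Lemma ex_half_pow_lt (R : realType) (x d : R) : 0 < d -> exists n, x / 2 ^+ n < d.
Proof.
move=> d0; exists (Num.bound (x / d)).
rewrite ltr_pdivrMr ?exprn_gt0// mulrC -ltr_pdivrMr//.
have [xd|xd] := leP 0 (x / d); last by rewrite (lt_trans xd)// exprn_gt0.
apply: lt_le_trans (archi_boundP xd) _.
by rewrite -natrX ler_nat ltnW// ltn_expl.
Qed.

Section Bisection.
Variables (R : realType) (P : R -> R -> R -> R -> Prop) (a L b T : R).
Hypotheses (L0 : 0 <= L) (T0 : 0 <= T).

Let inside x l y t := [/\ a <= x, x + l <= a + L, b <= y & y + t <= b + T].

(* [P x l y t] is a property of the rectangle [x, x + l] * [y, y + t]. *)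
Hypothesis glue : forall x l y t, 0 <= l -> 0 <= t -> inside x l y t ->
  P x (l / 2) y (t / 2) -> P (x + l / 2) (l / 2) y (t / 2) ->
  P x (l / 2) (y + t / 2) (t / 2) -> P (x + l / 2) (l / 2) (y + t / 2) (t / 2) ->
  P x l y t.
Hypothesis local : forall p q, a <= p <= a + L -> b <= q <= b + T ->
  exists2 d, 0 < d & forall x l y t, 0 <= l < d -> 0 <= t < d ->
    inside x l y t -> x <= p <= x + l -> y <= q <= y + t -> P x l y t.

(** If [P] fails on a rectangle, [glue] makes it fail on a quarter; the nested quarters shrink to a
    point, where [local] is contradicted. This one principle serves Goursat's theorem, boundedness
    on discs and uniform continuity along circles. *)
Lemma bisection : P a L b T.
Proof.
apply: contrapT => nP.
pose l n := L / 2 ^+ n; pose t n := T / 2 ^+ n.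
have l0 n : 0 <= l n by rewrite divr_ge0// exprn_ge0.
have t0 n : 0 <= t n by rewrite divr_ge0// exprn_ge0.
have lS n : l n / 2 = l n.+1 by rewrite /l exprSr invfM mulrA.
have tS n : t n / 2 = t n.+1 by rewrite /t exprSr invfM mulrA.
have l2 n : l n.+1 + l n.+1 = l n by rewrite -lS -splitr.
have t2 n : t n.+1 + t n.+1 = t n by rewrite -tS -splitr.
pose Inv n (z : R * R) := inside z.1 (l n) z.2 (t n) /\ ~ P z.1 (l n) z.2 (t n).
(* Stating the selection of a bad quarter as an implication makes it total, so that [choice] yields
   a function to iterate. *)
have step (z : nat * (R * R)) : exists w : R * R, Inv z.1 z.2 ->
   [/\ Inv z.1.+1 w, z.2.1 <= w.1, w.1 + l z.1.+1 <= z.2.1 + l z.1,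
       z.2.2 <= w.2 & w.2 + t z.1.+1 <= z.2.2 + t z.1].
  case: z => n [x y] /=.
  apply: contrapT => /forallNP h.
  have /not_implyP[[ins nPn] _] := h (x, y).
  move: (ins) => [ax xL b_y yT]; apply: nPn.
  have sub u v : u = x \/ u = x + l n.+1 -> v = y \/ v = y + t n.+1 ->
      P u (l n.+1) v (t n.+1).
    move=> hu hv; apply: contrapT => nP'; apply: (h (u, v)) => _ /=.
    have hx : x <= u /\ u + l n.+1 <= x + l n.
      by rewrite -(l2 n); case: hu => ->; have := l0 n.+1; split; lra.
    have hy : y <= v /\ v + t n.+1 <= y + t n.
      by rewrite -(t2 n); case: hv => ->; have := t0 n.+1; split; lra.
    case: hx hy => ? ? [? ?]; split => //; split => //=.
    rewrite /= in ax xL b_y yT.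
    by split; lra.
  apply: glue => //; rewrite lS tS; apply: sub; by [left|right].
have [f hf] := choice step.
pose s := fix s n := if n is m.+1 then f (m, s m) else (a, b).
have sInv n : Inv n (s n).
  elim: n => [|n /(hf (n, s n))[]//]; rewrite /Inv /= /l /t expr0 !divr1.
  by split.
have sx n : (s n).1 <= (s n.+1).1 by have [] := hf (n, s n) (sInv n).
have sxl n : (s n.+1).1 + l n.+1 <= (s n).1 + l n by have [] := hf (n, s n) (sInv n).
have sy n : (s n).2 <= (s n.+1).2 by have [] := hf (n, s n) (sInv n).
have syt n : (s n.+1).2 + t n.+1 <= (s n).2 + t n by have [] := hf (n, s n) (sInv n).
have nested (u v : nat -> R) : (forall n, 0 <= v n) -> (forall n, u n <= u n.+1) ->
    (forall n, u n.+1 + v n.+1 <= u n + v n) ->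
    exists p, forall n, u n <= p <= u n + v n.
  move=> v0 uS vS.
  have nu : nondecreasing_seq u by apply/nondecreasing_seqP.
  have nv : nonincreasing_seq (fun n => u n + v n) by apply/nonincreasing_seqP.
  have ub n m : u m <= u n + v n.
    have [mn|/ltnW nm] := leqP m n; first by rewrite (le_trans (nu _ _ mn))// lerDl.
    by rewrite (le_trans _ (nv _ _ nm))// lerDl.
  have cu : cvgn u.
    by apply: nondecreasing_is_cvgn => //; exists (u 0%N + v 0%N) => _ [n _ <-]; exact: ub.
  have /cvg_ex[p hp] := cu; exists p => n; apply/andP; split.
    by rewrite -(cvg_lim _ hp)//; apply: nondecreasing_cvgn_le.
  exact: ler_lim_cst hp (ub n).
have [p hp] := nested _ _ l0 sx sxl.
have [q hq] := nested _ _ t0 sy syt.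
have [||d d0 hd] := @local p q.
- by have := hp 0%N; rewrite /l expr0 divr1.
- by have := hq 0%N; rewrite /t expr0 divr1.
(* Both sides at stage [n] are at most [(L + T) / 2 ^+ n]. *)
have [n hn] := ex_half_pow_lt (L + T) d0.
have [ins nPn] := sInv n; apply: nPn; apply: hd => //.
  rewrite l0 /= (le_lt_trans _ hn)// /l ler_wpM2r ?invr_ge0 ?exprn_ge0//.
  by rewrite lerDl.
rewrite t0 /= (le_lt_trans _ hn)// /t ler_wpM2r ?invr_ge0 ?exprn_ge0//.
by rewrite lerDr.
Qed.

End Bisection.

(** * Differentiability as a first-order estimate *)

Section Differentiability.
Variable K : numFieldType.
Implicit Types (f : K -> K).

(** Multiplying the difference quotient by [x - t] removes the excluded point [x = t]. *)
Lemma derivable_epsP f (t : K) : derivable f t 1 <->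
  exists l, forall e, 0 < e -> exists2 d, 0 < d &
    forall x, `|x - t| < d -> `|f x - f t - l * (x - t)| <= e * `|x - t|.
Proof.
split=> [/cvg_ex[l /cvgrPdist_le hl]|[l hl]].
  exists l => e /hl /nbhs_ballP[d /= d0 hd]; exists d => // x xd.
  have [->|xt] := eqVneq x t; first by rewrite !subrr mulr0 subr0 normr0 mulr0.
  have xt0 : x - t != 0 by rewrite subr_eq0.
  have := hd (x - t); rewrite /ball /= sub0r normrN => /(_ xd xt0).
  rewrite scaler1 subrK; set y := f x - f t => h.
  have -> : y - l * (x - t) = (x - t) * - (l - (x - t)^-1 * y) by field.
  by rewrite normrM normrN mulrC ler_wpM2r.
apply/cvg_ex; exists l; apply/cvgrPdist_le => e /hl[d d0 hd].
apply/nbhs_ballP; exists d => // h; rewrite /ball /= sub0r normrN => hd' h0.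
have := hd (h + t); rewrite addrK => /(_ hd').
rewrite scaler1; set y := f _ - f t => H.
rewrite -(ler_pM2r (_ : 0 < `|h|)) ?normr_gt0// -normrM.
suff -> : (l - h^-1 *: y) * h = - (y - l * h) by rewrite normrN.
by rewrite /GRing.scale /=; field.
Qed.

Lemma is_derive_eps f (t l : K) : is_derive t 1 f l ->
  forall e, 0 < e -> exists2 d, 0 < d &
    forall x, `|x - t| < d -> `|f x - f t - l * (x - t)| <= e * `|x - t|.
Proof.
move=> [/cvg_ex[l' h] <-] e.
have -> : 'D_1 f t = l' by apply/cvg_lim.
move: h => /cvgrPdist_le hl /hl /nbhs_ballP[d /= d0 hd]; exists d => // x xd.
have [->|xt] := eqVneq x t; first by rewrite !subrr mulr0 subr0 normr0 mulr0.
have xt0 : x - t != 0 by rewrite subr_eq0.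
have := hd (x - t); rewrite /ball /= sub0r normrN => /(_ xd xt0).
rewrite scaler1 subrK; set y := f x - f t => h.
have -> : y - l' * (x - t) = (x - t) * - (l' - (x - t)^-1 * y) by field.
by rewrite normrM normrN mulrC ler_wpM2r.
Qed.

End Differentiability.

(** * Goursat's theorem on a rectangle *)

Section Goursat.
Variable R : realType.
Local Notation C := (CC R).
Implicit Types (z w : C) (r s t : R).

Definition cdiff (G : C -> C) z := exists l, forall e, 0 < e -> exists2 d, 0 < d &
  forall w, absC (w - z) < d -> absC (G w - G z - l * (w - z)) <= e * absC (w - z).

Lemma cdiffP (G : C -> C) z : derivable G z 1 <-> cdiff G z.
Proof.
split=> [/derivable_epsP[l hl]|[l hl]].
  exists l => e e0; have [|d /gt0_toC[-> d0] hd] := hl (toC e 0); first by rewrite ltcR.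
  exists (reC d) => // w wd; have := hd w; rewrite normC_lt => /(_ wd).
  by rewrite !normCE -[toC e 0 * _](rmorphM (real_complex R)) lecR.
apply/derivable_epsP; exists l => e /gt0_toC[-> /hl[d d0 hd]].
exists (toC d 0); rewrite ?ltcR// => w; rewrite normC_lt => /hd.
by rewrite !normCE -[toC _ 0 * _](rmorphM (real_complex R)) lecR.
Qed.

(* complex differentiability of [K] as a function of [s + i t] *)
Definition cdiff2 (K : R -> R -> C) s t := exists l, forall e, 0 < e -> exists2 d, 0 < d &
  forall s' t', `|s' - s| < d -> `|t' - t| < d ->
  absC (K s' t' - K s t - l * toC (s' - s) (t' - t)) <= e * (`|s' - s| + `|t' - t|).

Lemma lipschitz_cvg (F : R -> C) t (A d : R) : 0 < d ->
  (forall x, `|x - t| < d -> absC (F x - F t) <= A * `|x - t|) ->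
  F x @[x --> t] --> F t.
Proof.
move=> d0 h; apply/cvgCP => e e0.
have A0 : 0 < `|A| + 1 by rewrite ltr_wpDl.
apply/nbhs_ballP; exists (Num.min d (e / (`|A| + 1))) => /=.
  by rewrite lt_min d0 divr_gt0.
move=> x; rewrite /ball /= distrC lt_min => /andP[xd xe].
rewrite absC_dist (le_lt_trans (h _ xd))//.
apply: (@le_lt_trans _ _ ((`|A| + 1) * `|x - t|)).
  by rewrite ler_wpM2r// (le_trans (ler_norm A))// lerDl.
by rewrite mulrC -ltr_pdivlMr.
Qed.

Lemma cdiff2_lipschitz (K : R -> R -> C) s t : cdiff2 K s t ->
  exists (A d : R), 0 < d /\ forall s' t', `|s' - s| < d -> `|t' - t| < d ->
  absC (K s' t' - K s t) <= A * (`|s' - s| + `|t' - t|).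
Proof.
move=> [l /(_ 1 ltr01)[d d0 hd]]; exists (1 + absC l), d; split => // s' t' hs ht.
rewrite -[K s' t' - _](subrK (l * toC (s' - s) (t' - t))) mulrDl.
rewrite (le_trans (ler_absCD _ _))// lerD ?hd// absCM ler_wpM2l ?absC_ge0//.
exact: absC_le_reim.
Qed.

Lemma cdiff2_cvg1 (K : R -> R -> C) s t : cdiff2 K s t -> K x t @[x --> s] --> K s t.
Proof.
move=> /cdiff2_lipschitz[A [d [d0 h]]]; apply: (@lipschitz_cvg (K^~ t) _ A d) => // x xs.
by have := h x t xs; rewrite subrr normr0 addr0; apply.
Qed.

Lemma cdiff2_cvg2 (K : R -> R -> C) s t : cdiff2 K s t -> K s x @[x --> t] --> K s t.
Proof.
move=> /cdiff2_lipschitz[A [d [d0 h]]]; apply: (@lipschitz_cvg (K s) _ A d) => // x xs.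
by have := h s x; rewrite subrr normr0 add0r; apply.
Qed.

Section Rectangle.
Variables (K : R -> R -> C) (a L b T : R).
Hypotheses (L0 : 0 <= L) (T0 : 0 <= T).
Hypothesis Kd : forall s t, a <= s <= a + L -> b <= t <= b + T -> cdiff2 K s t.

Let U x l y := cint x (x + l) (K^~ y).
Let V y t x := cint y (y + t) (K x).

(* integral of [K] along the boundary of [x, x + l] * [y, y + t] *)
Let Phi x l y t := U x l y - U x l (y + t) + toC 0 1 * (V y t (x + l) - V y t x).

Let hor x x' y : a <= x -> x' <= a + L -> b <= y <= b + T -> cont_on x x' (K^~ y).
Proof.
move=> ax xL hy s /andP[xs sx]; apply: cdiff2_cvg1; apply: Kd => //.
by rewrite (le_trans ax)//= (le_trans sx).
Qed.

Let ver y y' x : b <= y -> y' <= b + T -> a <= x <= a + L -> cont_on y y' (K x).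
Proof.
move=> b_y yT hx s /andP[ys sy]; apply: cdiff2_cvg2; apply: Kd => //.
by rewrite (le_trans b_y)//= (le_trans sy).
Qed.

(** The boundary integral is additive over quarters. Near a point [K] is affine up to a small error,
    and the boundary integral of an affine function of s + i t vanishes, so only the error
    contributes. *)
Lemma goursat :
  cint a (a + L) (K^~ b) - cint a (a + L) (K^~ (b + T)) +
  toC 0 1 * (cint b (b + T) (K (a + L)) - cint b (b + T) (K a)) = 0.
Proof.
(* The bound is tuned to [bisection]: quartering halves [L + T], so four quarter bounds add up
   exactly to the bound of the whole. *)
suff main e : 0 < e -> absC (Phi a L b T) <= e * (L + T) ^+ 2.
  apply/eqP; rewrite -absC_eq0 eq_le absC_ge0 andbT.
  apply/ler_addgt0Pr => e e0; rewrite add0r.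
  have D0 : 0 < (L + T) ^+ 2 + 1 by rewrite ltr_wpDl// sqr_ge0.
  apply: le_trans (main (e / ((L + T) ^+ 2 + 1)) _) _; first by rewrite divr_gt0.
  by rewrite mulrAC ler_pdivrMr// mulrDr mulr1 lerDl ltW.
move=> e0; apply: (@bisection R (fun x l y t => absC (Phi x l y t) <= e * (l + t) ^+ 2)) => //.
  move=> x l y t l0 t0 [ax xL b_y yT] h1 h2 h3 h4.
  have hx : x <= x + l / 2 <= x + l by lra.
  have hy : y <= y + t / 2 <= y + t by lra.
  have xE : x + l = x + l / 2 + l / 2 by field.
  have yE : y + t = y + t / 2 + t / 2 by field.
  have Us y' : y <= y' <= y + t -> U x l y' = U x (l / 2) y' + U (x + l / 2) (l / 2) y'.
    move=> hy'; rewrite /U -xE (@cint_chasles _ x (x + l) (x + l / 2))//; try lra.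
    by apply: hor; lra.
  have Vs x' : x <= x' <= x + l -> V y t x' = V y (t / 2) x' + V (y + t / 2) (t / 2) x'.
    move=> hx'; rewrite /V -yE (@cint_chasles _ y (y + t) (y + t / 2))//; try lra.
    by apply: ver; lra.
  have -> : Phi x l y t = Phi x (l / 2) y (t / 2) + Phi (x + l / 2) (l / 2) y (t / 2) +
      (Phi x (l / 2) (y + t / 2) (t / 2) + Phi (x + l / 2) (l / 2) (y + t / 2) (t / 2)).
    rewrite /Phi -!xE -!yE !Us; [|lra..]; rewrite !Vs; [|lra..]; ring.
  have -> : e * (l + t) ^+ 2 = e * (l / 2 + t / 2) ^+ 2 + e * (l / 2 + t / 2) ^+ 2 +
    (e * (l / 2 + t / 2) ^+ 2 + e * (l / 2 + t / 2) ^+ 2) by field.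
  by do 2 (apply: le_trans (ler_absCD _ _) _; apply: lerD => //);
    (apply: le_trans (ler_absCD _ _) _; apply: lerD => //).
move=> p q hp hq; have [be hbe] := Kd hp hq.
(* Comparing two points doubles [e / 4] to [e / 2], and the factor 2 of [cint_const_bound] brings it
   to [e]; the two pairs of sides then give [e * (l + t) * l] and [e * (l + t) * t]. *)
have [d d0 hd] := hbe (e / 4) (divr_gt0 e0 (ltr0n _ 4)).
exists d => // x l y t /andP[l0 ld] /andP[t0 td] [ax xL b_y yT] xp yq.
have err s u : x <= s <= x + l -> y <= u <= y + t ->
    absC (K s u - K p q - be * toC (s - p) (u - q)) <= e / 4 * (l + t).
  move=> hs hu.
  have sp : `|s - p| <= l by rewrite ler_norml; lra.
  have uq : `|u - q| <= t by rewrite ler_norml; lra.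
  apply: le_trans (hd _ _ (le_lt_trans sp ld) (le_lt_trans uq td)) _.
  by rewrite ler_wpM2l// ?lerD// divr_ge0// ltW.
have err2 s u s' u' : x <= s <= x + l -> y <= u <= y + t ->
    x <= s' <= x + l -> y <= u' <= y + t ->
    absC (K s u - K s' u' - be * toC (s - s') (u - u')) <= e / 2 * (l + t).
  move=> h1 h2 h3 h4.
  have -> : K s u - K s' u' - be * toC (s - s') (u - u') =
    (K s u - K p q - be * toC (s - p) (u - q)) - (K s' u' - K p q - be * toC (s' - p) (u' - q)).
    have -> : toC (s - s') (u - u') = toC (s - p) (u - q) - toC (s' - p) (u' - q).
      by apply: CC_eqP; rewrite ?(reCB, imCB) /=; ring.
    ring.
  apply: le_trans (ler_absCB _ _) _.
  have -> : e / 2 * (l + t) = e / 4 * (l + t) + e / 4 * (l + t) by field.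
  by rewrite lerD// err.
have Ub : absC (U x l y - U x l (y + t) - (- be * toC 0 t) * toC l 0) <= 2 * (e / 2 * (l + t)) * l.
  rewrite /U -cintB; try by apply: hor; lra.
  have := @cint_const_bound R x (x + l) (- be * toC 0 t) (e / 2 * (l + t))
    (fun s => K s y - K s (y + t)).
  have -> : x + l - x = l by ring.
  apply; [lra|by apply: cont_onB; apply: hor; lra|move=> s hs].
  have := @err2 s y s (y + t); rewrite subrr.
  have -> : be * toC 0 (y - (y + t)) = - be * toC 0 t.
    by apply: CC_eqP; rewrite ?(reCM, imCM, reCN, imCN) /=; ring.
  by apply => //; lra.
have Vb : absC (V y t (x + l) - V y t x - (be * toC l 0) * toC t 0) <= 2 * (e / 2 * (l + t)) * t.
  rewrite /V -cintB; try by apply: ver; lra.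
  have := @cint_const_bound R y (y + t) (be * toC l 0) (e / 2 * (l + t))
    (fun u => K (x + l) u - K x u).
  have -> : y + t - y = t by ring.
  apply; [lra|by apply: cont_onB; apply: ver; lra|move=> u hu].
  have := @err2 (x + l) u x u; rewrite subrr.
  have -> : x + l - x = l by ring.
  by apply => //; lra.
(* The constants subtracted on the horizontal and on the vertical sides cancel, which is the
   vanishing of the integral of the linear part. *)
have -> : Phi x l y t = (U x l y - U x l (y + t) - (- be * toC 0 t) * toC l 0) +
   toC 0 1 * (V y t (x + l) - V y t x - (be * toC l 0) * toC t 0).
  have : - be * toC 0 t * toC l 0 + toC 0 1 * (be * toC l 0 * toC t 0) = 0.
    by apply: CC_eqP; rewrite ?(reCM, imCM, reCN, imCN, reCD, imCD) /=; ring.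
  rewrite /Phi => H; rewrite -[LHS]subr0 -H; ring.
apply: le_trans (ler_absCD _ _) _; rewrite absCM.
have -> : absC (toC 0 1 : C) = 1 by rewrite /absC /= expr0n expr1n add0r sqrtr1.
rewrite mul1r; apply: le_trans (lerD Ub Vb) _; lra.
Qed.

End Rectangle.
End Goursat.

(** * Integrals over circles centred at the origin *)

Section CircleMeans.
Variable R : realType.
Local Notation C := (CC R).
Implicit Types (z w : C) (r s t : R).

Definition cis t : C := toC (cos t) (sin t).

Lemma cisD s t : cis (s + t) = cis s * cis t.
Proof. by apply: CC_eqP; rewrite ?(reCM, imCM) /= ?cosD ?sinD; ring. Qed.
Lemma absC_cis t : absC (cis t) = 1.
Proof. by rewrite /absC /= cos2Dsin2 sqrtr1. Qed.

Definition circ r t : C := toC r 0 * cis t.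

Lemma absC_circ r t : 0 <= r -> absC (circ r t) = r.
Proof. by move=> r0; rewrite absCM absC_cis mulr1 absC_toC ger0_norm. Qed.
Lemma circ_neq0 r t : 0 < r -> circ r t != 0.
Proof. by move=> r0; rewrite -absC_eq0 absC_circ ?gt_eqF// ltW. Qed.

(** Multiplicativity moves the expansion of exp(s + i t) to the point 0, where it follows from the
    derivatives of [expR], [cos] and [sin]. *)
Lemma circ_exp_cdiff2 s t e : 0 < e -> exists2 d, 0 < d &
  forall s' t', `|s' - s| < d -> `|t' - t| < d ->
  absC (circ (expR s') t' - circ (expR s) t - circ (expR s) t * toC (s' - s) (t' - t))
     <= e * (`|s' - s| + `|t' - t|).
Proof.
move=> e0; pose A := expR s; have A0 : 0 < A := expR_gt0 s.
(* Dividing by [A] undoes the modulus of the factor taken out, and 8 leaves room for all error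
   terms; [c <= 1] serves to bound [expR a - 1] by twice the modulus of [a]. *)
pose c := Num.min 1 (e / A / 8).
have c0 : 0 < c by rewrite lt_min ltr01 !divr_gt0.
have [d1 d10 h1] := is_derive_eps (is_derive_expR (0 : R)) c0.
have [d2 d20 h2] := is_derive_eps (is_derive_cos (0 : R)) c0.
have [d3 d30 h3] := is_derive_eps (is_derive_sin (0 : R)) c0.
exists (Num.min (Num.min (Num.min d1 d2) d3) (Num.min (1 / 2) (c / 2))).
  by rewrite !lt_min d10 d20 d30 !divr_gt0.
move=> s' t'; rewrite !lt_min => /andP[/andP[/andP[a1 _] _] /andP[a4 a5]].
move=> /andP[/andP[/andP[_ b2] b3] _].
have -> : s' = s + (s' - s) by ring.
have -> : t' = t + (t' - t) by ring.
move: (s' - s) (t' - t) a1 a4 a5 b2 b3 => a b a1 a4 a5 b2 b3.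
rewrite [s + a - s]addrC addKr [t + b - t]addrC addKr.
have -> : circ (expR (s + a)) (t + b) = circ A t * circ (expR a) b.
  by rewrite /circ cisD expRD; apply: CC_eqP; rewrite ?(reCM, imCM) /= /A; ring.
rewrite -/A; have -> : circ A t * circ (expR a) b - circ A t - circ A t * toC a b =
   circ A t * (circ (expR a) b - 1 - toC a b) by ring.
rewrite absCM absC_circ ?(ltW A0)// mulrC -ler_pdivlMr//.
have := h1 a; rewrite subr0 expR0 mul1r => /(_ a1) {}h1.
have := h2 b; rewrite subr0 cos0 sin0 oppr0 mul0r subr0 => /(_ b2) {}h2.
have := h3 b; rewrite subr0 sin0 cos0 subr0 mul1r => /(_ b3) {}h3.
have c1 : c <= 1 by rewrite ge_min lexx.
have ce : c <= e / A / 8 by rewrite ge_min lexx orbT.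
have ea : `|expR a - 1| <= 2 * `|a|.
  rewrite -[expR a - 1](subrK a) (le_trans (ler_normD _ _))//.
  have := ler_wpM2r (normr_ge0 a) c1; lra.
have ea2 : expR a <= 2.
  by have := ler_norm (expR a - 1); lra.
have ea0 := expR_gt0 a.
apply: le_trans (absC_le_reim _) _.
rewrite !reCB !imCB reCM imCM /= !mul0r subr0 addr0 subr0.
have -> : expR a * cos b - 1 - a = (expR a - 1 - a) + expR a * (cos b - 1) by ring.
have -> : expR a * sin b - b = expR a * (sin b - b) + b * (expR a - 1) by ring.
have B1 : `|expR a * (cos b - 1)| <= 2 * (c * `|b|).
  by rewrite normrM gtr0_norm// ler_pM// ltW.
have B2 : `|expR a * (sin b - b)| <= 2 * (c * `|b|).
  by rewrite normrM gtr0_norm// ler_pM// ltW.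
have B3 : `|b * (expR a - 1)| <= `|b| * c.
  rewrite normrM ler_wpM2l// (le_trans ea)//; lra.
have ha := normr_ge0 a; have hb := normr_ge0 b.
have Ca : c * `|a| <= e / A / 8 * `|a| by rewrite ler_wpM2r.
have Cb : c * `|b| <= e / A / 8 * `|b| by rewrite ler_wpM2r.
have N1 := ler_normD (expR a - 1 - a) (expR a * (cos b - 1)).
have N2 := ler_normD (expR a * (sin b - b)) (b * (expR a - 1)).
have -> : e * (`|a| + `|b|) / A = 8 * (e / A / 8 * `|a|) + 8 * (e / A / 8 * `|b|).
  by field; rewrite gt_eqF.
have Ca0 : 0 <= c * `|a| by rewrite mulr_ge0// ltW.
have Cb0 : 0 <= c * `|b| by rewrite mulr_ge0// ltW.
lra.
Qed.

(** Chain rule: half of [e] pays for the remainder of [G], half for the remainder of the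
    exponential. *)
Lemma cdiff_circ_exp (G : C -> C) s t : cdiff G (circ (expR s) t) ->
  cdiff2 (fun s t => G (circ (expR s) t)) s t.
Proof.
set z := circ (expR s) t => -[l hl]; exists (l * z) => e e0.
pose B := absC z + 1; have B0 : 0 < B by rewrite ltr_wpDl// absC_ge0.
pose D := absC l + 1; have D0 : 0 < D by rewrite ltr_wpDl// absC_ge0.
have [d1 d10 h1] := hl (e / 2 / B) (divr_gt0 (divr_gt0 e0 (ltr0n _ 2)) B0).
pose c := Num.min 1 (e / 2 / D).
have c0 : 0 < c by rewrite lt_min ltr01 !divr_gt0.
have [d2 d20 h2] := circ_exp_cdiff2 s t c0.
exists (Num.min d2 (d1 / 2 / B)); first by rewrite lt_min d20 !divr_gt0.
move=> s' t'; rewrite !lt_min => /andP[s2 s1] /andP[t2 t1].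
have := h2 _ _ s2 t2; rewrite -/z; set w := circ (expR s') t'.
set N := `|s' - s| + `|t' - t| => h.
have c1 : c <= 1 by rewrite ge_min lexx.
have ce : c <= e / 2 / D by rewrite ge_min lexx orbT.
have N0 : 0 <= N by rewrite addr_ge0.
have wz : absC (w - z) <= B * N.
  rewrite -[w - z](subrK (z * toC (s' - s) (t' - t))) (le_trans (ler_absCD _ _))//.
  rewrite /B mulrDl addrC lerD//.
    by rewrite absCM ler_wpM2l ?absC_ge0//; exact: absC_le_reim.
  by rewrite (le_trans h)// ler_wpM2r.
have wz1 : absC (w - z) < d1.
  rewrite (le_lt_trans wz)//.
  have -> : d1 = B * (d1 / 2 / B + d1 / 2 / B) by field; rewrite gt_eqF.
  by rewrite ltr_pM2l// ltrD.
have -> : G w - G z - l * z * toC (s' - s) (t' - t) = (G w - G z - l * (w - z)) +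
   l * (w - z - z * toC (s' - s) (t' - t)) by ring.
rewrite (le_trans (ler_absCD _ _))//.
have -> : e * N = e / 2 / B * (B * N) + D * (e / 2 / D * N) by field; rewrite !gt_eqF.
rewrite lerD//.
  by rewrite (le_trans (h1 _ wz1))// ler_wpM2l// !divr_ge0// ltW.
rewrite absCM ler_pM ?absC_ge0//; first by rewrite lerDl.
by rewrite (le_trans h)// ler_wpM2r.
Qed.

(* the contour integral of [- i G(w) / w] over the circle of radius [r] *)
Definition mean (G : C -> C) r : C := cint 0 (2 * pi) (fun t => G (circ r t)).

Lemma circ_cvg r t : circ r x @[x --> t] --> circ r t.
Proof.
apply: cvgM; first exact: cvg_cst.
have -> : cis = circ (expR 0).
  by apply/funext => u; rewrite /circ expR0 -[toC 1 0]/(1 : C) mul1r.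
apply: (@cdiff2_cvg2 R (fun s t => circ (expR s) t) 0).
by exists (circ (expR 0) t) => e; exact: circ_exp_cdiff2.
Qed.

Lemma circ_2pi r : circ r (2 * pi) = circ r 0.
Proof. by rewrite /circ /cis mulr_natl cos2pi sin2pi cos0 sin0. Qed.

(* Goursat for [G(exp(s + i t))] on a rectangle of height [2 pi]: the horizontal
   sides cancel by periodicity. *)
Lemma mean_const (G : C -> C) r r' : 0 < r -> r <= r' ->
  (forall z, r <= absC z <= r' -> cdiff G z) -> mean G r = mean G r'.
Proof.
move=> r0 rr hG.
have r'0 : 0 < r' by exact: lt_le_trans rr.
have l0 : 0 <= ln r' - ln r by rewrite subr_ge0 ler_ln ?posrE.
have p0 : 0 <= 2 * pi :> R by rewrite mulr_ge0// pi_ge0.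
have := @goursat R (fun s t => G (circ (expR s) t)) (ln r) (ln r' - ln r) 0 (2 * pi) l0 p0.
rewrite !add0r [ln r + _]addrC subrK.
rewrite [cint (ln r) _ _](@eq_cint _ _ _ _
  (fun s => G (circ (expR s) (2 * pi)))); last by move=> s _; rewrite circ_2pi.
rewrite subrr add0r !lnK ?posrE// => H.
have {H}/eqP : toC 0 1 * (mean G r' - mean G r) = 0.
  apply: H => s t /andP[s1 s2] _; apply: cdiff_circ_exp; apply: hG.
  rewrite absC_circ ?expR_ge0//.
  apply/andP; split; first by rewrite -[leLHS]lnK ?posrE// ler_expR.
  by rewrite -[leRHS]lnK ?posrE// ler_expR.
rewrite mulf_eq0 => /orP[/eqP/(congr1 (@imC R))/eqP|]; first by rewrite /= oner_eq0.
by rewrite subr_eq0 => /eqP.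
Qed.

(** Compactness by bisection of the square of half-side [r]: the absolute values of the bounds on
    four quarters add up to a bound on their union, and continuity bounds [Q] near each point. *)
Lemma continuous_bounded_disc (Q : C -> C) r : (forall z, Q x @[x --> z] --> Q z) ->
  exists B, forall z, absC z <= r -> absC (Q z) <= B.
Proof.
move=> cQ; have [r0|r0] := leP 0 r; last first.
  by exists 0 => z zr; have := absC_ge0 z; rewrite leNgt (le_lt_trans zr).
have D0 : 0 <= r + r by rewrite addr_ge0.
have := @bisection R (fun x l y t => exists B, forall u v, x <= u <= x + l ->
  y <= v <= y + t -> absC (Q (toC u v)) <= B) (- r) (r + r) (- r) (r + r) D0 D0.
have E : - r + (r + r) = r by ring.
rewrite !E => h; have [|p q _ _|B hB] := h.
- move=> x l y t l0 t0 _ [B1 h1] [B2 h2] [B3 h3] [B4 h4].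
  exists (`|B1| + `|B2| + `|B3| + `|B4|) => u v hu hv.
  have n1 := ler_norm B1; have n2 := ler_norm B2; have n3 := ler_norm B3; have n4 := ler_norm B4.
  have m1 := normr_ge0 B1; have m2 := normr_ge0 B2.
  have m3 := normr_ge0 B3; have m4 := normr_ge0 B4.
  have [u1|u1] := leP u (x + l / 2); have [v1|v1] := leP v (y + t / 2).
  + by apply: le_trans (h1 u v _ _) _; lra.
  + by apply: le_trans (h3 u v _ _) _; lra.
  + by apply: le_trans (h2 u v _ _) _; lra.
  + by apply: le_trans (h4 u v _ _) _; lra.
- have /cvgCP/(_ 1 ltr01)/nbhs_ballP[e /gt0_toC[-> e0] he] := cQ (toC p q).
  exists (reC e / 2); first by rewrite divr_gt0.
  move=> x l y t /andP[_ l0] /andP[_ t0] _ xp yq; exists (absC (Q (toC p q)) + 1) => u v xu yv.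
  have := he (toC u v); rewrite /ball /= -[_ - _]/(toC (p - u) (q - v)).
  rewrite normCE ltcR => H; rewrite -lerBlDl (le_trans (ler_absC_sub _ _))// absC_dist ltW//.
  apply: H; apply: le_lt_trans (absC_le_reim _) _ => /=.
  rewrite [ltRHS]splitr; apply: ltrD.
    by rewrite ltr_norml; lra.
  by rewrite ltr_norml; lra.
exists B => z zr; rewrite -(toC_reim z); apply: hB.
  by rewrite -ler_norml (le_trans (ler_reC z)).
by rewrite -ler_norml (le_trans (ler_imC z)).
Qed.

End CircleMeans.

(** * Cauchy's formula and expansion of entire functions *)

Section Cauchy.
Variable R : realType.
Local Notation C := (CC R).
Implicit Types (z w : C) (r s t : R).
Local Notation mean := (@mean R).

Lemma near_absC (P : C -> Prop) z r : 0 < r -> (forall x, absC (x - z) < r -> P x) ->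
  \forall x \near z, P x.
Proof.
move=> r0 H; apply/nbhs_ballP; exists (toC r 0); rewrite /= ?ltcR// => x.
by rewrite /ball /= normC_lt absC_dist => /H.
Qed.

Lemma eq_near_cvg (f g : C -> C) z (l : C) r : 0 < r ->
  (forall x, absC (x - z) < r -> f x = g x) -> f x @[x --> z] --> l -> g x @[x --> z] --> l.
Proof.
move=> r0 H; apply: cvg_trans; apply: (@near_eq_cvg _ _ (nbhs z) (nbhs_filter z)).
by apply: (near_absC r0) => x /H.
Qed.

Lemma cdiff_cvg (G : C -> C) z : cdiff G z -> G x @[x --> z] --> G z.
Proof. by move=> /cdiffP/derivable1_diffP/differentiable_continuous. Qed.

Lemma exprC_cvg k z : (fun w : C => w ^+ k) x @[x --> z] --> z ^+ k.
Proof.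
elim: k => [|k IH].
  have -> : (fun w : C => w ^+ 0) = (fun=> 1) by apply/funext => w; rewrite expr0.
  by rewrite expr0; exact: (@cvg_cst _ (1 : C) _ (nbhs z) _).
have -> : (fun w : C => w ^+ k.+1) = (fun w : C => w * w ^+ k).
  by apply/funext => w; rewrite exprS.
by rewrite exprS; exact: (cvgM (cvg_id (F := nbhs z)) IH).
Qed.

Lemma cont_on_circ (G : C -> C) r a b :
  (forall t, G x @[x --> circ r t] --> G (circ r t)) ->
  cont_on a b (fun t => G (circ r t)).
Proof. by move=> cG t _; exact: (@cvg_comp _ _ _ (circ r) G _ _ _ (@circ_cvg _ r t) (cG t)). Qed.

Lemma twopi_ge0 : 0 <= 2 * pi :> R. Proof. by rewrite mulr_ge0// pi_ge0. Qed.

Lemma mean_bound (G : C -> C) r M : (forall t, G x @[x --> circ r t] --> G (circ r t)) ->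
  (forall t, absC (G (circ r t)) <= M) -> absC (mean G r) <= 2 * M * (2 * pi).
Proof.
move=> cG GM; have := @cint_bound R 0 (2 * pi) M _ twopi_ge0 (cont_on_circ cG).
by rewrite subr0; apply.
Qed.

(** Continuity in the radius asks for an estimate uniform in the angle, which bisection of the
    interval of angles supplies. *)
Lemma mean_continuous (Q : C -> C) r0 : (forall z, Q x @[x --> z] --> Q z) ->
  forall e, 0 < e -> exists2 d, 0 < d & forall r, `|r - r0| < d ->
    absC (mean Q r - mean Q r0) <= e.
Proof.
move=> cQ e e0; pose e' := e / 2 / (2 * pi).
have pi2 : 0 < 2 * pi :> R by rewrite mulr_gt0// pi_gt0.
have e'0 : 0 < e' by rewrite !divr_gt0.
(* The rectangle is degenerate, of width 0 over [r0]; only the interval of angles is really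
   subdivided. *)
have [||d d0 hd] := @bisection R (fun x l y t => exists2 d, 0 < d & forall r u,
    `|r - r0| < d -> y <= u <= y + t -> absC (Q (circ r u) - Q (circ r0 u)) <= e')
    r0 0 0 (2 * pi) (lexx _) (ltW pi2).
- move=> x l y t l0 t0 _ [d1 d10 h1] _ [d2 d20 h2] _.
  exists (Num.min d1 d2); first by rewrite lt_min d10.
  move=> r u; rewrite lt_min => /andP[r1 r2] hu.
  have [u1|u1] := leP u (y + t / 2); first by apply: h1 => //; lra.
  by apply: h2 => //; lra.
- move=> p q hp _; have {hp}-> : p = r0 by lra.
  have /cvgCP/(_ (e' / 2) (divr_gt0 e'0 (ltr0n _ 2))) := cQ (circ r0 q).
  move=> /nbhs_ballP[b /gt0_toC[-> b0] hb].
  have b20 : 0 < reC b / 2 by rewrite divr_gt0.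
  have /cvgCP/(_ _ b20)/nbhs_ballP[d /= d0 hd] := @circ_cvg R r0 q.
  pose d' := Num.min d (reC b / 2).
  exists (d' / 1); first by rewrite divr1 lt_min d0.
  move=> x l y t _ /andP[_ td] _ _ yq; exists (reC b / 2) => // r u hr hu.
  have qu : `|q - u| < d.
    apply: (@le_lt_trans _ _ t); first by rewrite ler_norml; lra.
    by move: td; rewrite divr1 lt_min => /andP[].
  have C1 : absC (circ r0 q - circ r0 u) < reC b / 2 by apply: hd.
  have C2 : absC (circ r0 u - circ r u) < reC b / 2.
    rewrite /circ -mulrBl absCM absC_cis mulr1.
    have -> : toC r0 0 - toC r 0 = toC (r0 - r) 0 :> C.
      by apply: CC_eqP; rewrite ?(reCB, imCB) /= ?subrr.
    by rewrite absC_toC distrC.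
  have H v : absC (circ r0 q - v) < reC b -> absC (Q (circ r0 q) - Q v) < e' / 2.
    by move=> hv; apply: hb; rewrite /ball /= normC_lt.
  have := H (circ r0 u); have := H (circ r u).
  move=> /(_ _)/wrap[|H1].
    by rewrite (le_lt_trans (ler_absC_dist _ _ (circ r0 u)))// [ltRHS]splitr ltrD.
  move=> /(_ _)/wrap[|H2]; first by rewrite (lt_trans C1)// ltr_pdivrMr// ltr_pMr// ltr1n.
  rewrite (le_trans (ler_absC_dist _ _ (Q (circ r0 q))))// [leRHS]splitr lerD ?ltW//.
  by rewrite absC_dist.
exists d => // r hr; rewrite /mean -cintB; [|by apply: cont_on_circ..].
have -> : e = 2 * e' * (2 * pi - 0).
  by rewrite subr0 -mulrA divfK ?gt_eqF// mulrC divfK.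
apply: cint_bound; first exact: twopi_ge0.
  by apply: cont_onB; exact: cont_on_circ.
by move=> t ht; apply: hd; rewrite ?add0r.
Qed.

Section CauchyFormula.
Variables (h : C -> C) (z : C).
Hypothesis he : entire h.
Variable r : R.
Hypothesis zr : absC z < r.

Let r0 : 0 < r. Proof. exact: le_lt_trans (absC_ge0 z) zr. Qed.

Let sub_neq0 w : absC z < absC w -> w - z != 0.
Proof. by move=> zw; rewrite subr_eq0; apply: contraTneq zw => ->; rewrite ltxx. Qed.

Let entire_cvg w : h x @[x --> w] --> h w.
Proof. by apply: cdiff_cvg; apply/cdiffP; exact: he. Qed.

Let kernel_derivable w : w != z -> derivable (fun w : C => w / (w - z)) w 1.
Proof.
rewrite -subr_eq0 => wz; apply: derivableM; first exact: derivable_id.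
by apply: derivableV => //; exact: derivableB.
Qed.

Let kernel_cvg t : (fun w : C => w / (w - z)) x @[x --> circ r t] --> circ r t / (circ r t - z).
Proof.
apply: (@cdiff_cvg (fun w : C => w / (w - z))); apply/cdiffP; apply: kernel_derivable.
by rewrite -subr_eq0 sub_neq0// absC_circ// ltW.
Qed.

(** The mean is the same for all radii [s >= r], while the kernel tends to 1 as [s] grows, at rate
    [absC z / (s - absC z)]. *)
Lemma mean_kernel : mean (fun w => w / (w - z)) r = toC (2 * pi) 0.
Proof.
have bound s : r <= s -> absC (mean (fun w => w / (w - z)) r - toC (2 * pi) 0) * (s - absC z)
    <= 2 * absC z * (2 * pi).
  move=> rs; have zs : absC z < s by exact: lt_le_trans rs.
  have s0 : 0 < s by exact: lt_le_trans rs.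
  rewrite (@mean_const R (fun w => w / (w - z)) r s)//; last first.
    move=> w /andP[rw _]; apply/cdiffP; apply: kernel_derivable.
    by rewrite -subr_eq0 sub_neq0//; exact: lt_le_trans rw.
  have := @cint_const_bound R 0 (2 * pi) 1 (absC z / (s - absC z)) _ twopi_ge0
    (@cont_on_circ (fun w => w / (w - z)) s 0 (2 * pi) _).
  rewrite subr0 mul1r -/(mean _ s) => H.
  rewrite -ler_pdivlMr ?subr_gt0//.
  have -> : 2 * absC z * (2 * pi) / (s - absC z) = 2 * (absC z / (s - absC z)) * (2 * pi).
    by field; rewrite subr_eq0 gt_eqF.
  apply: H => [t|t _].
    apply: (@cdiff_cvg (fun w : C => w / (w - z))); apply/cdiffP; apply: kernel_derivable.
    by rewrite -subr_eq0 sub_neq0// absC_circ// ltW.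
  have wz : circ s t - z != 0 by rewrite sub_neq0// absC_circ// ltW.
  have -> : circ s t / (circ s t - z) - 1 = z / (circ s t - z) by field.
  rewrite absCM absCV ler_wpM2l ?absC_ge0// lef_pV2 ?posrE ?subr_gt0 ?absC_gt0//.
  by rewrite (le_trans _ (ler_absC_sub _ _))// absC_circ// ltW.
apply/eqP; rewrite -subr_eq0 -absC_eq0; apply/eqP.
set x := absC _ in bound *; have x0 : 0 <= x := absC_ge0 _.
apply: contrapT => /eqP xn0; have {x0 xn0}x0 : 0 < x by rewrite lt0r xn0.
set M := 2 * absC z * (2 * pi) in bound.
(* At this radius the left side exceeds [M + 1], contradicting the bound [M]. *)
have := bound (r + (M + 1) / x).
have M0 : 0 <= M by rewrite !mulr_ge0// ?absC_ge0// pi_ge0.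
rewrite lerDl divr_ge0 ?addr_ge0 ?(ltW x0)// => /(_ isT).
have -> : x * (r + (M + 1) / x - absC z) = M + 1 + x * (r - absC z) by field; rewrite gt_eqF.
have : 0 < x * (r - absC z) by rewrite mulr_gt0// subr_gt0.
lra.
Qed.

(** The circles are centred at 0, so one of them passes through [z]. The quotient [Q], filled in at
    [z] by the derivative, is continuous there but not known to be differentiable: its mean is
    constant on either side of radius [absC z], tends to 0 at small radii, and crosses the critical
    radius by continuity. *)
Lemma cauchy_formula : mean (fun w => h w * (w / (w - z))) r = h z * toC (2 * pi) 0.
Proof.
have [l hl] := (cdiffP h z).1 (@he z).
pose q w := if w == z then l else (h w - h z) / (w - z).
pose Q0 w := (h w - h z) / (w - z) * w.
pose Q w := q w * w.
have QE w : w != z -> Q w = Q0 w by rewrite /Q /q; case: eqVneq.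
have Q0d w : w != z -> derivable Q0 w 1.
  move=> wz; apply: derivableM; last exact: derivable_id.
  apply: derivableM; first by apply: derivableB; [exact: he|exact: derivable_cst].
  apply: derivableV; first by rewrite subr_eq0.
  exact: derivableB.
have qc w : q x @[x --> w] --> q w.
  have [->|wz] := eqVneq w z.
    apply/(@cvgCP R C (nbhs z) (nbhs_filter z) q (q z)) => e e0.
    have [d d0 hd] := hl (e / 2) (divr_gt0 e0 (ltr0n _ 2)).
    apply: (@near_absC _ z d) => // x /hd; rewrite /q eqxx; case: eqVneq => [_ _|xz].
      by rewrite subrr absC0.
    have xz0 : x - z != 0 by rewrite subr_eq0.
    move=> H; rewrite -(ltr_pM2r (_ : 0 < absC (x - z))) ?absC_gt0// -absCM.
    have -> : (l - (h x - h z) / (x - z)) * (x - z) = - (h x - h z - l * (x - z)) by field.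
    rewrite absCN (le_lt_trans H)// ltr_pM2r ?absC_gt0// ltr_pdivrMr// ltr_pMr// ltr1n//.
  have wz0 : w - z != 0 by rewrite subr_eq0.
  have H : (fun w => (h w - h z) / (w - z)) x @[x --> w] --> (h w - h z) / (w - z).
    apply: (@cdiff_cvg (fun w => (h w - h z) / (w - z))); apply/cdiffP.
    apply: derivableM; first by apply: derivableB; [exact: he|exact: derivable_cst].
    by apply: derivableV => //; exact: derivableB.
  rewrite /q (negbTE wz); apply: (@eq_near_cvg _ _ w _ (absC (w - z))) H.
    by rewrite absC_gt0.
  by move=> x; case: eqVneq => [->|//]; rewrite absC_dist ltxx.
have Qc w : Q x @[x --> w] --> Q w by exact: (cvgM (qc w) (cvg_id (F := nbhs w))).
have [B hB] := continuous_bounded_disc (absC z) qc.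
have Mconst s s' : 0 < s -> s <= s' -> s' < absC z \/ absC z < s -> mean Q s = mean Q s'.
  move=> s0 ss hs; have neq t : s <= t <= s' -> forall w, absC w = t -> w != z.
    move=> /andP[st ts] w wt; apply/eqP => wz; rewrite -wt wz in st ts.
    by case: hs; rewrite ltNge ?st ?ts.
  have mE t : s <= t <= s' -> mean Q t = mean Q0 t.
    move=> hst; apply: eq_cint => u _; apply: QE; apply: (neq t) => //.
    by rewrite absC_circ// (le_trans (ltW s0))//; case/andP: hst.
  have [h1 h2] : s <= s <= s' /\ s <= s' <= s' by rewrite !lexx ss.
  rewrite (mE _ h1) (mE _ h2).
  apply: (mean_const s0 ss) => w hw.
  by apply/cdiffP; apply: Q0d; apply: neq hw _ _.
(* The factor [w] in [Q] makes the mean of order [s], and the mean does not change while [s] shrinks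
   to 0. *)
have Msmall s : 0 < s -> s < absC z -> mean Q s = 0.
  move=> s0 sz; apply/eqP; rewrite -absC_eq0 eq_le absC_ge0 andbT.
  apply/ler_addgt0Pr => e e0; rewrite add0r.
  pose D := 2 * (`|B| + 1) * (2 * pi).
  have D0 : 0 < D by rewrite !mulr_gt0 ?pi_gt0// ltr_wpDl.
  pose s' := Num.min s (e / D).
  have s'0 : 0 < s' by rewrite lt_min s0 divr_gt0.
  have s's : s' <= s by rewrite ge_min lexx.
  rewrite -(Mconst s' s)//; last by left.
  apply: (@le_trans _ _ (D * s')).
    have -> : D * s' = 2 * ((`|B| + 1) * s') * (2 * pi) by rewrite /D mulrAC mulrA.
    have H := @mean_bound Q s' ((`|B| + 1) * s') (fun t => Qc _).
    apply: H => t.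
    rewrite absCM absC_circ ?(ltW s'0)// ler_pM2r//.
    rewrite (le_trans (hB _ _))//; last by rewrite (le_trans (ler_norm B))// lerDl.
    by rewrite absC_circ ?(ltW s'0)// (le_trans s's)// ltW.
  by rewrite mulrC -ler_pdivlMr// ge_min lexx orbT.
(* There are smaller positive radii only if [z != 0]; for [z = 0] the circle reduces to the origin,
   where [Q] vanishes. *)
have Mz : mean Q (absC z) = 0.
  have := absC_ge0 z; rewrite le_eqVlt => /orP[/eqP z0|z0].
    rewrite -z0 /mean; apply/eqP; rewrite -absC_eq0 eq_le absC_ge0 andbT.
    have := @mean_bound Q 0 0 (fun t => Qc _); rewrite mulr0 mul0r; apply => t.
    by rewrite /Q (_ : circ 0 t = 0) ?mulr0 ?absC0//; exact: mul0r.
  apply/eqP; rewrite -absC_eq0 eq_le absC_ge0 andbT.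
  apply/ler_addgt0Pr => e e0; rewrite add0r.
  have [d d0 hd] := mean_continuous (absC z) Qc e0.
  pose s := Num.max (absC z / 2) (absC z - d / 2).
  have s0 : 0 < s by rewrite lt_max divr_gt0.
  have sz : s < absC z.
    by rewrite gt_max ltrBlDr ltrDl divr_gt0// andbT ltr_pdivrMr// ltr_pMr// ltr1n.
  have := hd s; rewrite (Msmall _ s0 sz) sub0r absCN; apply.
  rewrite ltr0_norm ?subr_lt0// opprB ltrBlDr -ltrBlDl lt_max; apply/orP; right.
  by rewrite ltrD2l ltrN2 ltr_pdivrMr// ltr_pMr// ltr1n.
have Mr : mean Q r = 0.
  apply/eqP; rewrite -absC_eq0 eq_le absC_ge0 andbT.
  apply/ler_addgt0Pr => e e0; rewrite add0r.
  have [d d0 hd] := mean_continuous (absC z) Qc e0.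
  pose s := Num.min r (absC z + d / 2).
  have zs : absC z < s by rewrite lt_min zr ltrDl divr_gt0.
  have s0 : 0 < s by exact: le_lt_trans (absC_ge0 z) zs.
  have := hd s; rewrite Mz subr0 (Mconst s r) ?ge_min ?lexx//; last by right.
  apply; rewrite gtr0_norm ?subr_gt0// ltrBlDl gt_min; apply/orP; right.
  by rewrite ltrD2l ltr_pdivrMr// ltr_pMr// ltr1n.
have kc : cont_on 0 (2 * pi) (fun t => circ r t / (circ r t - z)).
  exact: (@cont_on_circ (fun w => w / (w - z)) r 0 (2 * pi) (@kernel_cvg)).
have hc : cont_on 0 (2 * pi) (fun t => h (circ r t)).
  exact: (@cont_on_circ h r 0 (2 * pi) (fun t => @entire_cvg (circ r t))).
have : mean Q r = mean (fun w => h w * (w / (w - z))) r - h z * mean (fun w => w / (w - z)) r.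
  have E1 := cintZ (h z) kc.
  have E2 := cintB (cont_onM hc kc) (cont_onM (@cont_on_cst R 0 (2 * pi) (h z)) kc).
  rewrite /mean -E1 -E2.
  apply: eq_cint => t _.
  have wz : circ r t - z != 0 by rewrite sub_neq0// absC_circ// ltW.
  by rewrite QE; [rewrite /Q0; field|rewrite -subr_eq0].
by rewrite Mr mean_kernel => /esym/eqP; rewrite subr_eq0 => /eqP.
Qed.

End CauchyFormula.

Definition abs_entire (c : nat -> C) := forall r, 0 <= r ->
  exists S, forall N, \sum_(0 <= k < N) absC (c k) * r ^+ k <= S.

(** Cauchy's kernel is expanded into a finite geometric sum in [z / w] with exact remainder, so no
    limit has to be exchanged with the integral. The coefficients obtained depend a priori on
    [r]. *)
Lemma entire_power_series_disc (h : C -> C) r : entire h -> 0 < r ->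
  exists (c : nat -> C) (B : R), (forall k, absC (c k) * r ^+ k <= B) /\
    forall z, absC z < r -> series (fun k => c k * z ^+ k) @ \oo --> h z.
Proof.
move=> he r0.
have hc z : h x @[x --> z] --> h z by apply: cdiff_cvg; apply/cdiffP; exact: he.
have [B hB] := continuous_bounded_disc r hc.
have tp : toC (2 * pi) 0 != 0 :> C.
  by rewrite -absC_eq0 absC_toC normr_eq0 mulf_neq0// gt_eqF// pi_gt0.
have hk k t : (fun w => h w * w ^- k) x @[x --> circ r t] --> h (circ r t) * circ r t ^- k.
  apply: (cvgM (hc (circ r t))).
  by apply: cvgV; [rewrite expf_neq0// circ_neq0|exact: exprC_cvg].
pose c k := mean (fun w => h w * w ^- k) r / toC (2 * pi) 0.
exists c, (2 * B); split.
  move=> k; rewrite /c absCM absCV absC_toC ger0_norm ?twopi_ge0//.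
  rewrite mulrAC ler_pdivrMr ?mulr_gt0 ?pi_gt0//.
  have -> : 2 * B * (2 * pi) = 2 * (B / r ^+ k) * (2 * pi) * r ^+ k.
    by field; rewrite expf_neq0// gt_eqF.
  rewrite ler_wpM2r ?exprn_ge0 ?(ltW r0)//.
  have H := @mean_bound (fun w => h w * w ^- k) r (B / r ^+ k) (hk k).
  apply: H => t.
  rewrite absCM absCV absCX absC_circ ?(ltW r0)// ler_wpM2r ?invr_ge0 ?exprn_ge0 ?(ltW r0)//.
  by apply: hB; rewrite absC_circ// ltW.
move=> z zr.
(* This dominates the geometric remainder [(z / w) ^+ n * (w / (w - z))] on the circle; [2 * B]
   combines the bound of [h] with the factor 2 of [cint_bound]. *)
apply: (@cvgC_dominated R _ (fun n => 2 * B * (r / (r - absC z)) * (absC z / r) ^+ n)).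
  move=> n; have wz t : circ r t - z != 0.
    by rewrite subr_eq0; apply: contraTneq zr => <-; rewrite absC_circ ?ltxx ?(ltW r0).
  have w0 t : circ r t != 0 by exact: circ_neq0.
  rewrite -(ler_pM2r (_ : 0 < absC (toC (2 * pi) 0 : C))) ?absC_gt0// -absCM mulrBl.
  rewrite -(cauchy_formula he zr).
  have kd t : (fun w => w / (w - z)) x @[x --> circ r t] --> circ r t / (circ r t - z).
    apply: (@cdiff_cvg (fun w => w / (w - z))); apply/cdiffP.
    by apply: derivableM => //; apply: derivableV => //; exact: derivableB.
  (* Continuity of the finite sums is carried through the induction, since additivity of [cint] asks
     for it. *)
  have sumE : forall N, mean (fun w => h w * \sum_(0 <= k < N) (z ^+ k * w ^- k)) r =
      series (fun k => c k * z ^+ k) N * toC (2 * pi) 0 /\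
      cont_on 0 (2 * pi) (fun t => h (circ r t) * \sum_(0 <= k < N) (z ^+ k * circ r t ^- k)).
    elim=> [|N [IH1 IH2]].
      rewrite /series /= big_geq// mul0r; split.
        rewrite /mean (@eq_cint _ _ _ _ (fun=> 0 * h 0)); last first.
          by move=> t _; rewrite big_geq// mulr0 mul0r.
        by rewrite cintZ ?mul0r//; exact: cont_on_cst.
      move=> t _; under eq_fun do rewrite big_geq// mulr0.
      by rewrite big_geq// mulr0; exact: cvg_cst.
    have cN : cont_on 0 (2 * pi) (fun t => z ^+ N * (h (circ r t) * circ r t ^- N)).
      apply: cont_onM; first exact: cont_on_cst.
      exact: (@cont_on_circ (fun w => h w * w ^- N) r 0 (2 * pi) (hk N)).
    split.
      rewrite /series /= big_nat_recr//= mulrDl -IH1 /mean.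
      have -> : c N * z ^+ N * toC (2 * pi) 0 = z ^+ N * mean (fun w => h w * w ^- N) r.
        by rewrite /c; field.
      rewrite -cintZ; last exact: (@cont_on_circ (fun w => h w * w ^- N) r 0 (2 * pi) (hk N)).
      rewrite -cintD//; apply: eq_cint => t _.
      by rewrite big_nat_recr//= mulrDr; congr (_ + _); rewrite mulrCA.
    move=> t ht; have := cont_onD IH2 cN ht.
    under eq_fun do rewrite mulrCA -mulrDr -[_ + _]big_nat_recr//=.
    by rewrite mulrCA -mulrDr -[_ + _]big_nat_recr.
  have [<- cS] := sumE n.
  have kh : cont_on 0 (2 * pi) (fun t => h (circ r t) * (circ r t / (circ r t - z))).
    exact: (@cont_on_circ (fun w => h w * (w / (w - z))) r 0 (2 * pi)
      (fun t => cvgM (hc (circ r t)) (kd t))).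
  have E := cintB kh cS; rewrite /mean -E.
  have -> : 2 * B * (r / (r - absC z)) * (absC z / r) ^+ n * absC (toC (2 * pi) 0 : C) =
     2 * (B * ((absC z / r) ^+ n * (r / (r - absC z)))) * (2 * pi - 0).
    rewrite absC_toC ger0_norm ?twopi_ge0// subr0; ring.
  apply: (@cint_bound R 0 (2 * pi)); first exact: twopi_ge0.
    exact: cont_onB.
  move=> t _.
  have -> : h (circ r t) * (circ r t / (circ r t - z)) -
      h (circ r t) * (\sum_(0 <= k < n) z ^+ k * circ r t ^- k) =
      h (circ r t) * ((z / circ r t) ^+ n * (circ r t / (circ r t - z))).
    rewrite -mulrBr; congr (_ * _); move: (wz t) (w0 t); set w := circ r t => wz' w0'.
    elim: n {cS E} => [|n IH]; first by rewrite big_geq// subr0 expr0 mul1r.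
    rewrite big_nat_recr//= opprD addrA IH -exprVn -exprMn exprS.
    by set X := _ ^+ n; field; rewrite ?w0' ?wz'.
  rewrite absCM ler_pM ?absC_ge0//; first by apply: hB; rewrite absC_circ// ltW.
  have cr : absC (circ r t) = r by rewrite absC_circ// ltW.
  rewrite absCM absCX absCM [absC (circ r t / _)]absCM !absCV cr.
  apply: ler_wpM2l; first by rewrite exprn_ge0// divr_ge0 ?absC_ge0 ?(ltW r0).
  apply: ler_wpM2l; first exact: ltW.
  rewrite lef_pV2 ?posrE ?subr_gt0 ?absC_gt0//.
  by rewrite (le_trans _ (ler_absC_sub _ _))// cr.
rewrite -[X in _ --> X](mulr0 (2 * B * (r / (r - absC z)))); apply: cvgM; first exact: cvg_cst.
apply: cvg_expr; rewrite ger0_norm ?divr_ge0 ?absC_ge0 ?(ltW r0)//.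
by rewrite ltr_pdivrMr// mul1r.
Qed.

Lemma geometric_sum_le2 (B : R) (u : nat -> R) N : 0 <= B ->
  (forall k, u k <= B * 2^-1 ^+ k) -> \sum_(0 <= k < N) u k <= 2 * B.
Proof.
(* The induction runs on the exact geometric sum; the bound [2 * B] alone would not propagate. *)
move=> B0 hu; apply: (@le_trans _ _ (2 * B - 2 * B * 2^-1 ^+ N)); last first.
  by rewrite lerBlDr lerDl !mulr_ge0// exprn_ge0// invr_ge0.
elim: N => [|N IH]; first by rewrite big_geq// expr0 mulr1 subrr.
rewrite big_nat_recr//= (le_trans (lerD IH (hu N)))// exprS.
by rewrite le_eqVlt; apply/orP; left; apply/eqP; set x := _ ^+ N; field.
Qed.

(** The expansions for radius 1 and for radius [r] agree at small positive reals, hence have the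
    same coefficients; so the expansion for radius 1 converges everywhere. *)
Lemma entire_power_series (h : C -> C) : entire h -> exists c, abs_entire c /\
  forall z, series (fun k => c k * z ^+ k) @ \oo --> h z.
Proof.
move=> he; have [c [B [cB ch]]] := entire_power_series_disc he (@ltr01 R).
have all r : 0 < r -> exists B', (forall k, absC (c k) * r ^+ k <= B') /\
    forall z, absC z < r -> series (fun k => c k * z ^+ k) @ \oo --> h z.
  move=> r0; have [c' [B' [cB' ch']]] := entire_power_series_disc he r0.
  suff -> : c = c' by exists B'.
  apply/funext => k; apply/eqP; rewrite -subr_eq0; apply/eqP; move: k.
  pose m := Num.min 1 r; have m0 : 0 < m by rewrite lt_min ltr01.
  have B0 : 0 <= B + B'.
    by rewrite addr_ge0// (le_trans _ (cB 0%N), le_trans _ (cB' 0%N))// mulr_ge0 ?absC_ge0.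
  apply: (@power_series_eq0 R (fun k => c k - c' k) (m / 2) (2 * (B + B'))).
  - by rewrite divr_gt0.
  - move=> N; apply: geometric_sum_le2 => // k.
    rewrite expr_div_n -exprVn mulrA ler_wpM2r ?exprn_ge0 ?invr_ge0//.
    rewrite (le_trans (ler_wpM2r _ (ler_absCB _ _))) ?exprn_ge0 ?(ltW m0)// mulrDl lerD//.
      rewrite (le_trans _ (cB k))// ler_wpM2l ?absC_ge0//.
      by rewrite lerXn2r ?nnegrE ?(ltW m0)// ge_min lexx.
    rewrite (le_trans _ (cB' k))// ler_wpM2l ?absC_ge0//.
    by rewrite lerXn2r ?nnegrE ?(ltW m0)// ?(ltW r0)// ge_min lexx orbT.
  move=> t /andP[t0 tm].
  have tm' : t < m by rewrite (lt_trans tm)// ltr_pdivrMr// ltr_pMr// ltr1n.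
  have t1 : t < 1 by rewrite (lt_le_trans tm')// ge_min lexx.
  have tr : t < r by rewrite (lt_le_trans tm')// ge_min lexx orbT.
  have ta : absC (toC t 0 : C) = t by rewrite absC_toC gtr0_norm.
  have h1 : series (fun k => c k * toC t 0 ^+ k) @ \oo --> h (toC t 0).
    by apply: ch; rewrite ta.
  have h2 : series (fun k => c' k * toC t 0 ^+ k) @ \oo --> h (toC t 0).
    by apply: ch'; rewrite ta.
  have E : series (fun k => (c k - c' k) * toC t 0 ^+ k) =
    (fun N => series (fun k => c k * toC t 0 ^+ k) N - series (fun k => c' k * toC t 0 ^+ k) N).
    apply/funext => N; rewrite /series /= -sumrB.
    by apply: eq_bigr => k _; rewrite mulrBl.
  rewrite E -(subrr (h (toC t 0))); exact: (cvgB h1 h2).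
exists c; split=> [r r0|z].
  (* Coefficients bounded at a radius above [2 * r] decay like [2 ^- k] at radius [r]. *)
  have [B' [hB' _]] := all (2 * r + 1) (ltr_wpDl (mulr_ge0 (ler0n _ 2) r0) ltr01).
  exists (2 * B') => N; apply: geometric_sum_le2.
    by rewrite (le_trans _ (hB' 0%N))// mulr_ge0 ?absC_ge0.
  move=> k; rewrite exprVn ler_pdivlMr ?exprn_gt0// -mulrA -exprMn (le_trans _ (hB' k))//.
  rewrite ler_wpM2l ?absC_ge0// lerXn2r ?nnegrE ?mulr_ge0// ?addr_ge0 ?mulr_ge0//.
  by rewrite mulrC lerDl.
have [] := all (absC z + 1) (ltr_wpDl (absC_ge0 z) ltr01).
by move=> B' [_ H]; apply: H; rewrite ltrDl.
Qed.

End Cauchy.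

(** * Sums of power series are entire *)

Section PowerSeriesEntire.
Variable R : realType.
Local Notation C := (CC R).
Implicit Types (z w u : C) (r : R).

(** The power of 4 absorbs both the factor [k] and the binomial coefficients, so the induction
    closes and the remainders sum by absolute convergence at radius [4 * r]. *)
Lemma absC_expr_taylor2 z u (r : R) k : 1 <= r -> absC z <= r -> absC u <= r ->
  absC ((z + u) ^+ k - z ^+ k - (z ^+ k.-1 *+ k) * u) <= absC u ^+ 2 * (4 * r) ^+ k.
Proof.
move=> r1 zr ur; have r0 : 0 <= r by exact: le_trans r1.
elim: k => [|k IH].
  by rewrite !expr0 subrr sub0r mulr0n mul0r oppr0 absC0 mulr1 sqr_ge0.
have -> : (z + u) ^+ k.+1 - z ^+ k.+1 - (z ^+ k *+ k.+1) * u =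
   (z + u) * ((z + u) ^+ k - z ^+ k - (z ^+ k.-1 *+ k) * u) + (z ^+ k.-1 *+ k) * u ^+ 2.
  have E : z * (z ^+ k.-1 *+ k) = z ^+ k *+ k.
    by case: k {IH} => [|k]; rewrite ?mulr0n ?mulr0// mulrnAr -exprS.
  rewrite !exprS mulrSr; ring: E.
apply: le_trans (ler_absCD _ _) _.
rewrite [absC ((z + u) * _)]absCM [absC (_ * u ^+ 2)]absCM absCX.
have Z : absC (z ^+ k.-1 *+ k) <= 2 ^+ k * r ^+ k.
  rewrite -mulr_natl absCM absC_nat absCX ler_pM ?exprn_ge0 ?absC_ge0//.
    by rewrite -natrX ler_nat ltnW// ltn_expl.
  rewrite (@le_trans _ _ (r ^+ k.-1))//; first by rewrite lerXn2r ?nnegrE ?absC_ge0.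
  by apply: ler_weXn2l => //; exact: leq_pred.
have S : absC (z + u) <= 2 * r by have := ler_absCD z u; lra.
apply: (@le_trans _ _ (2 * r * (absC u ^+ 2 * (4 * r) ^+ k) + 2 ^+ k * r ^+ k * absC u ^+ 2)).
  by rewrite lerD//; [rewrite ler_pM ?absC_ge0|rewrite ler_wpM2r ?sqr_ge0].
rewrite [(4 * r) ^+ k.+1]exprS -exprMn [_ * absC u ^+ 2]mulrC mulrCA -mulrDr ler_wpM2l ?sqr_ge0//.
have : (2 * r) ^+ k <= (4 * r) ^+ k.
  by rewrite lerXn2r ?nnegrE ?mulr_ge0// ler_wpM2r// ler_nat.
have : 0 <= (4 * r) ^+ k by rewrite exprn_ge0// mulr_ge0.
move: ((2 * r) ^+ k) ((4 * r) ^+ k) => a b b0 ab.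
have : b <= r * b by rewrite ler_peMl.
have -> : 2 * r * b + a = 2 * (r * b) + a by rewrite mulrA.
have -> : 4 * r * b = 4 * (r * b) by rewrite mulrA.
move: (r * b) => c; lra.
Qed.

(** Termwise differentiation: [k <= 2 ^ k] makes the derived series converge, and the second-order
    remainders sum to a constant times [absC (w - z) ^+ 2]. *)
Lemma power_series_entire (c : nat -> C) (h : C -> C) : abs_entire c ->
  (forall z, series (fun k => c k * z ^+ k) @ \oo --> h z) -> entire h.
Proof.
move=> ca ch z; apply/cdiffP.
pose r := absC z + 1.
have r1 : 1 <= r by rewrite lerDr absC_ge0.
have r0 : 0 <= r by exact: le_trans r1.
have [S hS] := ca (4 * r) (mulr_ge0 (ler0n _ 4) r0).
have S0 : 0 <= S by have := hS 0%N; rewrite big_geq.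
have [l hl] : exists l : C, series (fun k => c k * (z ^+ k.-1 *+ k)) @ \oo --> l.
  apply: (@absC_series_cvg R _ S) => N; apply: le_trans (hS N); apply: ler_sum => k _.
  rewrite absCM ler_wpM2l ?absC_ge0// -mulr_natl absCM absC_nat absCX exprMn.
  rewrite ler_pM ?exprn_ge0 ?absC_ge0//.
    by rewrite -natrX ler_nat ltnW// ltn_expl.
  rewrite (@le_trans _ _ (r ^+ k.-1))//; first by rewrite lerXn2r ?nnegrE ?absC_ge0// lerDl.
  by apply: ler_weXn2l => //; exact: leq_pred.
have key w : absC (w - z) <= 1 -> absC (h w - h z - l * (w - z)) <= S * absC (w - z) ^+ 2.
  move=> wz.
  have H : (fun N => series (fun k => c k * w ^+ k) N - series (fun k => c k * z ^+ k) N -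
     series (fun k => c k * (z ^+ k.-1 *+ k)) N * (w - z)) @ \oo --> h w - h z - l * (w - z).
    exact: (cvgB (cvgB (ch w) (ch z)) (cvgM hl (@cvg_cst _ (w - z) _ \oo _))).
  apply: ler_absC_lim H _ => N.
  rewrite /series /= mulr_suml -!sumrB (le_trans (absC_sum _ _ _))//.
  apply: (@le_trans _ _ (\sum_(0 <= k < N) absC (c k) * (4 * r) ^+ k * absC (w - z) ^+ 2)).
    apply: ler_sum => k _.
    have -> : c k * w ^+ k - c k * z ^+ k - c k * (z ^+ k.-1 *+ k) * (w - z) =
        c k * ((z + (w - z)) ^+ k - z ^+ k - (z ^+ k.-1 *+ k) * (w - z)).
      by rewrite [z + (w - z)]addrC subrK; ring.
    rewrite absCM -[leRHS]mulrA; apply: ler_wpM2l; first exact: absC_ge0.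
    rewrite [leRHS]mulrC; apply: absC_expr_taylor2 => //; first by rewrite lerDl.
    exact: le_trans r1.
  by rewrite -mulr_suml ler_wpM2r ?sqr_ge0.
exists l => e e0; exists (Num.min 1 (e / (S + 1))).
  by rewrite lt_min ltr01 divr_gt0// ltr_wpDl.
move=> w; rewrite lt_min => /andP[w1 we]; apply: le_trans (key w (ltW w1)) _.
rewrite expr2 mulrA ler_wpM2r ?absC_ge0//.
rewrite (@le_trans _ _ ((S + 1) * absC (w - z)))//.
  by rewrite ler_wpM2r ?absC_ge0// lerDl.
by rewrite mulrC -ler_pdivlMr ?ltr_wpDl// ltW.
Qed.

End PowerSeriesEntire.

(** * Fock norm of a power series *)

Section PlaneIntegral.
Variable R : realType.
Local Notation C := (CC R).
Local Notation mu := (@lebesgue_measure R).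
Local Notation area := ((@lebesgue_measure R) \x (@lebesgue_measure R))%E.

(** The image of Lebesgue measure under the translation has the right value on half-open intervals,
    which determines it. *)
Lemma ge0_integral_translate (c : R) (f : measurableTypeR R -> \bar R) :
  measurable_fun setT f -> (forall x, (0 <= f x)%E) ->
  (\int[mu]_x f ((x : R) + c)%R)%E = (\int[mu]_x f x)%E.
Proof.
move=> mf f0; pose g := (fun x : R => x + c) : measurableTypeR R -> measurableTypeR R.
have mg : measurable_fun setT g by exact: measurable_funD.
pose gm := isMeasurableFun.Build _ _ _ _ g mg.
pose phi : {mfun _ >-> _} := HB.pack g gm.
transitivity (\int[pushforward mu phi]_x f x)%E.
  have H : {in setT, forall y, (0 <= f y)%E} by move=> y _.
  exact: (esym (ge0_integral_pushforward mg mu measurableT mf H)).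
apply: eq_measure_integral => A mA _.
apply/esym/lebesgue_measure_unique => //= _ [[a b]] _ <-.
rewrite /pushforward (_ : _ @^-1` _ = `]a - c, b - c]%classic).
  rewrite !lebesgue_measure_itv /= !lte_fin ltrD2r -!EFinD.
  by rewrite opprB addrA subrK.
by apply/seteqP; split => x /=; rewrite !in_itv /= ltrBlDr lerBrDr.
Qed.

(** Half of an interchange of limit and integral, from nonnegativity alone. *)
Lemma fatou_cvg_le d (T : measurableType d) (m : {measure set T -> \bar R})
    (f : nat -> T -> \bar R) (g : T -> \bar R) (B : \bar R) :
  (forall n, measurable_fun setT (f n)) -> (forall n x, (0 <= f n x)%E) ->
  (forall x, f ^~ x @ \oo --> g x) -> (forall n, (\int[m]_x f n x <= B)%E) ->
  (\int[m]_x g x <= B)%E.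
Proof.
move=> mf f0 fg fB.
have -> : (\int[m]_x g x)%E = (\int[m]_x limn_einf (f^~ x))%E.
  by apply: eq_integral => x _; rewrite (cvg_limn_einf_sup (fg x)).1.
apply: le_trans (fatou m measurableT mf (fun n x _ => f0 n x)) _.
rewrite limn_einf_lim; apply: lime_le; first exact: is_cvg_einfs.
apply: nearW => n; apply: le_trans (fB n).
by apply: ereal_inf_lbound; exists n => /=.
Qed.

Local Notation RR := (measurableTypeR R * measurableTypeR R)%type.

Lemma measurable_affine (a b : R) : measurable_fun setT (fun p : RR => a * p.1 + b * p.2 : R).
Proof.
by apply: measurable_funD; apply: measurable_funM.
Qed.

(** By Tonelli's theorem: for a fixed second coordinate the shear translates the first. *)
Lemma ge0_integral_shear1 (a : R) (F : RR -> \bar R) :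
  measurable_fun setT F -> (forall p, (0 <= F p)%E) ->
  (\int[area]_p F (p.1 + a * p.2, p.2)%R)%E = (\int[area]_p F p)%E.
Proof.
move=> mF F0.
have mS : measurable_fun setT (fun p : RR => (p.1 + a * p.2, p.2) : RR).
  apply: measurable_fun_pair; last exact: measurable_snd.
  by have := measurable_affine 1 a; under eq_fun do rewrite mul1r.
rewrite (@fubini_tonelli2 _ _ _ _ _ mu mu (fun p => F (p.1 + a * p.2, p.2)))//; last first.
  exact: (measurableT_comp mF mS).
rewrite fubini_tonelli2//; apply: eq_integral => y _; rewrite /fubini_G /=.
apply: (@ge0_integral_translate (a * y) (fun x => F (x, y))) => //.
exact: measurable_fun_pair1.
Qed.

Lemma ge0_integral_shear2 (a : R) (F : RR -> \bar R) :
  measurable_fun setT F -> (forall p, (0 <= F p)%E) ->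
  (\int[area]_p F (p.1, p.2 + a * p.1)%R)%E = (\int[area]_p F p)%E.
Proof.
move=> mF F0.
have mS : measurable_fun setT (fun p : RR => (p.1, p.2 + a * p.1) : RR).
  apply: measurable_fun_pair; first exact: measurable_fst.
  by have := measurable_affine a 1; under eq_fun do rewrite mul1r addrC.
rewrite (@fubini_tonelli1 _ _ _ _ _ mu mu (fun p => F (p.1, p.2 + a * p.1)))//; last first.
  exact: (measurableT_comp mF mS).
rewrite fubini_tonelli1//; apply: eq_integral => x _; rewrite /fubini_F /=.
apply: (@ge0_integral_translate (a * x) (fun y => F (x, y))) => //.
exact: measurable_fun_pair2.
Qed.

(* a rotation by an angle other than pi is a product of three shears *)
Lemma ge0_integral_rotation (c s : R) (F : RR -> \bar R) :
  c ^+ 2 + s ^+ 2 = 1 -> 1 + c != 0 ->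
  measurable_fun setT F -> (forall p, (0 <= F p)%E) ->
  (\int[area]_p F (c * p.1 - s * p.2, s * p.1 + c * p.2)%R)%E = (\int[area]_p F p)%E.
Proof.
(* [t] is the tangent of half the angle, whence the condition on [1 + c]; the three shears have
   coefficients [- t], [s], [- t]. *)
move=> cs c1 mF F0; pose t := s / (1 + c).
have ts : 1 - t * s = c.
  have s2 : s ^+ 2 = (1 + c) * (1 - c).
    by rewrite (_ : s ^+ 2 = 1 - c ^+ 2); [ring|rewrite -cs; ring].
  by rewrite /t mulrAC -expr2 s2 mulrAC divff// mul1r; ring.
have tc : t * (1 + c) = s by rewrite /t divfK.
have mS1 a : measurable_fun setT (fun p : RR => (p.1 + a * p.2, p.2) : RR).
  apply: measurable_fun_pair; last exact: measurable_snd.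
  by have := measurable_affine 1 a; under eq_fun do rewrite mul1r.
have mS2 a : measurable_fun setT (fun p : RR => (p.1, p.2 + a * p.1) : RR).
  apply: measurable_fun_pair; first exact: measurable_fst.
  by have := measurable_affine a 1; under eq_fun do rewrite mul1r addrC.
have mF1 := measurableT_comp mF (mS1 (- t)).
have mF2 := measurableT_comp mF1 (mS2 s).
rewrite -(ge0_integral_shear1 (- t) mF F0).
rewrite -(ge0_integral_shear2 s mF1 (fun p => F0 _)).
rewrite -(ge0_integral_shear1 (- t) mF2 (fun p => F0 _)).
apply: eq_integral => -[x y] _ /=; congr (F (_, _)).
  have -> : c * x - s * y = (1 - t * s) * x - t * (1 + (1 - t * s)) * y by rewrite ts tc.
  ring.
have -> : s * x + c * y = s * x + (1 - t * s) * y by rewrite ts.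
ring.
Qed.

End PlaneIntegral.

(** * Roots of unity and the discrete Parseval identity *)

Section RootsOfUnity.
Variable R : realType.
Local Notation C := (CC R).

Lemma CC_prim_root_exists n : (0 < n)%N -> exists w : C, n.-primitive_root w.
Proof.
pose p : {poly C} := 'X^n - 1; have [r Dp] := closed_field_poly_normal p.
move=> n0; rewrite (monicP _) ?monicXnsubC// scale1r in Dp.
have rn1 : all n.-unity_root r by apply/allP => z; rewrite -root_prod_XsubC -Dp.
have sz_r : (n < (size r).+1)%N.
  by rewrite -(size_prod_XsubC r id) -Dp size_XnsubC.
have [|z _ hz] := hasP (has_prim_root n0 rn1 _ sz_r); last by exists z.
by rewrite -separable_prod_XsubC -Dp separable_Xn_sub_1// pnatr_eq0 -lt0n.
Qed.

Lemma absC_prim_root n (w : C) : n.-primitive_root w -> absC w = 1.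
Proof.
move=> hw; have n0 := prim_order_gt0 hw.
apply/eqP; rewrite -(@pexpr_eq1 _ _ n) ?absC_ge0//.
by rewrite -absCX (prim_expr_order hw) absC1.
Qed.

(** On the unit circle, real part -1 forces the value -1, whose square is 1. *)
Lemma prim_root_neqN1 n (w : C) : (2 < n)%N -> n.-primitive_root w -> 1 + reC w != 0.
Proof.
move=> n2 hw; apply: contraTneq n2 => w0; rewrite -leqNgt.
have re1 : reC w = -1 by apply/eqP; rewrite -addr_eq0 addrC w0.
have im0 : imC w = 0.
  have := absC_sqr w; rewrite (absC_prim_root hw) re1 => /eqP.
  by rewrite sqrrN !expr1n eq_sym -subr_eq0 addrAC subrr add0r sqrf_eq0 => /eqP.
have : w ^+ 2 = 1.
  by apply: CC_eqP; rewrite expr2 ?(reCM, imCM) re1 im0 /=; ring.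
move/eqP; rewrite -(prim_order_dvd hw) => /dvdn_leq; exact.
Qed.

(** Orthogonality of characters: for [k != l] the quotient [v] of the two powers of [w] is an [N]-th
    root of unity other than 1, and the sum of its powers vanishes. *)
Lemma parseval_prim_root N (w : C) (x : nat -> C) : N.-primitive_root w ->
  \sum_(0 <= j < N) absC (\sum_(0 <= k < N) x k * w ^+ (j * k)) ^+ 2 =
  N%:R * \sum_(0 <= k < N) absC (x k) ^+ 2.
Proof.
move=> hw; have w1 := absC_prim_root hw.
have wc : w * w^* = 1 by rewrite mulC_conj w1 expr1n.
have wn j : w ^+ j * (w ^+ j)^* = 1.
  by rewrite mulC_conj absCX w1 !expr1n.
have orth (k l : 'I_N) :
    \sum_(j < N) w ^+ (j * k) * (w ^+ (j * l))^* = (if k == l then N%:R else 0 : C).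
  have [->|kl] := eqVneq k l.
    by under eq_bigr do rewrite wn; rewrite sumr_const card_ord.
  pose v := w ^+ k * (w ^+ l)^*.
  have vj (j : 'I_N) : w ^+ (j * k) * (w ^+ (j * l))^* = v ^+ j.
    by rewrite /v exprMn !(mulnC j) !exprM rmorphXn.
  have vN : v ^+ N = 1.
    rewrite /v exprMn -rmorphXn /= -!exprM !(mulnC _ N) !exprM (prim_expr_order hw).
    by rewrite !expr1n rmorph1 mulr1.
  have v1 : v != 1.
    apply: contraNneq kl => v1; apply/eqP/val_inj => /=.
    have : w ^+ k == w ^+ l.
      by rewrite -[w ^+ k]mulr1 -(wn l) mulrA mulrAC -/v v1 mul1r.
    by rewrite (eq_prim_root_expr hw) !modn_small// => /eqP.
  under eq_bigr do rewrite vj.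
  have := subrX1 v N; rewrite vN subrr => /esym/eqP.
  by rewrite mulf_eq0 subr_eq0 (negbTE v1) => /eqP.
apply: (@complexI R); rewrite rmorphM !rmorph_sum rmorph_nat /= !big_mkord.
transitivity (\sum_(j < N) \sum_(k < N) \sum_(l < N)
    (x k * (x l)^*) * (w ^+ (j * k) * (w ^+ (j * l))^*)).
  apply: eq_bigr => j _; rewrite -[LHS]mulC_conj rmorph_sum /= !big_mkord mulr_suml.
  apply: eq_bigr => k _; rewrite mulr_sumr; apply: eq_bigr => l _.
  by rewrite rmorphM /= mulrACA.
rewrite exchange_big mulr_sumr; apply: eq_bigr => k _.
rewrite exchange_big (bigD1 k)//= [X in _ + X]big1 ?addr0 => [|l lk]; last first.
  by rewrite -mulr_sumr orth eq_sym (negbTE lk) mulr0.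
by rewrite -mulr_sumr orth eqxx mulrC -[real_complex _ _]mulC_conj.
Qed.

End RootsOfUnity.

(** Uniqueness of power series applied to the coefficients [a n - 1]. *)
Lemma geometric_series_unique (R : realType) (a : nat -> R) : (forall n, 0 <= a n) ->
  (forall t, 0 < t < 1 -> series (fun n => a n * t ^+ n) @ \oo --> (1 - t)^-1) ->
  (forall t, 0 < t < 1 -> forall N, \sum_(0 <= n < N) a n * t ^+ n <= (1 - t)^-1) ->
  forall k, a k = 1.
Proof.
move=> a0 cva bda k.
have geo (t : R) : 0 < t < 1 -> series (fun n => t ^+ n) @ \oo --> (1 - t)^-1.
  move=> /andP[t0 t1]; have := @cvg_geometric_series _ 1 t.
  rewrite ger0_norm ?(ltW t0)// => /(_ t1).
  by rewrite mul1r /geometric; under eq_fun do rewrite mul1r.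
have h2 : 0 < (2^-1 : R) < 1 by rewrite invr_gt0 ltr0n invf_lt1 ?ltr1n.
have toCX t n : (toC t 0 : CC R) ^+ n = toC (t ^+ n) 0.
  by rewrite !toCE rmorphXn.
suff : toC (a k - 1) 0 = 0 :> CC R by case => /eqP; rewrite subr_eq0 => /eqP.
(* At radius 1/2 each of the two series has partial sums at most 2, hence the bound 4. *)
move: k; apply: (@power_series_eq0 R (fun n => toC (a n - 1) 0) 2^-1 4).
- by case/andP: h2.
- move=> N; apply: (@le_trans _ _ (\sum_(0 <= n < N) (a n * 2^-1 ^+ n + 2^-1 ^+ n))).
    apply: ler_sum => n _; rewrite absC_toC -[X in _ <= _ + X]mul1r -mulrDl ler_wpM2r//.
    by rewrite (le_trans (ler_normB _ _))// normr1 ger0_norm.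
  rewrite big_split /= [leRHS](_ : _ = 2 + 2); last by rewrite -natrD.
  apply: lerD.
    by rewrite (le_trans (bda _ h2 N))// le_eqVlt; apply/orP; left; apply/eqP; field.
  by rewrite (le_trans (@geometric_sum_le2 R 1 _ N ler01 _)) ?mulr1// => n; rewrite mul1r.
- move=> t /andP[t0 t2].
  have t01 : 0 < t < 1 by rewrite t0 (lt_trans t2)//; case/andP: h2.
  apply: cvgC_reim.
    have -> : @reC R \o series (fun n => toC (a n - 1) 0 * toC t 0 ^+ n) =
        (fun N => series (fun n => a n * t ^+ n) N - series (fun n => t ^+ n) N).
      apply/funext => N; rewrite /series /= reC_sum -sumrB; apply: eq_bigr => n _.
      by rewrite toCX reCM /=; ring.
    rewrite [X in _ --> X](_ : _ = (1 - t)^-1 - (1 - t)^-1); last by rewrite subrr.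
    exact: (cvgB (cva t t01) (geo t t01)).
  have -> : @imC R \o series (fun n => toC (a n - 1) 0 * toC t 0 ^+ n) = fun=> 0.
    by apply/funext => N; rewrite /series /= imC_sum big1// => n _; rewrite toCX imCM /=; ring.
  exact: cvg_cst.
Qed.

(** * Gaussian moments of the plane *)

Section GaussianMoments.
Variable R : realType.
Local Notation C := (CC R).
Local Notation mu := (@lebesgue_measure R).
Local Notation area := ((@lebesgue_measure R) \x (@lebesgue_measure R))%E.
Local Notation RR := (measurableTypeR R * measurableTypeR R)%type.
Local Open Scope ereal_scope.

(** The integrand is a multiple of the centred normal density of variance [1 / (2 * l)], which has
    total mass 1. *)
Lemma integral_expR_Nsqr (l : R) : (0 < l)%R ->
  \int[mu]_x (expR (- (l * x ^+ 2)))%:E = (Num.sqrt (pi / l))%:E.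
Proof.
move=> l0; pose s : R := Num.sqrt ((2 * l)^-1).
have s2 : (s ^+ 2 = (2 * l)^-1)%R by rewrite sqr_sqrtr// invr_ge0 mulr_ge0// ltW.
have s0 : s != 0%R by rewrite gt_eqF// sqrtr_gt0 invr_gt0 mulr_gt0.
have peakE : normal_peak s = (Num.sqrt (pi / l))^-1%R.
  rewrite /normal_peak s2; congr ((Num.sqrt _)^-1)%R.
  by rewrite -mulr_natr; move: pi => p; field; rewrite gt_eqF.
have p0 : (0 < Num.sqrt (pi / l))%R by rewrite sqrtr_gt0 divr_gt0// pi_gt0.
have := integral_normal_pdf 0 s.
under eq_integral => x _.
  rewrite normal_pdfE// peakE.
  have -> : normal_fun 0 s x = expR (- (l * x ^+ 2)).
    rewrite /normal_fun subr0 s2; congr expR.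
    by rewrite -mulr_natr; field; rewrite gt_eqF.
  rewrite EFinM.
  over.
rewrite /= ge0_integralZl_EFin//; last first.
  apply/measurable_EFinP; apply: measurableT_comp => //.
  by apply: measurableT_comp => //; apply: measurable_funM => //; apply: measurable_funX.
move/(congr1 (fun x => (Num.sqrt (pi / l))%:E * x)).
by rewrite muleA -EFinM divff ?gt_eqF// mul1e mule1.
Qed.

Lemma integral_expR_plane (l : R) : (0 < l)%R ->
  \int[area]_p (expR (- (l * (p.1 ^+ 2 + p.2 ^+ 2))))%:E = (pi / l)%:E.
Proof.
move=> l0.
have m1 : measurable_fun setT (fun x : measurableTypeR R => expR (- (l * x ^+ 2))).
  apply: measurableT_comp => //.
  by apply: measurableT_comp => //; apply: measurable_funM => //; apply: measurable_funX.
have mf : measurable_fun setT (fun p : RR => (expR (- (l * (p.1 ^+ 2 + p.2 ^+ 2))))%:E).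
  apply/measurable_EFinP; apply: measurableT_comp => //.
  apply: measurableT_comp => //; apply: measurable_funM => //.
  by apply: measurable_funD; apply: measurable_funX.
rewrite fubini_tonelli1//.
have E x : fubini_F mu (fun p : RR => (expR (- (l * (p.1 ^+ 2 + p.2 ^+ 2))))%:E) x =
    (Num.sqrt (pi / l))%:E * (expR (- (l * x ^+ 2)))%:E.
  rewrite /fubini_F /=.
  under eq_integral do rewrite mulrDr opprD expRD EFinM.
  rewrite ge0_integralZl_EFin//; [|exact/measurable_EFinP].
  by rewrite integral_expR_Nsqr// muleC.
under eq_integral do rewrite E.
rewrite ge0_integralZl_EFin//; [|exact/measurable_EFinP].
rewrite integral_expR_Nsqr// -EFinM -expr2 sqr_sqrtr//.
by rewrite divr_ge0 ?pi_ge0// ltW.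
Qed.

Lemma nneseries_EFin (u : nat -> R) (s : R) : (series u @ \oo --> s)%R ->
  \sum_(0 <= k <oo) (u k)%:E = s%:E.
Proof.
move=> us; apply/cvg_lim => //.
have -> : (fun n => \sum_(0 <= k < n) (u k)%:E) = EFin \o series u.
  by apply/funext => n; rewrite sumEFin.
by apply/cvg_EFin; [exact: nearW|exact: us].
Qed.

Lemma exp_series_cvg (x : R) : (series (exp_coeff x) @ \oo --> expR x)%R.
Proof.
have /cvg_ex[l hl] := is_cvg_series_exp_coeff x.
by rewrite /expR (cvg_lim _ hl).
Qed.

(* The moments are read off their generating function:
   [sum_k t^k / k! int |z|^(2k) e^(-|z|^2) = int e^(-(1-t)|z|^2) = pi / (1 - t)]. *)
Lemma gauss_moment (k : nat) :
  \int[area]_p (absC (toC p.1 p.2) ^+ (2 * k) * gauss_weight p)%:E = (pi * k`!%:R)%:E.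
Proof.
have absE (p : R * R) n : (absC (toC p.1 p.2) ^+ (2 * n) = (p.1 ^+ 2 + p.2 ^+ 2) ^+ n)%R.
  by rewrite exprM absC_sqr.
pose f n (p : RR) := ((p.1 ^+ 2 + p.2 ^+ 2) ^+ n * gauss_weight p)%:E.
have f0 n p : 0 <= f n p.
  by rewrite lee_fin mulr_ge0 ?expR_ge0// exprn_ge0// addr_ge0 ?sqr_ge0.
have mf n : measurable_fun setT (f n).
  apply/measurable_EFinP; apply: measurable_funM.
    by apply: measurable_funX; apply: measurable_funD; apply: measurable_funX.
  apply: measurableT_comp => //; apply: measurableT_comp => //.
  by apply: measurable_funD; apply: measurable_funX.
pose m n := \int[area]_p f n p.
have m0 n : 0 <= m n by exact: integral_ge0.
have gen (t : R) : (0 < t < 1)%R ->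
    \sum_(0 <= n <oo) ((t ^+ n / n`!%:R)%:E * m n) = (pi / (1 - t))%:E.
  move=> /andP[t0 t1]; rewrite -(@integral_expR_plane (1 - t)) ?subr_gt0//.
  have c0 n : (0 <= t ^+ n / n`!%:R)%R by rewrite divr_ge0// exprn_ge0// ltW.
  have E n : (t ^+ n / n`!%:R)%:E * m n = \int[area]_p ((t ^+ n / n`!%:R)%:E * f n p).
    by rewrite (ge0_integralZl_EFin _ measurableT (fun p _ => f0 n p) (mf n) (c0 n)).
  under eq_eseriesr => n _ do rewrite E.
  rewrite -integral_nneseries//; last 2 first.
  - by move=> n; apply: emeasurable_funM => //; exact: measurable_cst.
  - by move=> n x _; rewrite mule_ge0// lee_fin.
  apply: eq_integral => p _.
  set s := (p.1 ^+ 2 + p.2 ^+ 2)%R.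
  have -> : (expR (- ((1 - t) * s)) = expR (t * s) * gauss_weight p)%R.
    by rewrite /gauss_weight -expRD -/s; congr expR; ring.
  have -> : (expR (t * s) * gauss_weight p)%:E = (gauss_weight p)%:E * (expR (t * s))%:E.
    by rewrite mulrC EFinM.
  rewrite -(nneseries_EFin (@exp_series_cvg (t * s)%R)).
  rewrite -nneseriesZl; last first.
    move=> n _; rewrite lee_fin /exp_coeff /= divr_ge0// exprn_ge0// mulr_ge0 ?(ltW t0)//.
    by rewrite addr_ge0 ?sqr_ge0.
  apply: eq_eseriesr => n _; rewrite /f -/s -!EFinM /exp_coeff /=; congr EFin.
  rewrite exprMn; ring.
(* Finiteness of a moment is read off the generating series at 1/2: the sum is finite and the moment
   enters with a positive coefficient. *)
have mfin n : m n = (fine (m n))%:E.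
  rewrite fineK// ge0_fin_numE//.
  have h2 : (0 < (2^-1 : R) < 1)%R by rewrite invr_gt0 ltr0n invf_lt1 ?ltr1n.
  have cp : (0 < (2^-1 : R) ^+ n / n`!%:R)%R.
    by rewrite divr_gt0 ?exprn_gt0 ?invr_gt0// ltr0n fact_gt0.
  have : ((2^-1 : R) ^+ n / n`!%:R)%:E * m n < +oo.
    apply: (@le_lt_trans _ _ (pi / (1 - 2^-1))%:E); last exact: ltry.
    rewrite -(gen _ h2); apply: le_trans (nneseries_lim_ge n.+1 _); last first.
      by move=> i _ _; rewrite mule_ge0// lee_fin divr_ge0// exprn_ge0// invr_ge0.
    rewrite big_nat_recr//= leeDr// sume_ge0// => i _.
    by rewrite mule_ge0// lee_fin divr_ge0// exprn_ge0// invr_ge0.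
  move: (m0 n); case: (m n) => [r _ _|_|//]; first exact: ltry.
  by rewrite gt0_muley ?lte_fin.
suff H : (fine (m k) = pi * k`!%:R)%R.
  by under eq_integral do rewrite absE; rewrite -/(m k) mfin H.
(* Normalised moments: their generating function is [(1 - t)^-1] and the claim becomes [a k = 1]. *)
pose a n := (fine (m n) / n`!%:R / pi)%R.
have a0 n : (0 <= a n)%R.
  by rewrite !divr_ge0 ?pi_ge0// -lee_fin -mfin.
have ser (t : R) : (0 < t < 1)%R -> (series (fun n => a n * t ^+ n) @ \oo --> (1 - t)^-1)%R /\
    (forall N, (\sum_(0 <= n < N) a n * t ^+ n <= (1 - t)^-1)%R).
  move=> t01; have := gen t t01; under eq_eseriesr => n _.
    have -> : (t ^+ n / n`!%:R)%:E * m n = (pi * (a n * t ^+ n))%:E.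
      rewrite mfin -EFinM /a; congr EFin.
      have := pi_gt0 R; move: pi => p p0; field.
      by rewrite gt_eqF//= pnatr_eq0 -lt0n fact_gt0.
    over.
  move=> H; have b N : (\sum_(0 <= n < N) a n * t ^+ n <= (1 - t)^-1)%R.
    rewrite -(ler_pM2l (@pi_gt0 R)) mulr_sumr -lee_fin -sumEFin -H.
    apply: nneseries_lim_ge => n _ _; rewrite lee_fin; apply: mulr_ge0; first exact: pi_ge0.
    by apply: mulr_ge0 => //; apply: exprn_ge0; case/andP: t01 => /ltW.
  split => //; have [|T [hT _ _]] := nneg_series_cvg _ b.
    by move=> n; apply: mulr_ge0 => //; apply: exprn_ge0; case/andP: t01 => /ltW.
  suff <- : T = (1 - t)^-1%R by [].
  have hT' : (series (fun n => pi * (a n * t ^+ n)) @ \oo --> pi * T)%R.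
    have -> : series (fun n => pi * (a n * t ^+ n))%R =
        (fun N => pi * series (fun n => a n * t ^+ n) N)%R.
      by apply/funext => N; rewrite /series /= mulr_sumr.
    exact: (cvgM (@cvg_cst _ (pi : R) _ \oo _) hT).
  have [E] := etrans (esym (nneseries_EFin hT')) H.
  exact: (mulfI (lt0r_neq0 (pi_gt0 R)) E).
have : a k = 1%R.
  apply: geometric_series_unique => // t t01; last by case: (ser t t01).
  by case: (ser t t01) => + _.
rewrite /a => H; have k0 : (0 < (k`!%:R : R))%R by rewrite ltr0n fact_gt0.
rewrite -[LHS](divfK (lt0r_neq0 k0)); congr (_ * _)%R.
by rewrite -[LHS](divfK (lt0r_neq0 (pi_gt0 R))) H mul1r.
Qed.

End GaussianMoments.

(** * Averaging over roots of unity *)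

Section FockNorm.
Variable R : realType.
Local Notation C := (CC R).
Local Notation area := ((@lebesgue_measure R) \x (@lebesgue_measure R))%E.
Local Notation RR := (measurableTypeR R * measurableTypeR R)%type.
Implicit Types (z w : C).

Definition measC (g : RR -> C) :=
  measurable_fun setT (fun p => reC (g p)) /\ measurable_fun setT (fun p => imC (g p)).

Lemma measC_cst (c : C) : measC (fun=> c).
Proof. by split; exact: measurable_cst. Qed.
Lemma measC_id : measC (fun p => toC p.1 p.2).
Proof. by split; [exact: measurable_fst|exact: measurable_snd]. Qed.
Lemma measCD g h : measC g -> measC h -> measC (fun p => g p + h p).
Proof.
move=> [g1 g2] [h1 h2]; split.
  by under eq_fun do rewrite reCD; exact: measurable_funD.
by under eq_fun do rewrite imCD; exact: measurable_funD.
Qed.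
Lemma measCM g h : measC g -> measC h -> measC (fun p => g p * h p).
Proof.
move=> [g1 g2] [h1 h2]; split.
  by under eq_fun do rewrite reCM; apply: measurable_funB; exact: measurable_funM.
by under eq_fun do rewrite imCM; apply: measurable_funD; exact: measurable_funM.
Qed.
Lemma measCX g n : measC g -> measC (fun p => g p ^+ n).
Proof.
move=> mg; elim: n => [|n IH].
  by under eq_fun do rewrite expr0; exact: measC_cst.
by under eq_fun do rewrite exprS; exact: measCM.
Qed.
Lemma measC_sum (g : nat -> RR -> C) N : (forall k, measC (g k)) ->
  measC (fun p => \sum_(0 <= k < N) g k p).
Proof.
move=> mg; elim: N => [|N IH].
  by under eq_fun do rewrite big_geq//; exact: measC_cst.
by under eq_fun do rewrite big_nat_recr//=; exact: measCD.
Qed.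
Lemma measC_lim (g : nat -> RR -> C) (h : RR -> C) : (forall k, measC (g k)) ->
  (forall p, (fun k => g k p) @ \oo --> h p) -> measC h.
Proof.
move=> mg gh; split.
  apply: (@measurable_fun_cvg _ _ _ setT (fun k p => reC (g k p))) => [k|p _].
    by case: (mg k).
  exact: cvg_reC (gh p).
apply: (@measurable_fun_cvg _ _ _ setT (fun k p => imC (g k p))) => [k|p _].
  by case: (mg k).
exact: cvg_imC (gh p).
Qed.

Definition dens (g : RR -> C) (p : RR) : R := absC (g p) ^+ 2 * gauss_weight p.

Lemma gauss_weight_ge0 (p : RR) : 0 <= gauss_weight p. Proof. exact: expR_ge0. Qed.
Lemma dens_ge0 g p : 0 <= dens g p.
Proof. by rewrite mulr_ge0 ?sqr_ge0// gauss_weight_ge0. Qed.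

Lemma measurable_gauss_weight : measurable_fun setT (fun p : RR => gauss_weight p).
Proof.
rewrite /gauss_weight; apply: measurableT_comp => //; apply: measurableT_comp => //.
by apply: measurable_funD; apply: measurable_funX.
Qed.

Lemma measurable_dens g : measC g -> measurable_fun setT (dens g).
Proof.
move=> [g1 g2]; apply: measurable_funM; last exact: measurable_gauss_weight.
under eq_fun do rewrite absC_sqr.
by apply: measurable_funD; apply: measurable_funX.
Qed.

(** The Gaussian weight depends on the modulus only, so this is rotation invariance of the area; the
    half-turn is excluded because of the shears. *)
Lemma integral_dens_rotation (w : C) (g : C -> C) : absC w = 1 -> 1 + reC w != 0 ->
  measC (fun p => g (toC p.1 p.2)) ->
  (\int[area]_p (dens (fun p => g (w * toC p.1 p.2)) p)%:E =
   \int[area]_p (dens (fun p => g (toC p.1 p.2)) p)%:E)%E.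
Proof.
move=> w1 wr mg; set F := dens (fun p => g (toC p.1 p.2)).
have cs : reC w ^+ 2 + imC w ^+ 2 = 1 by rewrite -absC_sqr w1 expr1n.
rewrite -[RHS](@ge0_integral_rotation R (reC w) (imC w) (fun p => (F p)%:E) cs wr); last 2 first.
- by apply/measurable_EFinP; exact: measurable_dens.
- by move=> p; rewrite lee_fin dens_ge0.
apply: eq_integral => p _; congr EFin; rewrite /F /dens /=; congr (absC (g _) ^+ 2 * expR (- _)).
  by apply: CC_eqP; rewrite ?(reCM, imCM) /=; ring.
rewrite -[LHS]mul1r -cs /=; ring.
Qed.

(** A power of [w] may be -1, so the rotation by [w] is iterated rather than applying the rotation
    by [w ^+ j] at once. *)
Lemma integral_dens_rotationX (w : C) (g : C -> C) j : absC w = 1 -> 1 + reC w != 0 ->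
  (forall u, measC (fun p => g (u * toC p.1 p.2))) ->
  (\int[area]_p (dens (fun p => g (w ^+ j * toC p.1 p.2)) p)%:E =
   \int[area]_p (dens (fun p => g (toC p.1 p.2)) p)%:E)%E.
Proof.
move=> w1 wr mg; elim: j => [|j <-].
  by under eq_integral do rewrite /dens expr0 mul1r.
rewrite -[RHS](@integral_dens_rotation w (fun z => g (w ^+ j * z)))//.
by apply: eq_integral => p _; rewrite /dens mulrA -exprSr.
Qed.

(* mean of [|g|^2] over the orbit of a point under the [N]-th roots of unity *)
Definition orbit_mean (g : C -> C) N (w z : C) : R :=
  N%:R^-1 * \sum_(0 <= j < N) absC (g (w ^+ j * z)) ^+ 2.

Lemma measurable_orbit_mean (g : C -> C) N w :
  (forall u, measC (fun p => g (u * toC p.1 p.2))) ->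
  measurable_fun setT (fun p : RR => orbit_mean g N w (toC p.1 p.2)).
Proof.
move=> mg; apply: measurable_funM => //; apply: measurable_sum => j.
have -> : (fun p : RR => absC (g (w ^+ j * toC p.1 p.2)) ^+ 2) =
   (fun p => reC (g (w ^+ j * toC p.1 p.2)) ^+ 2 + imC (g (w ^+ j * toC p.1 p.2)) ^+ 2).
  by apply/funext => p; rewrite absC_sqr.
by have [g1 g2] := mg (w ^+ j); apply: measurable_funD; apply: measurable_funX.
Qed.

Lemma integral_orbit_mean (g : C -> C) N w : (2 < N)%N -> N.-primitive_root w ->
  (forall u, measC (fun p => g (u * toC p.1 p.2))) ->
  (\int[area]_p (orbit_mean g N w (toC p.1 p.2) * gauss_weight p)%:E =
   \int[area]_p (dens (fun p => g (toC p.1 p.2)) p)%:E)%E.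
Proof.
move=> N2 hw mg; set I := RHS.
have N0 : (0 < (N%:R : R)) by rewrite ltr0n (ltn_trans _ N2).
have E p : (orbit_mean g N w (toC p.1 p.2) * gauss_weight p)%:E =
   ((N%:R^-1)%:E * \sum_(0 <= j < N) (dens (fun p => g (w ^+ j * toC p.1 p.2)) p)%:E)%E.
  by rewrite sumEFin -EFinM /orbit_mean /dens -mulrA mulr_suml.
under eq_integral do rewrite E.
rewrite ge0_integralZl_EFin//; last 2 first.
- by move=> p _; apply: sume_ge0 => j _; rewrite lee_fin dens_ge0.
- by apply: emeasurable_sum => j; apply/measurable_EFinP; apply: measurable_dens; exact: mg.
rewrite (@ge0_integral_sum _ _ _ _ _ measurableT _
  (fun j q => (dens (fun p => g (w ^+ j * toC p.1 p.2)) q)%:E)); last 2 first.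
- by move=> j; apply/measurable_EFinP; apply: measurable_dens; exact: mg.
- by move=> j p _; rewrite lee_fin dens_ge0.
under eq_bigr do rewrite integral_dens_rotationX ?(absC_prim_root hw) ?(prim_root_neqN1 N2 hw)//.
rewrite -/I [X in (_ * X)%E](_ : _ = (N%:R)%:E * I)%E; last first.
  elim: (N) => [|n IH]; first by rewrite big_geq// mul0e.
  by rewrite big_nat_recr//= IH -natr1 EFinD ge0_muleDl ?mul1e// lee_fin.
by rewrite muleA -EFinM mulVf ?mul1e// gt_eqF.
Qed.

Section PowerSeries.
Variables (c : nat -> C) (h : C -> C).
Hypothesis ca : abs_entire c.
Hypothesis ch : forall z, series (fun k => c k * z ^+ k) @ \oo --> h z.

Let p n z : C := \sum_(0 <= k < n) c k * z ^+ k.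

Let measC_p n u : measC (fun q => p n (u * toC q.1 q.2)).
Proof.
apply: measC_sum => k; apply: measCM; first exact: measC_cst.
by apply: measCX; apply: measCM; [exact: measC_cst|exact: measC_id].
Qed.

Lemma measC_power_series u : measC (fun q => h (u * toC q.1 q.2)).
Proof.
by apply: (@measC_lim (fun n q => p n (u * toC q.1 q.2))) => [n|q]; [exact: measC_p|exact: ch].
Qed.

Let radial n z : R := \sum_(0 <= k < n) absC (c k) ^+ 2 * absC z ^+ (2 * k).

(** The polynomial has degree below the order [N], so its exponents are distinct modulo [N] and
    Parseval leaves no cross term. *)
Let orbit_mean_p N w z : N.-primitive_root w -> orbit_mean (p N) N w z = radial N z.
Proof.
move=> hw; have N0 : N%:R != 0 :> R by rewrite pnatr_eq0 -lt0n (prim_order_gt0 hw).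
rewrite /orbit_mean (eq_bigr (fun j =>
    absC (\sum_(0 <= k < N) (c k * z ^+ k) * w ^+ (j * k)) ^+ 2)); last first.
  move=> j _; congr (absC _ ^+ 2); apply: eq_bigr => k _.
  by rewrite exprMn -exprM mulrCA mulrC.
rewrite (parseval_prim_root (fun k => c k * z ^+ k) hw) mulKf//.
by apply: eq_bigr => k _; rewrite absCM absCX exprMn -exprM mulnC.
Qed.

(* the order is [n.+3] because [-1] is excluded in [ge0_integral_rotation] *)
Let orbit_mean_cvg (w : nat -> C) z : (forall n, n.+3.-primitive_root (w n)) ->
  exists s : R, radial ^~ z @ \oo --> s /\ (fun n => orbit_mean h n.+3 (w n) z) @ \oo --> s.
Proof.
move=> hw; have [S0 hS0] := ca (absC_ge0 z).
have [|T [hT _ TS]] := nneg_series_cvg _ hS0.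
  by move=> k; rewrite mulr_ge0 ?exprn_ge0 ?absC_ge0.
have T0 : 0 <= T by have := TS 0%N; rewrite big_geq.
have term k : absC (c k) * absC z ^+ k <= T.
  apply: le_trans (TS k.+1); rewrite big_nat_recr//= ler_wpDl//.
  by apply: sumr_ge0 => i _; rewrite mulr_ge0 ?exprn_ge0 ?absC_ge0.
have [||s [hs _ _]] := @nneg_series_cvg R (fun k => absC (c k) ^+ 2 * absC z ^+ (2 * k)) (T * T).
- by move=> k; rewrite mulr_ge0 ?exprn_ge0 ?absC_ge0.
- move=> N; apply: (@le_trans _ _ (\sum_(0 <= k < N) T * (absC (c k) * absC z ^+ k))).
    apply: ler_sum => k _; rewrite mulnC exprM -exprMn expr2 ler_wpM2r//.
    by rewrite mulr_ge0 ?exprn_ge0 ?absC_ge0.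
  by rewrite -mulr_sumr ler_wpM2l.
exists s; split => //.
(* A difference of squares factors: the difference of the moduli of [h] and of its truncation is at
   most the tail of the absolute series, and their sum is at most [2 * T]. *)
have bnd n : `|orbit_mean h n.+3 (w n) z - radial n.+3 z| <=
    (T - \sum_(0 <= k < n.+3) absC (c k) * absC z ^+ k) * (2 * T).
  rewrite -(orbit_mean_p z (hw n)) /orbit_mean -mulrBr -sumrB.
  rewrite normrM gtr0_norm ?invr_gt0 ?ltr0n// ler_pdivrMl ?ltr0n//.
  apply: (@le_trans _ _ (\sum_(0 <= j < n.+3)
     (T - \sum_(0 <= k < n.+3) absC (c k) * absC z ^+ k) * (2 * T))); last first.
    by rewrite sumr_const_nat subn0 [leRHS]mulr_natl.
  apply: le_trans (ler_norm_sum _ _ _) _; apply: ler_sum => j _.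
  set u := w n ^+ j * z; have uz : absC u = absC z.
    by rewrite absCM absCX (absC_prim_root (hw n)) expr1n mul1r.
  have uE k : absC (c k * u ^+ k) = absC (c k) * absC z ^+ k by rewrite absCM absCX uz.
  have bT N : \sum_(0 <= k < N) absC (c k * u ^+ k) <= T.
    by rewrite (eq_bigr _ (fun k _ => uE k)).
  have hT1 : absC (h u) <= T by exact: (@absC_series_le R (fun k => c k * u ^+ k) _ _ bT (@ch u)).
  have pT : absC (p n.+3 u) <= T by apply: le_trans (absC_sum _ _ _) (bT _).
  have tail := @absC_series_tail R (fun k => c k * u ^+ k) _ _ bT (@ch u) n.+3.
  rewrite (eq_bigr _ (fun k _ => uE k)) -/(p n.+3 u) in tail.
  rewrite subr_sqr normrM ler_pM// ?normr_ge0//.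
    rewrite (le_trans _ tail)// ler_norml ler_absC_sub andbT lerNl opprB.
    by rewrite absC_dist ler_absC_sub.
  by rewrite ger0_norm ?addr_ge0 ?absC_ge0// mulr_natl mulr2n lerD.
have D0 : (fun n => orbit_mean h n.+3 (w n) z - radial n.+3 z) @ \oo --> (0 : R).
  apply/cvgr0Pnorm_le => e e0.
  have hT3 : (fun n => (T - \sum_(0 <= k < n.+3) absC (c k) * absC z ^+ k) * (2 * T)) @ \oo -->
      (T - T) * (2 * T).
    apply: (@cvgM _ _ \oo _ _ _ _ _ _ (cvg_cst _)).
    apply: (cvgB (cvg_cst _)).
    rewrite (_ : (fun n => _) =
      (fun n => series (fun k => absC (c k) * absC z ^+ k) (n + 3)%N)).
      by rewrite cvg_shiftn.
    by apply/funext => n; rewrite addn3.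
  move: hT3; rewrite subrr mul0r => /cvgr0Pnorm_le /(_ e e0); apply: filterS => n H.
  by rewrite (le_trans (bnd n))// (le_trans (ler_norm _)).
have r3 : (fun n => radial n.+3 z) @ \oo --> s.
  rewrite (_ : (fun n => _) =
    (fun n => series (fun k => absC (c k) ^+ 2 * absC z ^+ (2 * k)) (n + 3)%N)).
    by rewrite cvg_shiftn.
  by apply/funext => n; rewrite addn3.
have -> : (fun n => orbit_mean h n.+3 (w n) z) =
    (fun n => orbit_mean h n.+3 (w n) z - radial n.+3 z + radial n.+3 z).
  by apply/funext => n; rewrite subrK.
by rewrite -[s]add0r; exact: (cvgD D0 r3).
Qed.

(* By Parseval, averaging [|h|^2] over orbits of roots of unity keeps its integral
   and converges to [sum_k |c_k|^2 |z|^(2k)], whose integral is known. *)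
Lemma integral_dens_power_series :
  (\int[area]_q (dens (fun q => h (toC q.1 q.2)) q)%:E =
   pi%:E * \sum_(0 <= k <oo) (k`!%:R * absC (c k) ^+ 2)%:E)%E.
Proof.
have [w hw] := choice (fun n => @CC_prim_root_exists R n.+3 (ltn0Sn _)).
have [s hs] := choice (fun z => @orbit_mean_cvg w z hw).
pose t k (q : RR) : R := absC (c k) ^+ 2 * (absC (toC q.1 q.2) ^+ (2 * k) * gauss_weight q).
have t0 k q : 0 <= t k q.
  by rewrite !mulr_ge0 ?exprn_ge0 ?absC_ge0// gauss_weight_ge0.
have mabs k : measurable_fun setT (fun q : RR => absC (toC q.1 q.2) ^+ (2 * k)).
  have -> : (fun q : RR => absC (toC q.1 q.2) ^+ (2 * k)) = (fun q => (q.1 ^+ 2 + q.2 ^+ 2) ^+ k).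
    by apply/funext => q; rewrite exprM absC_sqr.
  by apply: measurable_funX; apply: measurable_funD; apply: measurable_funX.
have mt k : measurable_fun setT (t k).
  apply: measurable_funM => //; apply: measurable_funM; last exact: measurable_gauss_weight.
  exact: mabs.
have s0 z : 0 <= s z.
  have := @ler_lim_cst R (fun n => - radial n z) (- s z) 0 _ _; rewrite oppr_le0; apply.
    exact: cvgN (hs z).1.
  move=> n; rewrite oppr_le0; apply: sumr_ge0 => k _.
  by rewrite mulr_ge0 ?exprn_ge0 ?absC_ge0.
have sE (q : RR) : ((s (toC q.1 q.2) * gauss_weight q)%:E = \sum_(0 <= k <oo) (t k q)%:E)%E.
  apply/esym/nneseries_EFin.
  rewrite (_ : series _ = (fun n => radial n (toC q.1 q.2) * gauss_weight q)); last first.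
    apply/funext => n; rewrite /series /radial /= mulr_suml.
    by apply: eq_bigr => k _; rewrite /t mulrA.
  exact: (cvgM (hs (toC q.1 q.2)).1 (cvg_cst _)).
have -> : (pi%:E * \sum_(0 <= k <oo) (k`!%:R * absC (c k) ^+ 2)%:E =
    \int[area]_q (s (toC q.1 q.2) * gauss_weight q)%:E)%E.
  under [RHS]eq_integral do rewrite sE.
  rewrite integral_nneseries//; last 2 first.
  - by move=> k; exact/measurable_EFinP.
  - by move=> k q _; rewrite lee_fin.
  rewrite -nneseriesZl; last by move=> k _; rewrite lee_fin mulr_ge0 ?sqr_ge0.
  apply: eq_eseriesr => k _; rewrite /t.
  under [RHS]eq_integral do rewrite EFinM.
  rewrite ge0_integralZl_EFin ?sqr_ge0//; last 2 first.
  - by move=> q _; rewrite lee_fin mulr_ge0 ?exprn_ge0 ?absC_ge0// gauss_weight_ge0.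
  - apply/measurable_EFinP; apply: measurable_funM; last exact: measurable_gauss_weight.
    exact: mabs.
  by rewrite gauss_moment -!EFinM; congr EFin; ring.
have p3 z : (fun n => p n.+3 z) @ \oo --> h z.
  have -> : (fun n => p n.+3 z) = (fun n => series (fun k => c k * z ^+ k) (n + 3)%N).
    by apply/funext => n; rewrite addn3.
  by rewrite cvg_shiftn; exact: ch.
have sle n z : radial n z <= s z.
  have nd : nondecreasing_seq (radial ^~ z).
    apply/nondecreasing_seqP => m; rewrite /radial big_nat_recr//= lerDl.
    by rewrite mulr_ge0 ?exprn_ge0 ?absC_ge0.
  rewrite -(cvg_lim _ (hs z).1)//; apply: nondecreasing_cvgn_le => //.
  by apply/cvg_ex; exists (s z); exact: (hs z).1.
have mh n : measurable_fun setT (fun q : RR => orbit_mean h n.+3 (w n) (toC q.1 q.2)).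
  exact: (measurable_orbit_mean _ _ measC_power_series).
have ms : measurable_fun setT (fun q : RR => s (toC q.1 q.2) * gauss_weight q).
  apply: measurable_funM; last exact: measurable_gauss_weight.
  apply: (measurable_fun_cvg mh) => q _; exact: (hs (toC q.1 q.2)).2.
apply/eqP; rewrite eq_le; apply/andP; split.
  (* Upper bound: the truncations converge to [h], and their integrals, equal to those of [radial],
     stay below the integral of [s]. *)
  apply: (@fatou_cvg_le R _ _ _ (fun n q => (dens (fun q => p n.+3 (toC q.1 q.2)) q)%:E)).
  - move=> n; apply/measurable_EFinP; apply: measurable_dens.
    have -> : (fun q : RR => p n.+3 (toC q.1 q.2)) = (fun q => p n.+3 (1 * toC q.1 q.2)).
      by apply/funext => q; rewrite mul1r.
    exact: measC_p.
  - by move=> n q; rewrite lee_fin dens_ge0.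
  - move=> q; apply/cvg_EFin; first exact: nearW.
    have H : (fun n => absC (p n.+3 (toC q.1 q.2))) @ \oo --> absC (h (toC q.1 q.2)).
      by apply: cvg_absC; exact: p3.
    exact: (cvgM (cvgM H H) (@cvg_cst _ (gauss_weight q : R) _ \oo _)).
  - move=> n; rewrite -(@integral_orbit_mean (p n.+3) n.+3 (w n) isT (hw n) (@measC_p n.+3)).
    apply: ge0_le_integral => //.
    + move=> q _; rewrite lee_fin mulr_ge0 ?gauss_weight_ge0// (orbit_mean_p _ (hw n)).
      by apply: sumr_ge0 => k _; rewrite mulr_ge0 ?exprn_ge0 ?absC_ge0.
    + apply/measurable_EFinP; apply: measurable_funM; last exact: measurable_gauss_weight.
      exact: (measurable_orbit_mean _ _ (@measC_p n.+3)).
    + exact/measurable_EFinP.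
    + move=> q _; rewrite lee_fin ler_wpM2r ?gauss_weight_ge0//.
      by rewrite (orbit_mean_p _ (hw n)).
(* Lower bound: the orbit means of [h] converge to [s], and all of them have the same weighted
   integral as the squared modulus of [h]. *)
apply: (@fatou_cvg_le R _ RR area
  (fun n (q : RR) => (orbit_mean h n.+3 (w n) (toC q.1 q.2) * gauss_weight q)%:E)
  (fun q : RR => (s (toC q.1 q.2) * gauss_weight q)%:E)).
- move=> n; apply/measurable_EFinP; apply: measurable_funM; last exact: measurable_gauss_weight.
  exact: mh.
- move=> n q; rewrite lee_fin mulr_ge0 ?gauss_weight_ge0// mulr_ge0 ?invr_ge0//.
  by apply: sumr_ge0 => k _; exact: sqr_ge0.
- move=> q; apply/cvg_EFin; first exact: nearW.
  exact: (cvgM (hs (toC q.1 q.2)).2 (@cvg_cst _ (gauss_weight q : R) _ \oo _)).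
- by move=> n; rewrite (@integral_orbit_mean h n.+3 (w n) isT (hw n) measC_power_series).
Qed.

End PowerSeries.

End FockNorm.

(** * The Fock space as a weighted sequence space *)

Section FockSequences.
Variable R : realType.
Local Notation C := (CC R).
Local Notation area := ((@lebesgue_measure R) \x (@lebesgue_measure R))%E.
Local Notation RR := (measurableTypeR R * measurableTypeR R)%type.
Implicit Types (z w : C) (c d : nat -> C).

Lemma nneseries_le_bound (u : nat -> \bar R) (B : \bar R) : (forall k, (0 <= u k)%E) ->
  (forall N, (\sum_(0 <= k < N) u k <= B)%E) -> (\sum_(0 <= k <oo) u k <= B)%E.
Proof.
move=> u0 uB; apply: lime_le; first by apply: is_cvg_nneseries => k _ _.
exact: nearW.
Qed.

Definition fock_seq c := exists B, forall N, \sum_(0 <= k < N) k`!%:R * absC (c k) ^+ 2 <= B.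

Lemma exp_sum_le (x : R) N : 0 <= x -> \sum_(0 <= k < N) x ^+ k / k`!%:R <= expR x.
Proof.
move=> x0; have nd : nondecreasing_seq (series (exp_coeff x)).
  apply/nondecreasing_seqP => n; rewrite /series /= big_nat_recr//= lerDl.
  by rewrite divr_ge0 ?exprn_ge0.
have h := @exp_series_cvg R x.
rewrite -(cvg_lim _ h)//; apply: (nondecreasing_cvgn_le nd).
by apply/cvg_ex; exists (expR x).
Qed.

Lemma weighted_amgm (f x y : R) : 0 < f -> 0 <= x -> 0 <= y ->
  x * y <= f * x ^+ 2 + y ^+ 2 / f.
Proof.
move=> f0 x0 y0; rewrite -(ler_pM2l f0) mulrDr [X in _ + X]mulrC divfK ?gt_eqF//.
have := sqr_ge0 (f * x - y); have : 0 <= f * x * y by rewrite !mulr_ge0// ltW.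
nra.
Qed.

(** [weighted_amgm] with weight [k!] splits each term into a term of the Fock sum and [r^(2k) / k!],
    and the latter sum to at most [expR (r ^+ 2)]. *)
Lemma fock_seq_abs_entire c : fock_seq c -> abs_entire c.
Proof.
move=> [B hB] r r0; exists (B + expR (r ^+ 2)) => N.
apply: le_trans (lerD (hB N) (exp_sum_le N (sqr_ge0 r))).
rewrite -big_split /=; apply: ler_sum => k _; rewrite exprAC.
  by apply: weighted_amgm; rewrite ?ltr0n ?fact_gt0 ?absC_ge0 ?exprn_ge0.
Qed.

Lemma fock_seqZ (e : C) c : fock_seq c -> fock_seq (fun k => e * c k).
Proof.
move=> [B hB]; exists (absC e ^+ 2 * B) => N.
rewrite (le_trans _ (ler_wpM2l (sqr_ge0 _) (hB N)))// mulr_sumr.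
by apply: ler_sum => k _; rewrite absCM exprMn mulrCA.
Qed.

Lemma absC_sqrD z w : absC (z + w) ^+ 2 <= 2 * (absC z ^+ 2 + absC w ^+ 2).
Proof.
apply: (@le_trans _ _ ((absC z + absC w) ^+ 2)).
  by rewrite lerXn2r ?nnegrE ?addr_ge0 ?absC_ge0// ler_absCD.
have := sqr_ge0 (absC z - absC w); nra.
Qed.

Lemma fock_seqD c d : fock_seq c -> fock_seq d -> fock_seq (fun k => c k + d k).
Proof.
move=> [B hB] [D hD]; exists (2 * (B + D)) => N.
rewrite (le_trans _ (ler_wpM2l _ (lerD (hB N) (hD N))))// -big_split mulr_sumr.
by apply: ler_sum => k _; rewrite /= -mulrDr [leRHS]mulrCA ler_wpM2l// absC_sqrD.
Qed.

Definition pseries_of c (h : C -> C) := forall z, series (fun k => c k * z ^+ k) @ \oo --> h z.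

Lemma pseries_ofD c d h k : pseries_of c h -> pseries_of d k ->
  pseries_of (fun n => c n + d n) (fun z => h z + k z).
Proof.
move=> hc kd z.
have -> : series (fun n => (c n + d n) * z ^+ n) =
    (fun N => series (fun n => c n * z ^+ n) N + series (fun n => d n * z ^+ n) N).
  by apply/funext => N; rewrite /series /= -big_split; apply: eq_bigr => n _; rewrite mulrDl.
exact: (cvgD (hc z) (kd z)).
Qed.

Lemma pseries_ofZ (e : C) c h : pseries_of c h ->
  pseries_of (fun n => e * c n) (fun z => e * h z).
Proof.
move=> hc z.
have -> : series (fun n => e * c n * z ^+ n) = (fun N => e * series (fun n => c n * z ^+ n) N).
  by apply/funext => N; rewrite /series /= mulr_sumr; apply: eq_bigr => n _; rewrite mulrA.
exact: (cvgM (@cvg_cst _ e _ \oo _) (hc z)).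
Qed.

Lemma fock_norm2_pseries c h : abs_entire c -> pseries_of c h ->
  fock_norm2 h = (\sum_(0 <= k <oo) (k`!%:R * absC (c k) ^+ 2)%:E)%E.
Proof.
move=> ca hc; rewrite /fock_norm2 (integral_dens_power_series ca hc) muleA -EFinM.
by rewrite mulVf ?mul1e// gt_eqF// pi_gt0.
Qed.

Lemma fock_pseries c h : fock_seq c -> pseries_of c h -> fock h.
Proof.
move=> fc hc; have ca := fock_seq_abs_entire fc.
split; first exact: power_series_entire ca hc.
have [B hB] := fc; rewrite (fock_norm2_pseries ca hc).
apply: (@le_lt_trans _ _ B%:E); last exact: ltry.
apply: nneseries_le_bound => [k|N].
  by rewrite lee_fin mulr_ge0 ?sqr_ge0.
by rewrite sumEFin lee_fin.
Qed.

(** Integrability is recorded because polarization subtracts two such integrals. *)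
Lemma Rintegral_dens c h : fock_seq c -> pseries_of c h ->
  area.-integrable setT (EFin \o dens (fun q => h (toC q.1 q.2))) /\
  series (fun k => k`!%:R * absC (c k) ^+ 2) @ \oo -->
    pi^-1 * \int[area]_q dens (fun q => h (toC q.1 q.2)) q.
Proof.
move=> fc hc; have ca := fock_seq_abs_entire fc; have [B hB] := fc.
have [|S [hS _ _]] := nneg_series_cvg _ hB; first by move=> k; rewrite mulr_ge0 ?sqr_ge0.
have IE := integral_dens_power_series ca hc; rewrite (nneseries_EFin hS) -EFinM in IE.
split; last by rewrite /Rintegral IE /= mulKf ?gt_eqF ?pi_gt0.
apply/integrableP; split.
  apply/measurable_EFinP; apply: measurable_dens.
  have := measC_power_series hc 1.
  have -> : (fun q : RR => h (1 * toC q.1 q.2)) = (fun q => h (toC q.1 q.2)) => [|//].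
  by apply/funext => q; rewrite mul1r.
rewrite (eq_integral (fun q => (dens (fun q => h (toC q.1 q.2)) q)%:E)).
  by rewrite IE ltry.
by move=> q _; rewrite /= ger0_norm// dens_ge0.
Qed.

(* polarization: [4 Re(h conj k) = |h + k|^2 - |h - k|^2] *)
Lemma fock_ip_re c d h k : fock_seq c -> fock_seq d -> pseries_of c h -> pseries_of d k ->
  series (fun n => reC (n`!%:R * (c n * (d n)^*))) @ \oo -->
    pi^-1 * \int[area]_q (reC (h (toC q.1 q.2) * (k (toC q.1 q.2))^*) * gauss_weight q).
Proof.
move=> fc fd hc kd.
have polar z w : reC (z * w^*) = 4^-1 * (absC (z + w) ^+ 2 - absC (z + (-1) * w) ^+ 2).
  rewrite !absC_sqr !(reCD, imCD, reCM, imCM, reC_conj, imC_conj) /= ?oppr0.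
  by field.
have [i1 s1] := Rintegral_dens (fock_seqD fc fd) (pseries_ofD hc kd).
have [i2 s2] := Rintegral_dens (fock_seqD fc (fock_seqZ (-1) fd))
  (pseries_ofD hc (@pseries_ofZ (-1) d k kd)).
move: i1 s1 i2 s2; set D1 := dens _; set D2 := dens _ => i1 s1 i2 s2.
have -> : \int[area]_q (reC (h (toC q.1 q.2) * (k (toC q.1 q.2))^*) * gauss_weight q) =
    4^-1 * (\int[area]_q D1 q - \int[area]_q D2 q).
  rewrite -RintegralB// -RintegralZl//.
    by apply: eq_Rintegral => q _; rewrite polar -mulrA mulrBl.
  exact: (integrableB measurableT i1 i2).
have -> : series (fun n => reC (n`!%:R * (c n * (d n)^*))) =
   (fun N => 4^-1 * (series (fun n => n`!%:R * absC (c n + d n) ^+ 2) N -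
     series (fun n => n`!%:R * absC (c n + -1 * d n) ^+ 2) N)).
  apply/funext => N; rewrite /series /= -sumrB mulr_sumr; apply: eq_bigr => n _.
  by rewrite natCE reCM /= mul0r subr0 polar; ring.
rewrite mulrCA mulrBr; apply: (cvgM (@cvg_cst _ (4^-1 : R) _ \oo _)).
exact: (cvgB s1 s2).
Qed.

(** The imaginary part is the real part for [i * k] in place of [k], so the polarized identity
    covers both. *)
Lemma fock_ip_pseries c d h k : fock_seq c -> fock_seq d -> pseries_of c h -> pseries_of d k ->
  series (fun n => n`!%:R * (c n * (d n)^*)) @ \oo --> fock_ip h k.
Proof.
move=> fc fd hc kd; pose i : C := toC 0 1.
have imE z w : reC (z * (i * w)^*) = imC (z * w^*).
  by rewrite !(reCM, imCM, reC_conj, imC_conj) /=; ring.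
apply: cvgC_reim.
  have -> : @reC R \o series (fun n => n`!%:R * (c n * (d n)^*)) =
     series (fun n => reC (n`!%:R * (c n * (d n)^*))).
    by apply/funext => N; rewrite /series /= reC_sum.
  exact: fock_ip_re.
have -> : @imC R \o series (fun n => n`!%:R * (c n * (d n)^*)) =
    series (fun n => reC (n`!%:R * (c n * (i * d n)^*))).
  apply/funext => N; rewrite /series /= imC_sum; apply: eq_bigr => n _.
  by rewrite natCE reCM imCM /= !mul0r subr0 addr0 imE.
have := fock_ip_re fc (fock_seqZ i fd) hc (@pseries_ofZ i d k kd).
rewrite /fock_ip /=; congr (_ --> _); congr (_ * _).
by apply: eq_Rintegral => q _; rewrite imE.
Qed.

End FockSequences.

(** * Double series in z and conj z *)

Section DoubleEntire.
Variable R : realType.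
Local Notation C := (CC R).
Implicit Types (z w : C) (a b : nat -> nat -> C).

(** Absolute convergence at all radii, phrased with squares so that it is visibly stable under
    [transpose]. *)
Definition abs_entire2 a := forall r : R, 0 <= r -> exists S, forall N,
  \sum_(0 <= n < N) \sum_(0 <= m < N) absC (a n m) * r ^+ (n + m) <= S.

Definition sf_row a n z : C := csum (fun m => a n m * z ^+ m).
Definition sf_sum a z : C := csum (fun n => z^* ^+ n * sf_row a n z).
Definition transpose a : nat -> nat -> C := fun m n => a n m.

Lemma abs_entire2_transpose a : abs_entire2 a -> abs_entire2 (transpose a).
Proof.
move=> ha r r0; have [S hS] := ha r r0; exists S => N.
by rewrite exchange_big_nat /=; under eq_bigr do under eq_bigr do rewrite addnC.
Qed.

Section Sum.
Variables (a : nat -> nat -> C) (ha : abs_entire2 a).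

Let x z n m : C := z^* ^+ n * (a n m * z ^+ m).

Let xE z n m : absC (x z n m) = absC (a n m) * absC z ^+ (n + m).
Proof. by rewrite !absCM !absCX absC_conj exprD mulrCA. Qed.

Let x_bound z : exists S, forall N,
  \sum_(0 <= n < N) \sum_(0 <= m < N) absC (x z n m) <= S.
Proof.
have [S hS] := ha (absC_ge0 z); exists S => N.
by under eq_bigr do under eq_bigr do rewrite xE.
Qed.

Lemma sf_row_cvg n : pseries_of (a n) (sf_row a n).
Proof.
move=> z; suff [l hl] : exists l : C, series (fun m => a n m * z ^+ m) @ \oo --> l.
  by rewrite /sf_row (csum_eq hl).
(* A radius at least 1 gives [r ^+ n >= 1], so that the weight [r ^+ (n + m)] dominates
   [absC z ^+ m] in every row. *)
pose r := absC z + 1; have r1 : 1 <= r by rewrite lerDr absC_ge0.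
have r0 : 0 <= r by exact: le_trans r1.
have [S hS] := ha r0; apply: (@absC_series_cvg _ _ S) => N.
have u0 n' m : 0 <= absC (a n' m) * r ^+ (n' + m) by rewrite mulr_ge0 ?absC_ge0 ?exprn_ge0.
apply: le_trans (row_sum_le u0 hS n N); apply: ler_sum => m _.
rewrite absCM absCX ler_wpM2l ?absC_ge0// exprD.
apply: (@le_trans _ _ (r ^+ m)); first by rewrite lerXn2r ?nnegrE ?absC_ge0// lerDl.
by rewrite ler_peMl ?exprn_ge0// exprn_ege1.
Qed.

Lemma sf_sum_cvg z : series (fun n => z^* ^+ n * sf_row a n z) @ \oo --> sf_sum a z /\
  (fun N => \sum_(0 <= n < N) \sum_(0 <= m < N) z^* ^+ n * (a n m * z ^+ m)) @ \oo -->
  sf_sum a z.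
Proof.
have [S hS] := x_bound z; have [y [l [hy hl hsq]]] := double_series_cvg hS.
have yE n : y n = z^* ^+ n * sf_row a n z.
  apply: cvgC_unique (hy n) _.
  have -> : series (x z n) = (fun N => z^* ^+ n * series (fun m => a n m * z ^+ m) N).
    by apply/funext => N; rewrite /series /= mulr_sumr.
  exact: (cvgM (@cvg_cst _ (z^* ^+ n : C) _ \oo _) (@sf_row_cvg n z)).
have E : (fun n => z^* ^+ n * sf_row a n z) = y by apply/funext => n; rewrite yE.
by rewrite /sf_sum E (csum_eq hl).
Qed.

End Sum.

(* regrouping [sf_sum a] by powers of [z] *)
Lemma sf_sum_transpose a z : abs_entire2 a -> sf_sum a z = sf_sum (transpose a) z^*.
Proof.
move=> ha; have [_ h1] := sf_sum_cvg ha z.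
have [_ h2] := sf_sum_cvg (abs_entire2_transpose ha) z^*.
apply: cvgC_unique h1 _; rewrite conjCK in h2.
set f := (fun N => _) in h2 *; set g := (fun N => _).
suff -> : g = f by [].
apply/funext => N; rewrite /f /g exchange_big_nat /=.
by apply: eq_bigr => m _; apply: eq_bigr => n _; rewrite /transpose; ring.
Qed.

Lemma sf_sum_col_cvg a z : abs_entire2 a ->
  series (fun m => z ^+ m * sf_row (transpose a) m z^*) @ \oo --> sf_sum a z.
Proof.
move=> ha; rewrite (sf_sum_transpose z ha).
by have [] := sf_sum_cvg (abs_entire2_transpose ha) z^*; rewrite conjCK.
Qed.

Lemma abs_entire2B a b : abs_entire2 a -> abs_entire2 b ->
  abs_entire2 (fun n m => a n m - b n m).
Proof.
move=> ha hb r r0; have [S hS] := ha r r0; have [T hT] := hb r r0.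
exists (S + T) => N; apply: le_trans (lerD (hS N) (hT N)).
rewrite -big_split; apply: ler_sum => n _; rewrite -big_split; apply: ler_sum => m _ /=.
by rewrite -mulrDl ler_wpM2r ?exprn_ge0// ler_absCB.
Qed.

Lemma sf_sumB a b z : abs_entire2 a -> abs_entire2 b ->
  sf_sum (fun n m => a n m - b n m) z = sf_sum a z - sf_sum b z.
Proof.
move=> ha hb; have [_ h1] := sf_sum_cvg ha z; have [_ h2] := sf_sum_cvg hb z.
have [_ h] := sf_sum_cvg (abs_entire2B ha hb) z.
apply: cvgC_unique h _.
set f := (fun N => _); suff -> : f = (fun N =>
  \sum_(0 <= n < N) \sum_(0 <= m < N) z^* ^+ n * (a n m * z ^+ m) -
  \sum_(0 <= n < N) \sum_(0 <= m < N) z^* ^+ n * (b n m * z ^+ m)) by exact: (cvgB h1 h2).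
apply/funext => N; rewrite /f -sumrB; apply: eq_bigr => n _; rewrite -sumrB.
by apply: eq_bigr => m _; rewrite mulrBl mulrBr.
Qed.

(** The part of total degree [d], homogeneous under real dilations. *)
Definition homog a d z : C :=
  \sum_(0 <= n < d.+1) z^* ^+ n * (a n (d - n)%N * z ^+ (d - n)).

(** Every remaining term has total degree at least [d + 1], so on the unit disc it is at most its
    absolute value at radius 1 times [absC z ^+ d.+1]. *)
Lemma sf_sum_leading a d : abs_entire2 a -> (forall n m, (n + m < d)%N -> a n m = 0) ->
  exists S, forall z, absC z <= 1 -> absC (sf_sum a z - homog a d z) <= S * absC z ^+ d.+1.
Proof.
move=> ha a0; have [S hS] := ha 1 ler01; exists S => z z1.
have [_ h] := sf_sum_cvg ha z.
have h' : (fun N => \sum_(0 <= n < N + d.+1) \sum_(0 <= m < N + d.+1) z^* ^+ n * (a n m * z ^+ m)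
    - homog a d z) @ \oo --> sf_sum a z - homog a d z.
  apply: (cvgB _ (@cvg_cst _ (homog a d z) _ \oo _)).
  by rewrite (@cvg_shiftn d.+1 _ (fun N => \sum_(0 <= n < N) \sum_(0 <= m < N)
    z^* ^+ n * (a n m * z ^+ m))).
apply: ler_absC_lim h' _ => N.
(* A square of side at least [d + 1] contains the whole antidiagonal [n + m = d]. *)
have -> : homog a d z = \sum_(0 <= n < N + d.+1) \sum_(0 <= m < N + d.+1)
    (if (n + m == d)%N then z^* ^+ n * (a n m * z ^+ m) else 0).
  rewrite (@big_cat_nat _ _ _ d.+1) ?leq_addl//= [X in _ + X]big_nat_cond.
  rewrite [X in _ + X]big1 ?addr0 => [|n /andP[/andP[dn _] _]]; last first.
    by apply: big1 => m _; rewrite gtn_eqF// (leq_trans dn)// leq_addr.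
  apply: eq_big_nat => n /andP[_ nd].
  rewrite -big_mkcond /= (eq_bigl (fun m => m == d - n)%N); last first.
    by move=> m; rewrite -[in LHS](subnKC (_ : n <= d)%N) ?eqn_add2l.
  by rewrite big_nat1_eq /= (leq_ltn_trans (leq_subr _ _))// addnS ltnS leq_addl.
rewrite -sumrB (le_trans (absC_sum _ _ _))//.
apply: (@le_trans _ _ (\sum_(0 <= n < N + d.+1) \sum_(0 <= m < N + d.+1)
   absC (a n m) * 1 ^+ (n + m) * absC z ^+ d.+1)).
  apply: ler_sum => n _; rewrite -sumrB (le_trans (absC_sum _ _ _))//.
  apply: ler_sum => m _; case: (ltngtP (n + m) d) => nm.
  - by rewrite a0// mul0r mulr0 subr0 absC0 !mul0r.
  - rewrite subr0 expr1n mulr1 !absCM !absCX absC_conj mulrCA -exprD.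
    by rewrite ler_wpM2l ?absC_ge0// ler_wiXn2l ?absC_ge0.
  - by rewrite subrr absC0 expr1n mulr1 mulr_ge0 ?exprn_ge0 ?absC_ge0.
under eq_bigr do rewrite -mulr_suml.
by rewrite -mulr_suml ler_wpM2r ?exprn_ge0 ?absC_ge0.
Qed.

(** Divided by [z ^+ d], the homogeneous part is a polynomial of degree at most [d] in conj z / z,
    so [d + 1] distinct values of this ratio suffice. *)
Lemma homog_eq0 a d : (forall z, homog a d z = 0) -> forall n, (n <= d)%N -> a n (d - n)%N = 0.
Proof.
move=> h0.
(* on the line z = 1 + i t, conj z / z takes infinitely many values *)
pose p : {poly C} := \poly_(n < d.+1) a n (d - n)%N.
pose zt (t : nat) : C := toC 1 t%:R.
have zt0 t : zt t != 0.
  rewrite -absC_eq0; apply/eqP => /(congr1 (fun x => x ^+ 2)).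
  by rewrite absC_sqr /= expr1n expr0n => /eqP; rewrite gt_eqF// ltr_wpDr ?sqr_ge0.
have rootE t : p.[(zt t)^* / zt t] = 0.
  rewrite horner_poly; apply: (mulfI (expf_neq0 d (zt0 t))); rewrite mulr0 -[RHS](h0 (zt t)).
  rewrite /homog big_mkord mulr_sumr; apply: eq_bigr => i _.
  have id : (i <= d)%N by rewrite -ltnS.
  rewrite expr_div_n -{1}(subnK id) exprD; have := expf_neq0 i (zt0 t).
  by move: (zt t ^+ i) => u u0; field.
have p0 : p = 0.
  apply/eqP; apply: contraT => pn0.
  pose s := [seq (zt t)^* / zt t | t <- iota 0 d.+1].
  have us : uniq s.
    rewrite map_inj_uniq ?iota_uniq// => t u /eqP; rewrite eqr_div// => /eqP/(congr1 (@imC R)).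
    rewrite !imCM !reC_conj !imC_conj /= => H; apply/eqP; rewrite -(eqr_nat R); apply/eqP; lra.
  have rs : all (root p) s by apply/allP => _ /mapP[t _ ->]; apply/eqP; exact: rootE.
  have := leq_trans (max_poly_roots pn0 rs us) (size_poly _ _).
  by rewrite size_map size_iota ltnn.
move=> n nd; have := congr1 (fun q : {poly C} => q`_n) p0.
by rewrite /= coef_poly ltnS nd coef0.
Qed.

(** Induction on the total degree: at [t * z] with [t] a small positive real, the part of degree [d]
    scales as [t ^+ d] and the remainder is of order [t ^+ d.+1], so the part vanishes. *)
Lemma sf_sum_eq0 a : abs_entire2 a -> (forall z, sf_sum a z = 0) -> forall n m, a n m = 0.
Proof.
move=> ha F0.
suff main d : forall n m, (n + m < d)%N -> a n m = 0 by move=> n m; apply: (main (n + m).+1).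
elim: d => [//|d IH] n m; rewrite ltnS leq_eqVlt => /orP[/eqP nmd|]; last exact: IH.
have [S hS] := sf_sum_leading ha IH.
have S0 : 0 <= S.
  have := hS 1; rewrite absC1 expr1n mulr1 => /(_ (lexx _)); apply: le_trans.
  exact: absC_ge0.
have hz z : homog a d z = 0.
  have hom t : homog a d (toC t 0 * z) = (toC t 0) ^+ d * homog a d z.
    rewrite /homog mulr_sumr; apply: eq_big_nat => i /andP[_ id].
    have tc : (toC t 0 : C)^* = toC t 0 by rewrite conjCE /= oppr0.
    have -> : (toC t 0 : C) ^+ d = toC t 0 ^+ i * toC t 0 ^+ (d - i) by rewrite -exprD subnKC.
    by rewrite rmorphM /= tc !exprMn; ring.
  apply/eqP; rewrite -absC_eq0 eq_le absC_ge0 andbT.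
  apply/ler_addgt0Pr => e e0; rewrite add0r.
  pose A := absC z + 1; have A0 : 0 < A by rewrite ltr_wpDl ?absC_ge0.
  pose K := S * A ^+ d.+1; have K0 : 0 <= K by rewrite mulr_ge0 ?exprn_ge0 ?(ltW A0).
  (* [A^-1] keeps [t * z] in the unit disc, where the remainder estimate holds; the other entry
     makes [t * K] at most [e]. *)
  pose t := Num.min A^-1 (e / (K + 1)).
  have t0 : 0 < t by rewrite lt_min invr_gt0 A0 divr_gt0// ltr_wpDl.
  have tz : absC (toC t 0 * z) <= 1.
    rewrite absCM absC_toC gtr0_norm// (@le_trans _ _ (A^-1 * A))//.
      by rewrite ler_pM ?absC_ge0 ?(ltW t0)// ?ge_min ?lexx// lerDl.
    by rewrite mulVf// gt_eqF.
  have := hS _ tz; rewrite F0 sub0r absCN hom !absCM absCX absC_toC gtr0_norm//.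
  rewrite (_ : S * (t * absC z) ^+ d.+1 = t ^+ d * (t * (S * absC z ^+ d.+1))); last first.
    by rewrite exprMn [t ^+ d.+1]exprS; ring.
  rewrite ler_pM2l ?exprn_gt0//.
  move=> H; apply: (le_trans H); apply: (@le_trans _ _ (t * K)).
    rewrite ler_wpM2l ?(ltW t0)// /K ler_wpM2l// lerXn2r ?nnegrE ?absC_ge0 ?(ltW A0)//.
    by rewrite lerDl.
  apply: (@le_trans _ _ (e / (K + 1) * K)); first by rewrite ler_wpM2r// ge_min lexx orbT.
  by rewrite mulrAC ler_pdivrMr ?ltr_wpDl// mulrDr mulr1 lerDl ltW.
have nd : (n <= d)%N by rewrite -nmd leq_addr.
by have := homog_eq0 hz nd; rewrite -nmd addKn.
Qed.

(** This pins down the decompositions that [xget] merely selects. *)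
Lemma sf_sum_inj a b : abs_entire2 a -> abs_entire2 b -> sf_sum a = sf_sum b -> a = b.
Proof.
move=> ha hb ab; apply/funext => n; apply/funext => m; apply/eqP; rewrite -subr_eq0.
apply/eqP; apply: (@sf_sum_eq0 (fun n m => a n m - b n m)); first exact: abs_entire2B.
by move=> z; rewrite sf_sumB// ab subrr.
Qed.

End DoubleEntire.

(** * SF as a space of weighted square-summable matrices *)

Section SFMatrices.
Variable R : realType.
Local Notation C := (CC R).
Implicit Types (z w : C) (a b : nat -> nat -> C).

Lemma nneseries2_le (u : nat -> nat -> R) (S : R) : (forall n m, 0 <= u n m) ->
  (forall N, \sum_(0 <= n < N) \sum_(0 <= m < N) u n m <= S) ->
  (\sum_(0 <= n <oo) \sum_(0 <= m <oo) (u n m)%:E <= S%:E)%E.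
Proof.
move=> u0 uS.
have row0 n : (0 <= \sum_(0 <= m <oo) (u n m)%:E)%E.
  by apply: nneseries_ge0 => m _ _; rewrite lee_fin.
apply: nneseries_le_bound => // N.
have fin n : exists s : R, series (u n) @ \oo --> s.
  have [s [hs _ _]] := @nneg_series_cvg R (u n) S (u0 n) (row_sum_le u0 uS n).
  by exists s.
have [s hs] := choice fin.
rewrite (eq_bigr (fun n => (s n)%:E)); last by move=> n _; apply: nneseries_EFin.
rewrite sumEFin lee_fin.
have h := @cvg_sum_nat _ R (fun n M => series (u n) M) s N hs.
by apply: ler_lim_cst h _ => M; exact: (rect_sum_le u0 uS).
Qed.

Lemma nneseries2_fin (u : nat -> nat -> R) : (forall n m, 0 <= u n m) ->
  (\sum_(0 <= n <oo) \sum_(0 <= m <oo) (u n m)%:E < +oo)%E ->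
  exists S, forall N, \sum_(0 <= n < N) \sum_(0 <= m < N) u n m <= S.
Proof.
move=> u0; set T := (\sum_(0 <= n <oo) _)%E => Tfin.
have row0 n : (0 <= \sum_(0 <= m <oo) (u n m)%:E)%E.
  by apply: nneseries_ge0 => m _ _; rewrite lee_fin.
have T0 : (0 <= T)%E by exact: nneseries_ge0.
exists (fine T) => N; rewrite -lee_fin fineK ?ge0_fin_numE//.
apply: le_trans (nneseries_lim_ge N (fun n _ _ => row0 n)).
rewrite -sumEFin; apply: lee_sum => n _; rewrite -sumEFin.
by apply: nneseries_lim_ge => m _ _; rewrite lee_fin.
Qed.

Definition sf_weight a n m : R := n`!%:R * (m`!%:R * absC (a n m) ^+ 2).

Definition sf_matrix a :=
  exists B, forall N, \sum_(0 <= n < N) \sum_(0 <= m < N) sf_weight a n m <= B.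

Lemma sf_weight_ge0 a n m : 0 <= sf_weight a n m.
Proof. by rewrite !mulr_ge0 ?exprn_ge0 ?absC_ge0. Qed.

(** The splitting used for one variable, now with weight [n! m!]; the comparison double sum is at
    most the square of [expR (r ^+ 2)]. *)
Lemma sf_matrix_abs_entire2 a : sf_matrix a -> abs_entire2 a.
Proof.
move=> [B hB] r r0; exists (B + expR (r ^+ 2) * expR (r ^+ 2)) => N.
have E0 : 0 <= \sum_(0 <= n < N) (r ^+ 2) ^+ n / n`!%:R.
  by apply: sumr_ge0 => n _; rewrite divr_ge0 ?exprn_ge0.
have E := exp_sum_le N (sqr_ge0 r).
apply: le_trans (lerD (hB N) (ler_pM E0 E0 E E)).
rewrite mulr_suml -big_split; apply: ler_sum => n _.
rewrite mulr_sumr -big_split; apply: ler_sum => m _ /=.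
have [n0 m0] : 0 < (n`!%:R : R) /\ 0 < (m`!%:R : R) by rewrite !ltr0n !fact_gt0.
rewrite mulf_div -exprD exprAC /sf_weight mulrA.
by apply: weighted_amgm; rewrite ?mulr_gt0 ?exprn_ge0 ?absC_ge0.
Qed.

Lemma sf_matrix_row a n : sf_matrix a -> fock_seq (a n).
Proof.
move=> [B hB]; exists B => N.
apply: le_trans (row_sum_le (@sf_weight_ge0 a) hB n N); apply: ler_sum => m _.
rewrite ler_peMl ?mulr_ge0 ?exprn_ge0 ?absC_ge0//.
by rewrite -[1](@mulr1n R) ler_nat fact_gt0.
Qed.

Lemma fock_norm2_row a n : sf_matrix a ->
  fock_norm2 (sf_row a n) = (\sum_(0 <= m <oo) (m`!%:R * absC (a n m) ^+ 2)%:E)%E.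
Proof.
move=> sa; have ha := sf_matrix_abs_entire2 sa.
exact: (fock_norm2_pseries (fock_seq_abs_entire (sf_matrix_row n sa)) (@sf_row_cvg _ _ ha n)).
Qed.

Lemma sf_weight_sum a n :
  (\sum_(0 <= m <oo) (sf_weight a n m)%:E =
   (n`!%:R)%:E * \sum_(0 <= m <oo) (m`!%:R * absC (a n m) ^+ 2)%:E)%E.
Proof.
rewrite -nneseriesZl; last by move=> m _; rewrite lee_fin mulr_ge0 ?exprn_ge0 ?absC_ge0.
by apply: eq_eseriesr => m _; rewrite -EFinM.
Qed.

Lemma sf_decomp_sum a : sf_matrix a -> sf_decomp (sf_sum a) (sf_row a).
Proof.
move=> sa; have ha := sf_matrix_abs_entire2 sa; split.
- by move=> n; exact: (fock_pseries (sf_matrix_row n sa) (@sf_row_cvg _ _ ha n)).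
- have [B hB] := sa.
  under eq_eseriesr => n _ do rewrite (fock_norm2_row n sa) -sf_weight_sum.
  by apply: le_lt_trans (nneseries2_le (@sf_weight_ge0 a) hB) (ltry _).
- by move=> z; have [] := sf_sum_cvg ha z.
Qed.

(** Row [n] collects the coefficients of the entire function [u n]; the norm formula for power
    series turns the norm condition into the weighted double sum. *)
Lemma sf_decomp_matrix f u : sf_decomp f u ->
  exists a, [/\ sf_matrix a, u = sf_row a & f = sf_sum a].
Proof.
move=> [fu nu fE].
have [a ha] := choice (fun n => entire_power_series (fu n).1).
have uE n z : sf_row a n z = u n z by apply: csum_eq; exact: (ha n).2.
have uE' : u = sf_row a by apply/funext => n; apply/funext => z; rewrite uE.
exists a; split => //; last first.
  apply/funext => z; apply/esym; apply: csum_eq; rewrite -uE'; exact: fE.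
apply: (nneseries2_fin (@sf_weight_ge0 a)); apply: le_lt_trans nu.
rewrite le_eqVlt; apply/orP; left; apply/eqP; apply: eq_eseriesr => n _.
by rewrite sf_weight_sum (fock_norm2_pseries (ha n).1 (ha n).2).
Qed.

Lemma SFP f : SF f <-> exists a, sf_matrix a /\ f = sf_sum a.
Proof.
split=> [[u /sf_decomp_matrix[a [sa _ ->]]]|[a [sa ->]]]; first by exists a.
by exists (sf_row a); exact: sf_decomp_sum.
Qed.

(** Whatever decomposition [xget] returns comes from a matrix with the same sum, and injectivity of
    [sf_sum] identifies that matrix with [a]. *)
Lemma sf_coef_sum a : sf_matrix a -> sf_coef (sf_sum a) = sf_row a.
Proof.
move=> sa; have : sf_decomp (sf_sum a) (sf_coef (sf_sum a)).
  exact: (@xgetPex _ _ [set u | sf_decomp (sf_sum a) u] (ex_intro _ (sf_row a) (sf_decomp_sum sa))).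
move=> /sf_decomp_matrix[b [sb -> /sf_sum_inj <- //]]; exact: sf_matrix_abs_entire2.
Qed.

Lemma sf_norm2_sum a : sf_matrix a ->
  sf_norm2 (sf_sum a) = (\sum_(0 <= n <oo) \sum_(0 <= m <oo) (sf_weight a n m)%:E)%E.
Proof.
move=> sa; rewrite /sf_norm2 (sf_coef_sum sa); apply: eq_eseriesr => n _.
by rewrite (fock_norm2_row n sa) sf_weight_sum.
Qed.

Lemma fock_ip_row a b n : sf_matrix a -> sf_matrix b ->
  series (fun m => m`!%:R * (a n m * (b n m)^*)) @ \oo --> fock_ip (sf_row a n) (sf_row b n).
Proof.
move=> sa sb; apply: fock_ip_pseries; try exact: sf_matrix_row.
  exact: (@sf_row_cvg _ _ (sf_matrix_abs_entire2 sa) n).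
exact: (@sf_row_cvg _ _ (sf_matrix_abs_entire2 sb) n).
Qed.

Lemma sf_ip_sum a b : sf_matrix a -> sf_matrix b ->
  sf_ip (sf_sum a) (sf_sum b) = csum (fun n => n`!%:R * fock_ip (sf_row a n) (sf_row b n)).
Proof. by move=> sa sb; rewrite /sf_ip !sf_coef_sum. Qed.

(** The double array [b] of the chosen decomposition regroups, by absolute convergence, into
    [sf_sum (transpose b)], so [transpose b] is [a] by injectivity. *)
Lemma sfbar_coef_sum a : sf_matrix a -> sfbar_coef (sf_sum a) = sf_row (transpose a).
Proof.
move=> sa; have ha := sf_matrix_abs_entire2 sa.
have ht := abs_entire2_transpose ha.
have D : sfbar_decomp (sf_sum a) (sf_row (transpose a)).
  exists (transpose a); split.
  - move=> r r0; have [S hS] := ht r r0.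
    apply: le_lt_trans (nneseries2_le _ hS) (ltry _) => n m.
    by rewrite mulr_ge0 ?exprn_ge0 ?absC_ge0.
  - by move=> m w; exact: sf_row_cvg.
  - by move=> z; exact: sf_sum_col_cvg.
have : sfbar_decomp (sf_sum a) (sfbar_coef (sf_sum a)).
  exact: (@xgetPex _ _ [set v | sfbar_decomp (sf_sum a) v] (ex_intro _ _ D)).
move=> [b [hb vb vE]].
have hb2 : abs_entire2 b.
  move=> r r0; apply: (nneseries2_fin _ (hb r r0)) => n m.
  by rewrite mulr_ge0 ?exprn_ge0 ?absC_ge0.
have vrow : sfbar_coef (sf_sum a) = sf_row b.
  by apply/funext => m; apply/funext => w; apply/esym; apply: csum_eq; exact: vb.
suff ab : transpose b = a by rewrite vrow -ab.
apply: sf_sum_inj => //; first exact: abs_entire2_transpose.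
apply/funext => z; have H := @sf_sum_col_cvg _ (transpose b) z (abs_entire2_transpose hb2).
by apply: cvgC_unique H _; rewrite -[transpose (transpose b)]/b -vrow; exact: vE.
Qed.

End SFMatrices.

(** * Primitives of power series *)

Section Primitive.
Variable R : realType.
Local Notation C := (CC R).

Lemma Rintegral_exprn k :
  \int[@lebesgue_measure R]_(t in `[0, 1]) (t ^+ k) = k.+1%:R^-1.
Proof.
have cX : continuous (fun t : R => k.+1%:R * t ^+ k).
  by move=> t; apply: cvgM; [exact: cvg_cst|exact: exprn_continuous].
have : \int[@lebesgue_measure R]_(t in `[0, 1]) (k.+1%:R * t ^+ k) = 1.
  rewrite /Rintegral (@continuous_FTC2 R _ (fun t => t ^+ k.+1))//.
  - by rewrite /= expr1n expr0n /= subr0.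
  - exact: continuous_subspaceT.
  - split; first by move=> t _; exact: exprn_derivable.
      by apply: cvg_at_right_filter; exact: exprn_continuous.
    by apply: cvg_at_left_filter; exact: exprn_continuous.
  - by move=> t _; rewrite exp_derive1.
rewrite RintegralZl//; last first.
  by apply: continuous_itv_integrable => t _; exact: exprn_continuous.
by move/(congr1 (fun x => k.+1%:R^-1 * x)); rewrite mulKf ?mulr1// pnatr_eq0.
Qed.

Definition int_coef (c : nat -> C) k : C := if k is j.+1 then c j / j.+1%:R else 0.

(** Termwise integration along the segment is uniform: [t * z] has modulus at most that of [z], so
    the tail of the absolute series at [z] bounds the remainder for all [t] in [0, 1]. *)
Lemma prim_pseries (c : nat -> C) h : abs_entire c -> pseries_of c h ->
  pseries_of (int_coef c) (prim h).
Proof.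
move=> ca hc z; have he := power_series_entire ca hc.
have [S hS] := ca _ (absC_ge0 z).
have [|T [hT _ TS]] := nneg_series_cvg _ hS.
  by move=> k; rewrite mulr_ge0 ?exprn_ge0 ?absC_ge0.
have ct : cont_on 0 1 (fun t : R => toC t 0 : C).
  move=> t _; apply/cvgCP => e e0; near=> x.
  have -> : toC t 0 - toC x 0 = toC (t - x) 0 :> C.
    by apply: CC_eqP; rewrite ?(reCB, imCB) /= ?subrr.
  by rewrite absC_toC; near: x; exact: cvgr_dist_lt.
have cX k : cont_on 0 1 (fun t : R => (toC t 0 : C) ^+ k).
  elim: k => [|k IH]; first exact: (@cont_on_cst R 0 1 1).
  have -> : (fun t : R => (toC t 0 : C) ^+ k.+1) = (fun t => toC t 0 * toC t 0 ^+ k).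
    by apply/funext => t; rewrite exprS.
  exact: cont_onM.
have ch : cont_on 0 1 (fun t : R => h (toC t 0 * z)).
  move=> t tI; have h1 : (fun t : R => toC t 0 * z) x @[x --> t] --> toC t 0 * z.
    by apply: cvgM; [exact: ct|exact: cvg_cst].
  have h2 : h x @[x --> toC t 0 * z] --> h (toC t 0 * z).
    by apply: cdiff_cvg; apply/cdiffP; exact: he.
  exact: (@cvg_comp _ _ _ (fun t : R => toC t 0 * z) h _ _ _ h1 h2).
have intX k : cint 0 1 (fun t : R => (toC t 0 : C) ^+ k) = toC k.+1%:R^-1 0.
  have E t : (toC t 0 : C) ^+ k = toC (t ^+ k) 0 by rewrite !toCE rmorphXn.
  rewrite /cint; congr toC.
    by rewrite -Rintegral_exprn; apply: eq_Rintegral => t _; rewrite E.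
  transitivity (\int[@lebesgue_measure R]_(t in `[0, 1]) (fun=> 0 : R) t).
    by apply: eq_Rintegral => t _; rewrite E.
  by rewrite /= Rintegral_cst// mul0r.
pose P N t : C := \sum_(0 <= k < N) (c k * z ^+ k) * toC t 0 ^+ k.
have intP N : cont_on 0 1 (P N) /\ cint 0 1 (P N) = \sum_(0 <= k < N) c k * z ^+ k / k.+1%:R.
  elim: N => [|N [IH1 IH2]].
    have -> : P 0%N = (fun=> 0 * 1) by apply/funext => t; rewrite /P big_geq// mul0r.
    split; first exact: cont_on_cst.
    by rewrite (cintZ 0 (@cont_on_cst R 0 1 1)) mul0r big_geq.
  have -> : P N.+1 = (fun t => P N t + (c N * z ^+ N) * toC t 0 ^+ N).
    by apply/funext => t; rewrite /P big_nat_recr.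
  have cN := cont_onM (@cont_on_cst R 0 1 (c N * z ^+ N)) (cX N).
  split; first exact: cont_onD.
  rewrite (cintD IH1 cN) IH2 (cintZ _ (cX N)) intX big_nat_recr//=.
  by rewrite natCE !toCE fmorphV.
(* The constant term of [int_coef c] is 0, so [N + 1] terms of the primitive correspond to [N] terms
   of [h]. *)
rewrite -(@cvg_shiftn 1 _ (series _)).
have tau0 : (fun N => absC z * (2 * (T - \sum_(0 <= k < N) absC (c k) * absC z ^+ k))) @ \oo --> 0.
  have -> : (fun N => absC z * (2 * (T - \sum_(0 <= k < N) absC (c k) * absC z ^+ k))) =
      (fun N => (absC z * 2) * (T - series (fun k => absC (c k) * absC z ^+ k) N)).
    by apply/funext => N; rewrite mulrA.
  rewrite [X in _ --> X](_ : 0 = absC z * 2 * (T - T)); last by rewrite subrr mulr0.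
  exact: (cvgM (@cvg_cst _ (absC z * 2 : R) _ \oo _) (cvgB (@cvg_cst _ T _ \oo _) hT)).
apply: (cvgC_dominated _ tau0) => N.
rewrite [X in absC (_ - X)](_ : _ = z * cint 0 1 (P N)); last first.
  rewrite -[LHS]/(series (fun k => int_coef c k * z ^+ k) (N + 1)%N) addn1 /series /=.
  rewrite big_nat_recl//= mul0r add0r (intP N).2 mulr_sumr.
  by apply: eq_bigr => k _; rewrite /= exprS; ring.
rewrite /prim -/(cint 0 1 (fun t => h (toC t 0 * z))) -mulrBr absCM ler_wpM2l ?absC_ge0//.
rewrite -(cintB ch (intP N).1).
have := @cint_bound R 0 1 (T - \sum_(0 <= k < N) absC (c k) * absC z ^+ k) _ ler01
  (cont_onB ch (intP N).1).
rewrite subr0 mulr1; apply => t /andP[t0 t1].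
have tz : absC (toC t 0 * z) <= absC z.
  by rewrite absCM absC_toC ger0_norm// ler_piMl ?absC_ge0.
have b N' : \sum_(0 <= k < N') absC (c k * (toC t 0 * z) ^+ k) <=
   \sum_(0 <= k < N') absC (c k) * absC z ^+ k.
  by apply: ler_sum => k _; rewrite absCM absCX ler_wpM2l ?absC_ge0// lerXn2r ?nnegrE ?absC_ge0.
have H := hc (toC t 0 * z).
have PE : P N t = \sum_(0 <= k < N) c k * (toC t 0 * z) ^+ k.
  by apply: eq_bigr => k _; rewrite exprMn; ring.
rewrite PE.
have H' : (fun M => series (fun k => c k * (toC t 0 * z) ^+ k) (M + N)%N -
    \sum_(0 <= k < N) c k * (toC t 0 * z) ^+ k) @ \oo -->
    h (toC t 0 * z) - \sum_(0 <= k < N) c k * (toC t 0 * z) ^+ k.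
  apply: cvgB; last exact: cvg_cst.
  by rewrite (@cvg_shiftn N _ (series _)).
apply: ler_absC_lim H' _ => M; rewrite /series /= (@big_cat_nat _ _ _ N 0 (M + N)) ?leq_addl//=.
rewrite addrAC subrr add0r (le_trans (absC_sum _ _ _))// lerBrDl.
apply: le_trans (TS (M + N)%N); rewrite [leRHS](@big_cat_nat _ _ _ N) ?leq_addl//= lerD2l.
by apply: ler_sum => k _; rewrite absCM absCX ler_wpM2l ?absC_ge0// lerXn2r ?nnegrE ?absC_ge0.
Unshelve. all: by end_near.
Qed.

End Primitive.

(** * The operators in matrix form *)

Section Operators.
Variable R : realType.
Local Notation C := (CC R).
Implicit Types (z w : C) (a b : nat -> nat -> C).

Definition shiftm a : nat -> nat -> C := fun n m => a n m.+1.
Definition intm a : nat -> nat -> C := fun n => int_coef (a n).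

Lemma sf_matrix_transpose a : sf_matrix a -> sf_matrix (transpose a).
Proof.
move=> [B hB]; exists B => N; rewrite exchange_big_nat /=; apply: le_trans (hB N).
by apply: ler_sum => n _; apply: ler_sum => m _; rewrite /sf_weight /transpose mulrCA.
Qed.

Lemma sf_weight_shiftm a n m : sf_weight (shiftm a) n m <= sf_weight a n m.+1.
Proof.
rewrite /sf_weight ler_wpM2l// ler_wpM2r ?exprn_ge0 ?absC_ge0// ler_nat.
by rewrite factS leq_pmull.
Qed.

(** The new factor is (m + 1)! / (m + 1)^2 = m! / (m + 1), at most m!. *)
Lemma sf_weight_intm a n m : sf_weight (intm a) n m.+1 <= sf_weight a n m.
Proof.
rewrite /sf_weight /= ler_wpM2l// absCM absCV absC_nat exprMn factS natrM.
have k0 : 0 < (m.+1%:R : R) by rewrite ltr0n.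
have k1 : 1 <= (m.+1%:R : R) by rewrite -[1](@mulr1n R) ler_nat.
rewrite (_ : _ * _ * _ = m`!%:R * absC (a n m) ^+ 2 * m.+1%:R^-1); last first.
  by move: (m.+1%:R : R) k0 => k k0; field; rewrite gt_eqF.
by rewrite ler_piMr ?mulr_ge0 ?exprn_ge0 ?absC_ge0// invf_le1.
Qed.

Lemma sf_matrix_shiftm a : sf_matrix a -> sf_matrix (shiftm a).
Proof.
move=> [B hB]; exists B => N; apply: le_trans (rect_sum_le (@sf_weight_ge0 _ a) hB N N.+1).
apply: ler_sum => n _; rewrite big_nat_recl//= ler_wpDl ?sf_weight_ge0//.
by apply: ler_sum => m _; exact: sf_weight_shiftm.
Qed.

Lemma sf_matrix_intm a : sf_matrix a -> sf_matrix (intm a).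
Proof.
move=> [B hB]; exists B => N; apply: le_trans (hB N); apply: ler_sum => n _.
apply: (@le_trans _ _ (\sum_(0 <= m < N.+1) sf_weight (intm a) n m)).
  by rewrite big_nat_recr//= ler_wpDr ?sf_weight_ge0.
have w0 : sf_weight (intm a) n 0 = 0 by rewrite /sf_weight absC0 expr0n !mulr0.
rewrite big_nat_recl//= w0 add0r.
by apply: ler_sum => m _; exact: sf_weight_intm.
Qed.

Lemma sf_matrix_lin (c : C) a b : sf_matrix a -> sf_matrix b ->
  sf_matrix (fun n m => c * a n m + b n m).
Proof.
move=> [A hA] [B hB]; exists (2 * (absC c ^+ 2 * A + B)) => N.
rewrite (le_trans _ (ler_wpM2l _ (lerD (ler_wpM2l (sqr_ge0 (absC c)) (hA N)) (hB N))))//.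
rewrite mulr_sumr -big_split mulr_sumr; apply: ler_sum => n _ /=.
rewrite mulr_sumr -big_split mulr_sumr; apply: ler_sum => m _ /=.
rewrite /sf_weight; have := absC_sqrD (c * a n m) (b n m).
rewrite absCM exprMn => h.
rewrite (_ : 2 * _ = n`!%:R * (m`!%:R *
  (2 * (absC c ^+ 2 * absC (a n m) ^+ 2 + absC (b n m) ^+ 2)))); last by ring.
by rewrite !ler_wpM2l.
Qed.

Lemma sf_sum_lin (c : C) a b z : sf_matrix a -> sf_matrix b ->
  sf_sum (fun n m => c * a n m + b n m) z = c * sf_sum a z + sf_sum b z.
Proof.
move=> sa sb; have [_ ha] := sf_sum_cvg (sf_matrix_abs_entire2 sa) z.
have [_ hb] := sf_sum_cvg (sf_matrix_abs_entire2 sb) z.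
have [_ h] := sf_sum_cvg (sf_matrix_abs_entire2 (sf_matrix_lin c sa sb)) z.
apply: cvgC_unique h _.
set f := (fun N => _); suff -> : f = (fun N =>
  c * (\sum_(0 <= n < N) \sum_(0 <= m < N) z^* ^+ n * (a n m * z ^+ m)) +
  \sum_(0 <= n < N) \sum_(0 <= m < N) z^* ^+ n * (b n m * z ^+ m)).
  exact: (cvgD (cvgM (@cvg_cst _ c _ \oo _) ha) hb).
apply/funext => N; rewrite /f mulr_sumr -big_split; apply: eq_bigr => n _ /=.
by rewrite mulr_sumr -big_split; apply: eq_bigr => m _ /=; ring.
Qed.

Lemma sf_row_shiftm a n z : abs_entire2 a -> abs_entire2 (shiftm a) ->
  sf_row a n z = a n 0%N + z * sf_row (shiftm a) n z.
Proof.
move=> ha hs; apply: csum_eq; rewrite -(@cvg_shiftS _ (series _)).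
set f := (fun N => _); suff -> : f = (fun N =>
  a n 0%N + z * series (fun m => shiftm a n m * z ^+ m) N).
  exact: (cvgD (@cvg_cst _ (a n 0%N) _ \oo _)
    (cvgM (@cvg_cst _ z _ \oo _) (@sf_row_cvg _ _ hs n z))).
apply/funext => N; rewrite /f /series /= big_nat_recl//= expr0 mulr1 mulr_sumr.
by congr (_ + _); apply: eq_bigr => m _; rewrite /shiftm exprS mulrCA.
Qed.

(** Each row is its constant term plus [z] times the shifted row; keeping the product instead of a
    quotient makes the identity valid at the origin too. *)
Lemma csum_sf_row0 a z : abs_entire2 a -> abs_entire2 (shiftm a) ->
  csum (fun n => z^* ^+ n * sf_row a n 0) = sf_sum a z - z * sf_sum (shiftm a) z.
Proof.
move=> ha hs; apply: csum_eq.
have [h1 _] := sf_sum_cvg ha z; have [h2 _] := sf_sum_cvg hs z.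
set f := series _; suff -> : f = (fun N => series (fun n => z^* ^+ n * sf_row a n z) N -
   z * series (fun n => z^* ^+ n * sf_row (shiftm a) n z) N).
  exact: (cvgB h1 (cvgM (@cvg_cst _ z _ \oo _) h2)).
apply/funext => N; rewrite /f /series /= mulr_sumr -sumrB; apply: eq_bigr => n _.
have := sf_row_shiftm n z ha hs; have := sf_row_shiftm n 0 ha hs.
move: (sf_row a n 0) (sf_row a n z) (sf_row (shiftm a) n z) => x0 x y -> ->.
by rewrite mul0r addr0; ring.
Qed.

(** The leading-part estimate in degree 0 makes [sf_sum a] continuous at 0, so the limit chosen by
    [extend0] there is the value of the sum. *)
Lemma extend0_sf_sum a (q : C -> C) : abs_entire2 a ->
  (forall z, z != 0 -> q z = sf_sum a z) -> extend0 q = sf_sum a.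
Proof.
move=> ha qE; apply/funext => z; rewrite /extend0; case: eqVneq => [->|]; last exact: qE.
have [//|S hS] := @sf_sum_leading _ a 0%N ha.
have h0 w : homog a 0 w = sf_sum a 0.
  have := hS 0; rewrite absC0 expr1 mulr0 => /(_ ler01).
  rewrite /homog !big_nat1 !expr0 => H; apply/eqP; rewrite eq_sym -subr_eq0 -absC_eq0.
  by rewrite eq_le H absC_ge0.
apply/cvg_lim => //; apply/cvgCP => e e0.
have S1 : 0 < `|S| + 1 by rewrite ltr_wpDl.
apply: (@near_absC _ _ 0 (Num.min 1 (e / (`|S| + 1)))); first by rewrite lt_min ltr01 divr_gt0.
move=> w; rewrite subr0 lt_min => /andP[w1 we] w0; rewrite qE// absC_dist -(h0 w).
apply: (le_lt_trans (hS w (ltW w1))); rewrite expr1.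
rewrite ltr_pdivlMr// in we; apply: le_lt_trans we; rewrite mulrC ler_wpM2l ?absC_ge0//.
by rewrite (le_trans (ler_norm _))// lerDl.
Qed.

Lemma Rinf_sum a : sf_matrix a -> Rinf (sf_sum a) = sf_sum (shiftm a).
Proof.
move=> sa; have ha := sf_matrix_abs_entire2 sa.
have hs := sf_matrix_abs_entire2 (sf_matrix_shiftm sa).
rewrite /Rinf sf_coef_sum//; apply: extend0_sf_sum => // z z0.
by rewrite csum_sf_row0// opprB addrC subrK mulKf.
Qed.

(** The row identity is used for the transposed matrix at the point [z^*] and carried back by
    [sf_sum_transpose]. *)
Lemma Linf_sum a : sf_matrix a ->
  Linf (sf_sum a) = sf_sum (transpose (shiftm (transpose a))).
Proof.
move=> sa; have ha := sf_matrix_abs_entire2 sa.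
have ht := abs_entire2_transpose ha.
have hs := sf_matrix_abs_entire2 (sf_matrix_shiftm (sf_matrix_transpose sa)).
have hst := abs_entire2_transpose hs.
rewrite /Linf sfbar_coef_sum//; apply: extend0_sf_sum => // z z0.
have := csum_sf_row0 z^* ht hs; rewrite conjCK => ->.
rewrite -(sf_sum_transpose z ha) (sf_sum_transpose z hst) opprB addrC subrK.
by rewrite mulKf// conjC_eq0.
Qed.

Lemma prim_sf_row a n z : sf_matrix a -> prim (sf_row a n) z = sf_row (intm a) n z.
Proof.
move=> sa; apply/esym/csum_eq.
apply: (@prim_pseries _ (a n)); first exact: fock_seq_abs_entire (sf_matrix_row n sa).
exact: (@sf_row_cvg _ _ (sf_matrix_abs_entire2 sa) n).
Qed.

Lemma Iinf_sum a : sf_matrix a -> Iinf (sf_sum a) = sf_sum (intm a).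
Proof.
move=> sa; apply/funext => z; rewrite /Iinf sf_coef_sum// /sf_sum; congr csum.
by apply/funext => n; rewrite prim_sf_row.
Qed.

Lemma Jinf_sum a : sf_matrix a ->
  Jinf (sf_sum a) = sf_sum (transpose (intm (transpose a))).
Proof.
move=> sa; have st := sf_matrix_transpose sa.
have hi := sf_matrix_abs_entire2 (sf_matrix_intm st).
apply/funext => z; rewrite /Jinf sfbar_coef_sum//.
rewrite (sf_sum_transpose z (abs_entire2_transpose hi)) /sf_sum; congr csum.
by apply/funext => n; rewrite prim_sf_row// conjCK.
Qed.

Lemma sf_norm2_transpose a : sf_matrix a ->
  sf_norm2 (sf_sum (transpose a)) = sf_norm2 (sf_sum a).
Proof.
move=> sa; rewrite !sf_norm2_sum//; last exact: sf_matrix_transpose.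
rewrite nneseries_interchange; last by move=> n m; rewrite lee_fin sf_weight_ge0.
apply: eq_eseriesr => n _; apply: eq_eseriesr => m _.
by rewrite /sf_weight /transpose mulrCA.
Qed.

(** The shift drops the column [m = 0] and lowers the weight (m + 1)! to m!. *)
Lemma sf_norm2_shiftm a : sf_matrix a ->
  (sf_norm2 (sf_sum (shiftm a)) <= sf_norm2 (sf_sum a))%E.
Proof.
move=> sa; rewrite !sf_norm2_sum//; last exact: sf_matrix_shiftm.
have w0 b n m : (0 <= (sf_weight b n m)%:E)%E by rewrite lee_fin sf_weight_ge0.
apply: lee_nneseries => [n _ _|n _]; first by apply: nneseries_ge0 => m _ _.
apply: nneseries_le_bound => // N.
apply: le_trans (nneseries_lim_ge N.+1 (fun m _ _ => w0 a n m)).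
rewrite [leRHS]big_nat_recl//= -[leLHS]add0e; apply: leeD => //.
by apply: lee_sum => m _; rewrite lee_fin sf_weight_shiftm.
Qed.

Lemma sf_norm2_fin a : sf_matrix a -> (sf_norm2 (sf_sum a) < +oo)%E.
Proof.
move=> sa; rewrite sf_norm2_sum//; have [B hB] := sa.
exact: le_lt_trans (nneseries2_le (@sf_weight_ge0 _ a) hB) (ltry _).
Qed.

Lemma sf_norm2_ge0 a : sf_matrix a -> (0 <= sf_norm2 (sf_sum a))%E.
Proof.
move=> sa; rewrite sf_norm2_sum//; apply: nneseries_ge0 => n _ _.
by apply: nneseries_ge0 => m _ _; rewrite lee_fin sf_weight_ge0.
Qed.

(** Absolute convergence follows by bounding a product of moduli by the sum of their squares. The
    limit over squares makes transposition and pairing with monomials immediate. *)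
Lemma sf_ip_cvg a b : sf_matrix a -> sf_matrix b ->
  (fun N => \sum_(0 <= n < N) \sum_(0 <= m < N) n`!%:R * (m`!%:R * (a n m * (b n m)^*))) @ \oo
    --> sf_ip (sf_sum a) (sf_sum b).
Proof.
move=> sa sb; have [A hA] := sa; have [B hB] := sb.
pose x n m : C := n`!%:R * (m`!%:R * (a n m * (b n m)^*)).
have xB N : \sum_(0 <= n < N) \sum_(0 <= m < N) absC (x n m) <= A + B.
  apply: le_trans (lerD (hA N) (hB N)).
  rewrite -big_split; apply: ler_sum => n _; rewrite -big_split; apply: ler_sum => m _ /=.
  rewrite /x /sf_weight !absCM !absC_nat absC_conj -!mulrDr !ler_wpM2l//.
  have := sqr_ge0 (absC (a n m) - absC (b n m)).
  have := mulr_ge0 (absC_ge0 (a n m)) (absC_ge0 (b n m)); nra.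
have [y [l [hy hl hsq]]] := double_series_cvg xB.
rewrite (sf_ip_sum sa sb).
suff -> : (fun n => n`!%:R * fock_ip (sf_row a n) (sf_row b n)) = y by rewrite (csum_eq hl).
apply/funext => n; apply: cvgC_unique _ (hy n).
have -> : series (x n) = (fun N => n`!%:R * series (fun m => m`!%:R * (a n m * (b n m)^*)) N).
  by apply/funext => N; rewrite /series /= mulr_sumr.
exact: (cvgM (@cvg_cst _ (n`!%:R : C) _ \oo _) (@fock_ip_row _ _ _ n sa sb)).
Qed.

Lemma sf_ip_transpose a b : sf_matrix a -> sf_matrix b ->
  sf_ip (sf_sum (transpose a)) (sf_sum (transpose b)) = sf_ip (sf_sum a) (sf_sum b).
Proof.
move=> sa sb; have h := sf_ip_cvg sa sb.
have ht := sf_ip_cvg (sf_matrix_transpose sa) (sf_matrix_transpose sb).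
apply: cvgC_unique ht _; set f := (fun N => _); set g := (fun N => _) in h.
suff -> : f = g by [].
apply/funext => N; rewrite /f /g exchange_big_nat /=.
by apply: eq_bigr => n _; apply: eq_bigr => m _; rewrite /transpose mulrCA.
Qed.

(* termwise, [(m + 1)! / (m + 1) = m!] *)
Lemma sf_ip_shiftm a b : sf_matrix a -> sf_matrix b ->
  sf_ip (sf_sum (shiftm a)) (sf_sum b) = sf_ip (sf_sum a) (sf_sum (intm b)).
Proof.
move=> sa sb; have ss := sf_matrix_shiftm sa; have si := sf_matrix_intm sb.
transitivity (csum (fun n => n`!%:R * fock_ip (sf_row (shiftm a) n) (sf_row b n))).
  exact: sf_ip_sum.
transitivity (csum (fun n => n`!%:R * fock_ip (sf_row a n) (sf_row (intm b) n))); last first.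
  exact/esym/sf_ip_sum.
apply: (congr1 (@csum R)); apply/funext => n; apply: (congr1 (fun x => n`!%:R * x)).
(* Shifting by one aligns position [m + 1] of [intm b] with position [m] of [b]; the entry at 0 is
   zero. *)
have h := @fock_ip_row _ _ _ n sa si; rewrite -(@cvg_shiftS _ (series _)) in h.
apply: cvgC_unique (@fock_ip_row _ _ _ n ss sb) _; set f := series _; set g := (fun N => _) in h.
suff -> : f = g by [].
apply/funext => N; rewrite /f /g /series /= big_nat_recl//= rmorph0 !mulr0 add0r.
apply: eq_bigr => m _; rewrite /shiftm /= rmorphM fmorphV rmorph_nat factS natrM.
have : (m.+1%:R : C) != 0 by rewrite pnatr_eq0.
by move: (m.+1%:R : C) => k k0; field.
Qed.

(** The matrix of the monomial of degree [n0] in conj z and [m0] in z. *)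
Definition delta n0 m0 : nat -> nat -> C := fun n m => ((n == n0) && (m == m0))%:R.

Lemma sf_matrix_delta n0 m0 : sf_matrix (delta n0 m0).
Proof.
exists (n0`!%:R * m0`!%:R) => N.
rewrite (eq_bigr (fun n => if n == n0 then \sum_(0 <= m < N)
   if m == m0 then n0`!%:R * m0`!%:R else 0 else 0)); last first.
  move=> n _; case: eqP => [->|/eqP nn]; last first.
    by apply: big1 => m _; rewrite /sf_weight /delta (negbTE nn) absC0 expr0n !mulr0.
  apply: eq_bigr => m _; rewrite /sf_weight /delta eqxx /=.
  by case: eqP => [->|_]; rewrite ?absC1 ?absC0 ?expr1n ?expr0n ?mulr1 ?mulr0.
rewrite -big_mkcond big_nat1_eq; case: ifP => _; last by rewrite mulr_ge0.
by rewrite -big_mkcond big_nat1_eq; case: ifP => _ //; rewrite mulr_ge0.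
Qed.

Lemma sf_ip_delta n0 m0 a : sf_matrix a ->
  sf_ip (sf_sum (delta n0 m0)) (sf_sum a) = n0`!%:R * (m0`!%:R * (a n0 m0)^*).
Proof.
move=> sa; have h := sf_ip_cvg (sf_matrix_delta n0 m0) sa.
(* After this shift every square contains the position [(n0, m0)], and the sequence of partial sums
   is constant. *)
rewrite -(@cvg_shiftn (n0 + m0).+1) in h.
apply: cvgC_unique h _; set f := (fun N => _); set l : C := _ * _.
suff -> : f = (fun=> l) by exact: cvg_cst.
apply/funext => N; rewrite /f.
rewrite (eq_bigr (fun n => if n == n0 then \sum_(0 <= m < N + (n0 + m0).+1)
   if m == m0 then l else 0 else 0)); last first.
  move=> n _; case: eqP => [->|/eqP nn]; last first.
    by apply: big1 => m _; rewrite /delta (negbTE nn) mul0r !mulr0.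
  apply: eq_bigr => m _; rewrite /delta eqxx /=.
  by case: eqP => [->|_]; rewrite ?mul1r ?mul0r ?mulr0.
rewrite -big_mkcond big_nat1_eq /= ifT; last by lia.
by rewrite -big_mkcond big_nat1_eq /= ifT//; lia.
Qed.

(** Common criterion for both pairs of operators. The adjoint vector is unique because pairing with
    a monomial returns the conjugate of one matrix entry, up to a nonzero factorial factor. *)
Lemma sf_adjoint_matrix (T S : (C -> C) -> (C -> C))
    (t s : (nat -> nat -> C) -> (nat -> nat -> C)) :
  (forall a, sf_matrix a -> sf_matrix (t a)) ->
  (forall a, sf_matrix a -> sf_matrix (s a)) ->
  (forall a, sf_matrix a -> T (sf_sum a) = sf_sum (t a)) ->
  (forall a, sf_matrix a -> S (sf_sum a) = sf_sum (s a)) ->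
  (forall (c : C) a b, t (fun n m => c * a n m + b n m) = fun n m => c * t a n m + t b n m) ->
  (forall a, sf_matrix a -> (sf_norm2 (sf_sum (t a)) <= sf_norm2 (sf_sum a))%E) ->
  (forall a b, sf_matrix a -> sf_matrix b ->
    sf_ip (sf_sum (t a)) (sf_sum b) = sf_ip (sf_sum a) (sf_sum (s b))) ->
  sf_adjoint T S.
Proof.
move=> mt ms TE SE tl tn ts; split; first split.
- by move=> f /SFP[a [sa ->]]; apply/SFP; exists (t a); split; [exact: mt|exact: TE].
- move=> c f g /SFP[a [sa ->]] /SFP[b [sb ->]].
  have E : (fun z => c * sf_sum a z + sf_sum b z) = sf_sum (fun n m => c * a n m + b n m).
    by apply/funext => z; apply/esym; exact: sf_sum_lin.
  rewrite (TE _ sa) (TE _ sb) E (TE _ (sf_matrix_lin c sa sb)) tl; apply/funext => z.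
  exact: (sf_sum_lin c z (mt _ sa) (mt _ sb)).
(* [t] does not increase the norm, so 1 is an operator bound; finiteness of both norms is checked
   because [sf_norm] passes through [fine]. *)
- exists 1 => f /SFP[a [sa ->]]; have sta := mt _ sa.
  rewrite mul1r (TE _ sa); apply: ler_wsqrtr.
  apply: (fine_le _ _ (tn _ sa)); apply/fin_numPlt; rewrite (lt_le_trans (ltNyr 0))/=.
  - exact: sf_norm2_fin.
  - exact: sf_norm2_ge0.
  - exact: sf_norm2_fin.
  - exact: sf_norm2_ge0.
- move=> g /SFP[b [sb ->]]; rewrite (SE _ sb); have sb' := ms _ sb.
  split; first by apply/SFP; exists (s b).
  move=> h /SFP[c [sc ->]]; split=> [H|->]; last first.
    by move=> f /SFP[a [sa ->]]; rewrite (TE _ sa) (ts _ _ sa sb).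
  congr sf_sum; apply/funext => n; apply/funext => m.
  have sd := sf_matrix_delta n m.
  have Sd : SF (sf_sum (delta n m)) by apply/SFP; exists (delta n m).
  have := H _ Sd; rewrite (TE _ sd) (ts _ _ sd sb) (sf_ip_delta n m sb') (sf_ip_delta n m sc).
  have nz k : (k`!%:R : C) != 0 by rewrite pnatr_eq0 -lt0n fact_gt0.
  move/(mulfI (nz n))/(mulfI (nz m))/(congr1 (@Num.conj _)).
  by rewrite !conjCK => ->.
Qed.

End Operators.

Theorem theorem2p22 (R : realType) :
  sf_adjoint (@Rinf R) (@Iinf R) /\ sf_adjoint (@Linf R) (@Jinf R).
Proof.
split.
  apply: (@sf_adjoint_matrix R _ _ (@shiftm R) (@intm R)).
  - exact: sf_matrix_shiftm.
  - exact: sf_matrix_intm.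
  - exact: Rinf_sum.
  - exact: Iinf_sum.
  - by [].
  - exact: sf_norm2_shiftm.
  - exact: sf_ip_shiftm.
apply: (@sf_adjoint_matrix R _ _ (fun a => transpose (shiftm (transpose a)))
  (fun a => transpose (intm (transpose a)))).
- by move=> a sa; apply: sf_matrix_transpose; apply: sf_matrix_shiftm; exact: sf_matrix_transpose.
- by move=> a sa; apply: sf_matrix_transpose; apply: sf_matrix_intm; exact: sf_matrix_transpose.
- exact: Linf_sum.
- exact: Jinf_sum.
- by [].
- move=> a sa; have sat := sf_matrix_transpose sa.
  rewrite (sf_norm2_transpose (sf_matrix_shiftm sat)) -(sf_norm2_transpose sa).
  exact: sf_norm2_shiftm.
- move=> a b sa sb; have sat := sf_matrix_transpose sa; have sbt := sf_matrix_transpose sb.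
  have -> := esym (sf_ip_transpose (sf_matrix_transpose (sf_matrix_shiftm sat)) sb).
  have -> := esym (sf_ip_transpose sa (sf_matrix_transpose (sf_matrix_intm sbt))).
  exact: sf_ip_shiftm.
Qed.
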